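(* Let $\Omega$ be a domain in $\mathbb{R}^N$, let $\mathscr{A}^{hk}(x)=\{a^{hk}_{ij}(x)\}$ ($1\le i,j\le m$, $1\le h,k\le N$) be $m\times m$ matrices with complex valued $L^\infty(\Omega)$ entries, and let $\varphi$ satisfy conditions (i)-(v) of the context. The operator $A=\partial_h(\mathscr{A}^{hk}(x)\partial_k)$ is strict $L^\Phi$-dissipative if and only if there exists $\kappa>0$ such that $$\operatorname{Re}\int_\Omega\Big(\langle\mathscr{A}^{hk}\partial_kv,\partial_hv\rangle+\Lambda(|v|)|v|^{-2}\langle(\mathscr{A}^{hk}-(\mathscr{A}^{kh})^* )v,\partial_hv\rangle\operatorname{Re}\langle v,\partial_kv\rangle-\Lambda^2(|v|)|v|^{-4}\langle\mathscr{A}^{hk}v,v\rangle\operatorname{Re}\langle v,\partial_kv\rangle\operatorname{Re}\langle v,\partial_hv\rangle\Big)dx\ge\kappa\int_\Omega|\nabla v|^2dx$$ for any $v\in[\mathring{H}^1(\Omega)]^m$.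
   Context: Conditions on $\varphi:(0,+\infty)\to(0,+\infty)$: (i) $\varphi\in C^1((0,+\infty))$; (ii) $(s\varphi(s))'>0$ for all $s>0$; (iii) the range of the strictly increasing function $s\varphi(s)$ is $(0,+\infty)$; (iv) there exist constants $C_1,C_2>0$, $r>-1$ and $s_0>0$ such that $C_1s^r\le(s\varphi(s))'\le C_2s^r$ for $s\in(0,s_0)$; if $r=0$ one requires moreover that the finite limit $\lim_{s\to0^+}\varphi(s)$ exists and is $>0$, and $\lim_{s\to0^+}s\varphi'(s)=0$; (v) there exists $s_1>s_0$ such that either $\varphi'(s)\ge0$ for all $s\ge s_1$ or $\varphi'(s)\le0$ for all $s\ge s_1$. The function $s\mapsto s\sqrt{\varphi(s)}$ is a strictly increasing bijection of $(0,+\infty)$ with $C^1$ inverse $\zeta(t)$; set $\Theta(t)=\zeta(t)/t$ and $\Lambda(t)=t\,\Theta'(t)/\Theta(t)$; equivalently $\Lambda(s\sqrt{\varphi(s)})=-\frac{s\varphi'(s)}{s\varphi'(s)+2\varphi(s)}$ for $s>0$. $\Phi(s)=\int_0^s\sigma\varphi(\sigma)d\sigma$ is only used in the name ''$L^\Phi$-dissipative''. Summation over repeated indices is understood; $\langle\cdot,\cdot\rangle$ is the standard Hermitian inner product of $\mathbb{C}^m$; $\mathscr{A}^*$ is the conjugate transpose. $\mathring{H}^1(\Omega)$ is the closure of the complex valued $C_c^\infty(\Omega)$ in the $H^1$ norm. In the integrand, terms containing $\Lambda(|v|)$ are taken to be zero on the set where $v$ vanishes. The operator $A$ is strict $L^\Phi$-dissipative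 if there exists $\kappa>0$ such that $\operatorname{Re}\int_\Omega\langle\mathscr{A}^{hk}\partial_ku,\partial_h(\varphi(|u|)u)\rangle dx\ge\kappa\int_\Omega|\nabla(\sqrt{\varphi(|u|)}\,u)|^2dx$ for any $u\in[\mathring{H}^1(\Omega)]^m$ such that $\varphi(|u|)u\in[\mathring{H}^1(\Omega)]^m$ (with $\varphi(|u|)u$ and $\sqrt{\varphi(|u|)}\,u$ set equal to $0$ where $u=0$; for such $u$ one has $\sqrt{\varphi(|u|)}\,u\in[\mathring{H}^1(\Omega)]^m$). *)

(* Defs.v *)
From HB Require Import structures.
From mathcomp Require Import all_boot all_order all_algebra.
From mathcomp Require Import complex.
From mathcomp Require Import all_classical all_reals all_analysis.

Set Implicit Arguments.
Unset Strict Implicit.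
Unset Printing Implicit Defensive.
Import Order.TTheory GRing.Theory Num.Theory.
Import numFieldTopology.Exports numFieldNormedType.Exports.

Local Open Scope classical_set_scope.
Local Open Scope complex_scope.
Local Open Scope sesquilinear_scope.
Local Open Scope ring_scope.

Section rV_measurable.
Context {R : realType}.
Variable n : nat.

Let coors : 'I_n -> 'rV[R]_n -> R := fun i x => x ord0 i.

Let rV_set0 : g_sigma_preimage coors set0.
Proof. exact: sigma_algebra0. Qed.

Let rV_setC A : g_sigma_preimage coors A -> g_sigma_preimage coors (~` A).
Proof. exact: sigma_algebraC. Qed.

Let rV_bigcup (F : _^nat) : (forall i, g_sigma_preimage coors (F i)) ->
  g_sigma_preimage coors (\bigcup_i (F i)).
Proof. exact: sigma_algebra_bigcup. Qed.

(* Borel sigma-algebra of R^n, generated by the coordinates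
   (as the library does for n.-tuple). *)
HB.instance Definition _ := @isMeasurable.Build default_measure_display
  'rV[R]_n (g_sigma_preimage coors) rV_set0 rV_setC rV_bigcup.

Lemma measurable_coor (i : 'I_n) :
  measurable_fun [set: 'rV[R]_n] (fun x : 'rV[R]_n => x ord0 i).
Proof.
move=> _ Y mY; rewrite setTI; apply: sub_sigma_algebra => /=.
rewrite -bigcup_seq/=; exists i => /=; first by rewrite mem_index_enum.
by exists Y => //; rewrite setTI.
Qed.

Lemma measurable_fun_rVP d (T : measurableType d) (f : T -> 'rV[R]_n) :
  measurable_fun [set: T] f <->
  forall i, measurable_fun [set: T] (fun x => f x ord0 i).
Proof.
split=> [mf i|mf].
  by apply: (measurableT_comp (measurable_coor i) mf).
apply: (@iffRL _ _ (iff_refl _)) => _ Y mY; rewrite setTI.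
suff : g_sigma_preimage coors `<=` [set Y | measurable (f @^-1` Y)].
  exact.
apply: smallest_sub.
  split; [by rewrite /= preimage_set0| |].
    by move=> A mA; rewrite /= setTD -preimage_setC; exact: measurableC.
  by move=> F mF; rewrite /= preimage_bigcup; exact: bigcupT_measurable.
rewrite -bigcup_seq => A [i _ [B mB <-]] /=.
by rewrite setTI -[X in measurable X]setTI; exact: mf.
Qed.

End rV_measurable.

Section lebesgueN.
Context {R : realType}.

Definition rV_cons n (p : measurableTypeR R * 'rV[R]_n) : 'rV[R]_n.+1 :=
  row_mx (const_mx p.1 : 'rV_1) p.2.

Lemma rV_cons0 n (p : measurableTypeR R * 'rV[R]_n) :
  rV_cons p ord0 ord0 = p.1.
Proof.
rewrite (_ : ord0 = lshift n (ord0 : 'I_1)); last exact/val_inj.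
by rewrite /rV_cons (row_mxEl (const_mx p.1 : 'rV_1)) mxE.
Qed.

Lemma rV_consS n (p : measurableTypeR R * 'rV[R]_n) (j : 'I_n) :
  rV_cons p ord0 (lift ord0 j) = p.2 ord0 j.
Proof.
rewrite (_ : lift ord0 j = rshift 1 j); last exact/val_inj.
by rewrite /rV_cons (row_mxEr (const_mx p.1 : 'rV_1)).
Qed.

Lemma measurable_rV_cons n : measurable_fun setT (@rV_cons n).
Proof.
apply/measurable_fun_rVP => i; case: (unliftP ord0 i) => [j|] ->; last first.
  by rewrite (_ : (fun x => _) = fst)//; apply/funext => x; rewrite rV_cons0.
rewrite (_ : (fun x => _) = (fun y : 'rV[R]_n => y ord0 j) \o snd).
  exact: (measurableT_comp (measurable_coor j) measurable_snd).
by apply/funext => x; rewrite rV_consS.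
Qed.

Section lebesgueNS.
Variables (n : nat) (mu : {sigma_finite_measure set 'rV[R]_n -> \bar R}).
Local Open Scope ereal_scope.

Definition lebesgueNS : set 'rV[R]_n.+1 -> \bar R :=
  pushforward (@lebesgue_measure R \x mu) (@rV_cons n).

Let pm := measure_function_pushforward__canonical__measure_function_Measure
  (@lebesgue_measure R \x mu) (@measurable_rV_cons n).

Let lebesgueNS0 : lebesgueNS set0 = 0.
Proof. exact: (measure0 pm). Qed.

Let lebesgueNS_ge0 A : 0 <= lebesgueNS A.
Proof. exact: (measure_ge0 pm). Qed.

Let lebesgueNS_sigma_additive : semi_sigma_additive lebesgueNS.
Proof. exact: (@measure_semi_sigma_additive _ _ _ pm). Qed.

HB.instance Definition _ := isMeasure.Build _ _ _ lebesgueNS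
  lebesgueNS0 lebesgueNS_ge0 lebesgueNS_sigma_additive.

Let lebesgueNS_sigma_finite : sigma_finite setT lebesgueNS.
Proof.
have [F TF Foo] : sigma_finite setT (@lebesgue_measure R \x mu).
  have /sigma_finiteP[F [TF ndF Foo]] := sigma_finiteT (@lebesgue_measure R).
  have /sigma_finiteP[G [TG ndG Goo]] := sigma_finiteT mu.
  exists (fun k => F k `*` G k).
    rewrite -setXTT TF TG predeqE => -[x y]; split=> [[/= [i _ Fx] [j _ Gy]]|].
      exists (maxn i j) => //; split.
        by move: x Fx; exact/subsetPset/ndF/leq_maxl.
      by move: y Gy; exact/subsetPset/ndG/leq_maxr.
    by move=> [i _ []/= ? ?]; split; exists i.
  move=> k; have [? ?] := Foo k; have [? ?] := Goo k.
  split; first exact: measurableX.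
  by rewrite product_measure1E// lte_mul_pinfty// ge0_fin_numE.
pose uncons (x : 'rV[R]_n.+1) : measurableTypeR R * 'rV[R]_n :=
  (x ord0 ord0, \row_j x ord0 (lift ord0 j)).
have consK : cancel (@rV_cons n) uncons.
  move=> p; rewrite /uncons rV_cons0 (_ : \row_j _ = p.2); first by case: p.
  by apply/rowP => j; rewrite mxE rV_consS.
have muncons : measurable_fun setT uncons.
  apply: measurable_fun_pair; first exact: measurable_coor.
  apply/measurable_fun_rVP => j.
  rewrite (_ : (fun x => _) = fun x : 'rV[R]_n.+1 => x ord0 (lift ord0 j)).
    exact: measurable_coor.
  by apply/funext => x; rewrite mxE.
exists (fun k => uncons @^-1` F k).
  by rewrite -preimage_bigcup -TF preimage_setT.
move=> k; have [mF Fk] := Foo k; split.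
  by rewrite -[X in measurable X]setTI; exact: muncons.
rewrite /lebesgueNS /pushforward (_ : _ @^-1` _ = F k)//.
by apply/seteqP; split => x; rewrite /preimage/= consK.
Qed.

HB.instance Definition _ := Measure_isSigmaFinite.Build _ _ _ lebesgueNS
  lebesgueNS_sigma_finite.

End lebesgueNS.

(* Product measure under the identification of R * R^n with R^(n+1). *)
Fixpoint lebesgueN n : {sigma_finite_measure set 'rV[R]_n -> \bar R} :=
  match n with
  | 0 => dirac (0 : 'rV[R]_0)
  | n'.+1 => lebesgueNS (lebesgueN n')
  end.

Lemma lebesgueN_box n (A : 'I_n -> set (measurableTypeR R)) :
  (forall i, measurable (A i)) ->
  lebesgueN n [set x : 'rV[R]_n | forall i, A i (x ord0 i)] =
  (\prod_(i < n) lebesgue_measure (A i))%E.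
Proof.
elim: n A => [|n ih] A mA.
  have Ax : [set x : 'rV[R]_0 | forall i, A i (x ord0 i)] 0 by case.
  by rewrite big_ord0 /= diracE mem_set.
have mB : measurable [set x : 'rV[R]_n | forall i, A (lift ord0 i) (x ord0 i)].
  rewrite (_ : [set x | _] = \bigcap_(i in [set: 'I_n])
      ((fun x : 'rV[R]_n => x ord0 i) @^-1` A (lift ord0 i))); last first.
    by apply/seteqP; split => x /= Ax i; [move=> _|]; exact: Ax.
  apply: fin_bigcap_measurable => // i _; rewrite -[X in measurable X]setTI.
  exact: (measurable_coor i measurableT (mA (lift ord0 i))).
rewrite big_ord_recl -ih//= /lebesgueNS /pushforward -product_measure1E//.
congr (_ _); apply/seteqP; split => p; rewrite /preimage/=.
  move=> Ap; split; first by have := Ap ord0; rewrite rV_cons0.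
  by move=> i; have := Ap (lift ord0 i); rewrite rV_consS.
move=> [A0 AS] i.
by case: (unliftP ord0 i) => [j|] ->; rewrite ?rV_cons0// rV_consS; exact: AS.
Qed.

End lebesgueN.

Section hermitian.
Context {R : realType} {m : nat}.
Implicit Types u v : 'cV[R[i]]_m.

(* Linear in the first argument: hdot u v = \sum_i u_i * conj v_i. *)
Definition hdot u v : R[i] := dotmx u^T v^T.

Lemma hdotE u v : hdot u v = \sum_i u i ord0 * conjc (v i ord0).
Proof.
rewrite /hdot dotmxE mxE; apply: eq_bigr => i _; rewrite !mxE.
by case: (v i ord0).
Qed.

Definition hnorm u : R := Num.sqrt (complex.Re (hdot u u)).

End hermitian.

Section sobolev.
Context {R : realType} {N : nat}.
Implicit Types (Omega : set 'rV[R]_N) (f g : 'rV[R]_N -> R[i]).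

Definition domain Omega := [/\ open Omega, connected Omega & Omega !=set0].

Definition cintegral Omega f : R[i] :=
  (\int[lebesgueN N]_(x in Omega) complex.Re (f x)) +i*
  (\int[lebesgueN N]_(x in Omega) complex.Im (f x)).

Definition cmeasurable Omega f :=
  measurable_fun Omega (fun x => complex.Re (f x)) /\
  measurable_fun Omega (fun x => complex.Im (f x)).

(* Functions are total on R^N, but only their values on Omega matter here. *)
Definition L2 Omega f :=
  cmeasurable Omega f /\
  (\int[lebesgueN N]_(x in Omega) (Normc.normc (f x) ^+ 2)%:E < +oo)%E.

Definition Linfty Omega f :=
  cmeasurable Omega f /\
  exists M : R,
    {ae lebesgueN N, forall x, Omega x -> Normc.normc (f x) <= M}.

(* Cn n f: f is of class C^n on R^N. *)
Fixpoint Cn (n : nat) (f : 'rV[R]_N -> R) : Prop :=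
  continuous f /\
  match n with
  | 0 => True
  | n'.+1 => forall k : 'I_N,
      (forall x, derivable f x 'e_k) /\ Cn n' (fun x => 'D_('e_k) f x)
  end.

Definition Ccinfty Omega f :=
  [/\ forall n, Cn n (fun x => complex.Re (f x)),
      forall n, Cn n (fun x => complex.Im (f x)),
      compact (closure [set x | f x != 0]) &
      closure [set x | f x != 0] `<=` Omega].

Definition partial (k : 'I_N) f (x : 'rV[R]_N) : R[i] :=
  'D_('e_k) (fun y => complex.Re (f y)) x +i*
  'D_('e_k) (fun y => complex.Im (f y)) x.

Definition is_wpartial Omega (k : 'I_N) f g :=
  L2 Omega g /\
  forall psi, Ccinfty Omega psi ->
    cintegral Omega (fun x => f x * partial k psi x) =
    - cintegral Omega (fun x => g x * psi x).

(* A chosen representative of the weak derivative (unique a.e. on Omega),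
   and 0 if there is none in L^2(Omega). *)
Definition wpartial Omega (k : 'I_N) f : 'rV[R]_N -> R[i] :=
  xget (fun=> 0) [set g | is_wpartial Omega k f g].

Definition H1 Omega f :=
  L2 Omega f /\ forall k, exists g, is_wpartial Omega k f g.

Definition H1norm Omega f : R :=
  Num.sqrt (\int[lebesgueN N]_(x in Omega) (Normc.normc (f x) ^+ 2)
    + \sum_(k < N) \int[lebesgueN N]_(x in Omega)
        (Normc.normc (wpartial Omega k f x) ^+ 2)).

Definition H10 Omega f :=
  H1 Omega f /\
  forall eps : R, 0 < eps ->
    exists2 psi, Ccinfty Omega psi & H1norm Omega (fun x => f x - psi x) < eps.

Section vector.
Context {m : nat}.
Implicit Types u : 'rV[R]_N -> 'cV[R[i]]_m.

Definition H10v Omega u := forall i : 'I_m, H10 Omega (fun x => u x i ord0).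

Definition wpartialv Omega (k : 'I_N) u (x : 'rV[R]_N) : 'cV[R[i]]_m :=
  \col_i wpartial Omega k (fun y => u y i ord0) x.

Definition dirichlet Omega u : R :=
  \int[lebesgueN N]_(x in Omega)
    (\sum_(k < N) hnorm (wpartialv Omega k u x) ^+ 2).

End vector.
End sobolev.

Section phi.
Context {R : realType}.
Variable phi : R -> R.

(* phi is total, but only its restriction to (0, +oo) is meaningful. *)
Definition phi_cond_C1 :=
  forall s, 0 < s -> derivable phi s 1 /\ {for s, continuous (derive1 phi)}.

Definition phi_cond_increasing :=
  forall s, 0 < s -> 0 < derive1 (fun t : R => t * phi t) s.

Definition phi_cond_range :=
  [set s * phi s | s in [set s : R | 0 < s]] = [set t : R | 0 < t].

Definition phi_cond_origin (s0 : R) :=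
  exists C1 C2 r : R,
    [/\ 0 < C1, 0 < C2, -1 < r,
        forall s, 0 < s < s0 ->
          C1 * s `^ r <= derive1 (fun t : R => t * phi t) s <= C2 * s `^ r &
        r = 0 ->
          (exists2 l : R, 0 < l & phi s @[s --> 0^'+] --> l) /\
          s * derive1 phi s @[s --> 0^'+] --> (0 : R)].

Definition phi_cond_infinity (s0 : R) :=
  exists2 s1 : R, s0 < s1 &
    (forall s, s1 <= s -> 0 <= derive1 phi s) \/
    (forall s, s1 <= s -> derive1 phi s <= 0).

Definition phi_admissible :=
  [/\ forall s, 0 < s -> 0 < phi s,
      phi_cond_C1, phi_cond_increasing, phi_cond_range &
      exists s0 : R, [/\ 0 < s0, phi_cond_origin s0 & phi_cond_infinity s0]].

(* The inverse of s |-> s * sqrt (phi s) on (0, +oo). *)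
Definition zeta (t : R) : R :=
  xget 0 [set s | 0 < s /\ s * Num.sqrt (phi s) = t].

Definition Theta (t : R) : R := zeta t / t.

Definition Lambda (t : R) : R := t * derive1 Theta t / Theta t.

End phi.

Section dissipativity.
Context {R : realType} {N m : nat}.

(* Where u x = 0 the value is 0, whatever f 0 is. *)
Definition nscale (f : R -> R) (u : 'rV[R]_N -> 'cV[R[i]]_m) :=
  fun x => (f (hnorm (u x)))%:C *: u x.

Definition strict_dissipative (Omega : set 'rV[R]_N)
    (A : 'I_N -> 'I_N -> 'rV[R]_N -> 'M[R[i]]_m) (phi : R -> R) :=
  exists2 kappa : R, 0 < kappa &
    forall u : 'rV[R]_N -> 'cV[R[i]]_m,
      H10v Omega u -> H10v Omega (nscale phi u) ->
      kappa * dirichlet Omega (nscale (fun s => Num.sqrt (phi s)) u) <=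
      complex.Re (cintegral Omega (fun x =>
        \sum_(h < N) \sum_(k < N)
          hdot (A h k x *m wpartialv Omega k u x)
               (wpartialv Omega h (nscale phi u) x))).

(* Where v x = 0 the two terms containing Lambda vanish: each has a factor
   hdot _ _ with v x as an argument (or its image under a matrix). *)
Definition transformed_integrand (Omega : set 'rV[R]_N)
    (A : 'I_N -> 'I_N -> 'rV[R]_N -> 'M[R[i]]_m) (phi : R -> R)
    (v : 'rV[R]_N -> 'cV[R[i]]_m) (x : 'rV[R]_N) : R[i] :=
  let dv k := wpartialv Omega k v x in
  let nv := hnorm (v x) in
  let rv k := complex.Re (hdot (v x) (dv k)) in
  \sum_(h < N) \sum_(k < N)
    (hdot (A h k x *m dv k) (dv h)
     + (Lambda phi nv * nv ^- 2)%:C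
       * hdot ((A h k x - (A k h x)^t*) *m v x) (dv h) * (rv k)%:C
     - (Lambda phi nv ^+ 2 * nv ^- 4)%:C
       * hdot (A h k x *m v x) (v x) * (rv k)%:C * (rv h)%:C).

End dissipativity.

(* Main.v *)
Require Import Defs.
From mathcomp Require Import all_boot all_order all_algebra.
From mathcomp Require Import complex ring lra.
From mathcomp Require Import all_classical all_reals all_analysis measurable_realfun.

(* Everything rests on one chain rule: if a and t |-> c t = (t a t)' are continuous
   and bounded on [0, +oo[ with a 0 = c 0, then p |-> a |p| p maps H10 into itself and
   d(a |p| p) = a dp + (c - a) Re <e, dp> e with e = p / |p|.  It is obtained by
   approximating p by test functions and a, c by polynomials in |p|^2.
   With v = sqrt (phi |u|) u, w = phi |u| u and theta = zeta |v| / |v| it gives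
   du = theta (dv + Lambda Re <e, dv> e) and dw = theta^-1 (dv - Lambda Re <e, dv> e),
   and the two quadratic forms coincide pointwise.
   For the transformed condition => dissipativity, u, v and w are all radial
   multiples of p = u + w in H10.  Conversely a given v in H10 need not come from
   an admissible u, so |v| is first replaced by the truncation cutoff n d |v|, with n
   so large that the corresponding u and w are radial multiples of v; then d -> 0 by
   dominated convergence, the derivatives of v vanishing a.e. where v = 0. *)

(** Multipliers must be bounded, and |u| / |v| need not be, so neither direction passes directly
    between u and v. The sum p = u + w suits every phi: s + s phi(s) has derivative at least 1, so
    |u| and |w| are nondecreasing and 1-Lipschitz in |p|; only the multiplier of v uses (iv) near 0
    and (v) near infinity. At zeros of p the multipliers of u, w, v are k, 1 - k and sqrt (k (1 -
    k)), so the forms agree there as well. In the converse, zeta t and t^2 / zeta t are the moduli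
    of u and w when |v| = t. Their logarithmic derivatives are 1 + Lambda and 1 - Lambda, which (iv)
    bounds below near 0 by some 1 / (q + 1). Hence both are O(t^(1/(q+1))), and a cutoff of order
    t^(2(q+1)) at 0 makes their quotients by t vanish there. Each multiplier may be unbounded as d
    -> 0, but their product is at most 1, which dominates the form. Polynomials are taken in |p|^2,
    not |p|, because they keep test functions smooth. Both directions preserve kappa. *)

Set Implicit Arguments.
Unset Strict Implicit.
Unset Printing Implicit Defensive.
Import Order.TTheory GRing.Theory Num.Theory.
Import numFieldTopology.Exports numFieldNormedType.Exports.

Local Open Scope classical_set_scope.
Local Open Scope complex_scope.
Local Open Scope ring_scope.

(** * Lebesgue measure on boxes and integration by parts *)

Section rV_topology.
Context {R : realType}.

Definition obox n (a b : 'rV[R]_n) : set 'rV[R]_n :=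
  [set x | forall i, a ord0 i < x ord0 i < b ord0 i].

Definition cbox n (a b : 'rV[R]_n) : set 'rV[R]_n :=
  [set x | forall i, a ord0 i <= x ord0 i <= b ord0 i].

Lemma obox_cbox n (a b : 'rV[R]_n) : obox a b `<=` cbox a b.
Proof. by move=> x xab i; have /andP[/ltW-> /ltW->] := xab i. Qed.

Lemma measurable_obox n (a b : 'rV[R]_n) : measurable (obox a b).
Proof.
rewrite (_ : obox a b = \bigcap_(i in [set: 'I_n])
    ((fun x : 'rV[R]_n => x ord0 i) @^-1` `]a ord0 i, b ord0 i[)); last first.
  apply/seteqP; split => x /= Ax i; first by move=> _; rewrite /= in_itv/= Ax.
  by have := Ax i I; rewrite /= in_itv.
apply: fin_bigcap_measurable => // i _; rewrite -[X in measurable X]setTI.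
by apply: measurable_coor => //; exact: measurable_itv.
Qed.

Lemma rV_ballP n (x : 'rV[R]_n) (e : R) (y : 'rV[R]_n) :
  0 < e -> (forall i, `|x ord0 i - y ord0 i| < e) -> ball x e y.
Proof. by move=> e0 xy; split => // i j; rewrite (ord1 i); exact: xy. Qed.

(* Centers in Q^n and radii 1/(k+1), enumerated by nat. *)
Lemma rV_box_basis n : exists2 ab : nat -> 'rV[R]_n * 'rV[R]_n,
  (forall j i, (ab j).1 ord0 i < (ab j).2 ord0 i) &
  forall U x, open U -> U x ->
    exists j, obox (ab j).1 (ab j).2 x /\ cbox (ab j).1 (ab j).2 `<=` U.
Proof.
pose c (j : nat) : 'rV[rat]_n * nat := odflt (0, 0%N) (unpickle j).
exists (fun j => (\row_i (ratr ((c j).1 ord0 i) - ((c j).2.+1%:R)^-1),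
                  \row_i (ratr ((c j).1 ord0 i) + ((c j).2.+1%:R)^-1))).
  move=> j i; rewrite /= !mxE.
  have : 0 < ((c j).2.+1%:R : R)^-1 by rewrite invr_gt0 ltr0n.
  by move: (ratr _) (_^-1) => u v v0; lra.
move=> U x oU Ux; have /nbhs_ballP[e /= e0 eU] := open_nbhs_nbhs (conj oU Ux).
have e20 : 0 < e / 2 by rewrite divr_gt0.
have [k _ /(_ k (leqnn k)) /= ke] := near_infty_natSinv_lt (PosNum e20).
set d := (k.+1%:R : R)^-1 in ke.
have d0 : 0 < d by rewrite /d invr_gt0 ltr0n.
have /choice[q qP] (i : 'I_n) : exists q : rat,
    ratr q \in `]x ord0 i - d, x ord0 i + d[.
  by apply: rat_in_itvoo; rewrite ltrBlDr -addrA ltrDl addr_gt0.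
exists (pickle (\row_i q i, k)).
have -> : c (pickle (\row_i q i, k)) = (\row_i q i, k) by rewrite /c pickleK.
split => [i|y yab].
  rewrite /= !mxE -/d; have := qP i; rewrite in_itv/=.
  by move: (ratr _) => u /andP[? ?]; lra.
apply: eU; apply: rV_ballP => // i.
have := yab i; rewrite /= !mxE -/d => /andP.
have := qP i; rewrite in_itv/= => /andP; move: (ratr _) => u [? ?] [? ?].
by rewrite ltr_norml; apply/andP; split; lra.
Qed.

(** The sigma-algebra is generated by the coordinates, so an open set is measurable as a countable
    union of open boxes. *)
Lemma open_measurable_rV n (U : set 'rV[R]_n) : open U -> measurable U.
Proof.
move=> oU; have [ab _ abU] := rV_box_basis n.
rewrite (_ : U = \bigcup_(j in [set j | cbox (ab j).1 (ab j).2 `<=` U])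
    obox (ab j).1 (ab j).2).
  by apply: bigcup_measurable => j _; exact: measurable_obox.
apply/seteqP; split => x.
  by move=> /(abU _ _ oU)[j [? ?]]; exists j.
by move=> [j /= jU /obox_cbox]; exact: jU.
Qed.

Lemma continuous_measurable_rV n (f : 'rV[R]_n -> R) :
  continuous f -> measurable_fun setT f.
Proof.
move=> /continuousP cf; apply: (measurability _ (RGenOpens.measurableE R)).
move=> _ [_ [a [b ->] <-]]; rewrite setTI.
by apply: open_measurable_rV; apply: cf; exact: interval_open.
Qed.

End rV_topology.

Section derive_affine.
Context {R : realType} {V W : normedModType R}.

(** The two difference quotients coincide, so differentiability is not assumed. This passes partial
    derivatives to the slices t |-> F (t, y) and y |-> F (t, y). *)
Lemma derive_affine (F : V -> R) (g : W -> V) (a w : W) (v : V) :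
  (forall h : R, g (h *: w + a) = h *: v + g a) ->
  'D_w (F \o g) a = 'D_v F (g a).
Proof.
by move=> gE; rewrite /derive; under eq_fun do rewrite /= gE.
Qed.

Lemma derivable_affine (F : V -> R) (g : W -> V) (a w : W) (v : V) :
  (forall h : R, g (h *: w + a) = h *: v + g a) ->
  derivable F (g a) v -> derivable (F \o g) a w.
Proof.
by move=> gE; rewrite /derivable; under [in X in _ -> X]eq_fun do rewrite /= gE.
Qed.

End derive_affine.

Section rV_cons_affine.
Context {R : realType} {n : nat}.
Implicit Types (t : R) (y : 'rV[R]_n).

Lemma shift_delta m (k i : 'I_m) (h : R) (z : 'rV[R]_m) :
  (h *: 'e_k + z) ord0 i = h * (i == k)%:R + z ord0 i.
Proof. by rewrite !mxE. Qed.

Lemma rVP m (x y : 'rV[R]_m) : (forall i, x ord0 i = y ord0 i) -> x = y.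
Proof. by move=> xy; apply/rowP. Qed.

Lemma rV_cons_affinel t y (h : R) :
  rV_cons (h *: 1 + t, y) = h *: 'e_ord0 + rV_cons (t, y).
Proof.
apply: rVP => i; rewrite shift_delta; case: (unliftP ord0 i) => [j|] ->.
  by rewrite !rV_consS mulr0 add0r.
by rewrite eqxx !rV_cons0 /= [_ *: _]mulr1 mulr1.
Qed.

Lemma rV_cons_affiner t y (k : 'I_n) (h : R) :
  rV_cons (t, h *: 'e_k + y) = h *: 'e_(lift ord0 k) + rV_cons (t, y).
Proof.
apply: rVP => i; rewrite shift_delta; case: (unliftP ord0 i) => [j|] ->.
  by rewrite !rV_consS/= shift_delta (inj_eq lift_inj).
by rewrite !rV_cons0/= mulr0 add0r.
Qed.

Lemma continuous_rV_consl y : continuous (fun t : R => rV_cons (t, y)).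
Proof.
move=> t; apply/cvg_ballP => e e0; near=> u; apply: rV_ballP => // i.
case: (unliftP ord0 i) => [j|] ->; first by rewrite !rV_consS subrr normr0.
rewrite !rV_cons0/=; near: u; exact: cvgr_dist_lt.
Unshelve. all: by end_near. Qed.

Lemma continuous_rV_consr t : continuous (fun y : 'rV[R]_n => rV_cons (t, y)).
Proof.
move=> y U /nbhs_ballP[e /= e0 eU].
apply: filterS (nbhsx_ballx y e e0) => z [_ yz]; apply: eU; apply: rV_ballP => // i.
case: (unliftP ord0 i) => [j|] ->; first by rewrite !rV_consS; exact: yz.
by rewrite !rV_cons0 subrr normr0.
Qed.

End rV_cons_affine.

Section bounded_support.
Context {R : realType}.

Lemma measurable_cbox n (a b : 'rV[R]_n) : measurable (cbox a b).
Proof.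
rewrite (_ : cbox a b = \bigcap_(i in [set: 'I_n])
    ((fun x : 'rV[R]_n => x ord0 i) @^-1` `[a ord0 i, b ord0 i])); last first.
  apply/seteqP; split => x /= Ax i; first by move=> _; rewrite /= in_itv/= Ax.
  by have := Ax i I; rewrite /= in_itv.
apply: fin_bigcap_measurable => // i _; rewrite -[X in measurable X]setTI.
by apply: measurable_coor => //; exact: measurable_itv.
Qed.

Lemma lebesgueN_cbox_lty n (a b : 'rV[R]_n) : (lebesgueN n (cbox a b) < +oo)%E.
Proof.
have -> : cbox a b = [set x | forall i, `[a ord0 i, b ord0 i]%classic (x ord0 i)].
  by apply/seteqP; split => x /= xab i; have := xab i; rewrite in_itv.
rewrite (lebesgueN_box (A := fun i => `[a ord0 i, b ord0 i]%classic))//.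
rewrite ltey_eq prode_fin_num// => i _.
by rewrite lebesgue_measure_itv/=; case: ifPn.
Qed.

Lemma bounded_support_integrable n (f : 'rV[R]_n -> R) (a b : 'rV[R]_n) (C : R) :
  measurable_fun setT f -> (forall x, `|f x| <= C) ->
  (forall x, ~ cbox a b x -> f x = 0) ->
  (lebesgueN n).-integrable setT (EFin \o f).
Proof.
move=> mf fC f0.
have -> : EFin \o f = (EFin \o f) \_ (cbox a b).
  apply/funext => x; rewrite patchE; case: ifPn => //= /negP xab.
  by rewrite f0// => /mem_set.
apply/integrable_restrict => //; first exact: measurable_cbox.
rewrite setTI; apply: measurable_bounded_integrable.
- exact: measurable_cbox.
- exact: lebesgueN_cbox_lty.
- exact: measurable_funTS.
- exists C; split; first exact: num_real.
  by move=> M CM x _ /=; exact: le_trans (fC x) (ltW CM).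
Qed.

Lemma closed_cbox n (a b : 'rV[R]_n) : closed (cbox a b).
Proof.
rewrite (_ : cbox a b = \bigcap_(i in [set: 'I_n])
    ((fun x : 'rV[R]_n => x ord0 i) @^-1` `[a ord0 i, b ord0 i])); last first.
  apply/seteqP; split => x /= Ax i; first by move=> _; rewrite /= in_itv/= Ax.
  by have := Ax i I; rewrite /= in_itv.
apply: closed_bigI => i _; apply: preimage_closed.
  by move=> x _; exact: coord_continuous.
exact: interval_closed.
Qed.

Lemma derive_out_support n (f : 'rV[R]_n -> R) (a b x v : 'rV[R]_n) :
  (forall x, ~ cbox a b x -> f x = 0) -> ~ cbox a b x -> 'D_v f x = 0.
Proof.
move=> f0 xab; rewrite (@near_eq_derive _ _ _ _ (cst 0)) ?derive_cst//.
have : nbhs x (~` cbox a b).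
  by apply: open_nbhs_nbhs; split => //; apply: closed_openC; exact: closed_cbox.
by apply: filterS => y /f0.
Qed.

Lemma integral_derive0 (F f : R -> R) (a b : R) : a < b ->
  (forall x : R, is_derive x 1 F (f x)) -> continuous f ->
  (forall x, ~ `[a, b]%classic x -> F x = 0) ->
  (\int[lebesgue_measure]_x (f x)%:E = 0)%E.
Proof.
move=> ab dF cf F0.
(* The interval is enlarged by 1 on each side, so that F vanishes at both endpoints in the
   fundamental theorem of calculus. *)
have f0 x : x \notin `[a - 1, b + 1] -> f x = 0.
  move=> /negP xab; have [_ <-] := dF x.
  rewrite (@near_eq_derive _ _ _ _ (cst 0)) ?derive_cst//.
  have : nbhs x (~` `[a, b]%classic).
    apply: open_nbhs_nbhs; split; first by apply: closed_openC; exact: interval_closed.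
    by move=> /=; rewrite in_itv/= => /andP[? ?]; apply: xab; rewrite in_itv/=; lra.
  by apply: filterS => y /F0.
have -> : (fun x => (f x)%:E) = (fun x => (f x)%:E) \_ `[a - 1, b + 1].
  apply/funext => x; rewrite patchE; case: ifPn => //= /negP xab.
  by rewrite f0//; apply/negP => ?; apply: xab; exact/mem_set.
rewrite -integral_mkcond (@continuous_FTC2 _ f F) => //; [|lra| | |].
- by rewrite !F0 ?subee//= in_itv/=; lra.
- exact: continuous_subspaceT.
- have cF : continuous F.
    by move=> x; apply: differentiable_continuous; apply/derivable1_diffP.
  split; first by move=> x _.
    by apply: cvg_at_right_filter; exact: cF.
  by apply: cvg_at_left_filter; exact: cF.
- by move=> x _; rewrite derive1E; have [_ <-] := dF x.
Qed.

Lemma integral_partial0 n (k : 'I_n) (F : 'rV[R]_n -> R) (a b : 'rV[R]_n)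
    (C : R) : (forall i, a ord0 i < b ord0 i) ->
  (forall x, derivable F x 'e_k) ->
  continuous (fun x => 'D_('e_k) F x) -> (forall x, `|'D_('e_k) F x| <= C) ->
  (forall x, ~ cbox a b x -> F x = 0) ->
  (\int[lebesgueN n]_x ('D_('e_k) F x)%:E = 0)%E.
Proof.
elim: n k F a b => [[]//|n ih] k F a b ab dF cdF bdF F0.
have Dint := bounded_support_integrable (continuous_measurable_rV cdF) bdF
  (fun x => @derive_out_support _ _ _ _ x _ F0).
pose a' : 'rV[R]_n := \row_j a ord0 (lift ord0 j).
pose b' : 'rV[R]_n := \row_j b ord0 (lift ord0 j).
have F0l t y : ~ `[a ord0 ord0, b ord0 ord0]%classic t -> F (rV_cons (t, y)) = 0.
  move=> tab; apply: F0 => /(_ ord0); rewrite rV_cons0 /= => tab'.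
  by apply: tab; rewrite /= in_itv.
have F0r t y : ~ cbox a' b' y -> F (rV_cons (t, y)) = 0.
  move=> yab; apply: F0 => tyab; apply: yab => j.
  by have := tyab (lift ord0 j); rewrite rV_consS !mxE.
pose G (p : measurableTypeR R * 'rV[R]_n) : \bar R := ('D_('e_k) F (rV_cons p))%:E.
have mD := continuous_measurable_rV cdF.
have mG : measurable_fun setT G.
  apply/measurable_EFinP.
  exact: (measurableT_comp mD (@measurable_rV_cons R n)).
rewrite /= /lebesgueNS.
have Gint : (lebesgue_measure \x lebesgueN n)%E.-integrable setT G.
  apply/integrableP; split => //; have /integrableP[_] := Dint.
  rewrite /= /lebesgueNS ge0_integral_pushforward//.
  - exact: measurable_rV_cons.
  - by apply/measurable_EFinP; apply: measurableT_comp.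
rewrite (@integral_pushforward _ _ _ _ _ _ (@measurable_rV_cons R n) _ setT
   (fun x => ('D_('e_k) F x)%:E)) //; [|exact/measurable_EFinP].
(* Fubini in the order that suits k: for a later coordinate the tail is integrated first and the
   induction hypothesis applies to each slice; for the first coordinate t is integrated first and
   the one-dimensional case applies. *)
case: (unliftP ord0 k) => [j|] kE.
  rewrite -integral12_prod_meas1//; apply: integral0_eq => t _.
  rewrite /fubini_F /=.
  have E y : 'D_('e_k) F (rV_cons (t, y)) =
      'D_('e_j) (fun y => F (rV_cons (t, y))) y.
    by rewrite kE -(derive_affine _ (rV_cons_affiner t y j)).
  rewrite /G; under eq_integral do rewrite E.
  apply: (ih _ _ a' b').
  - by move=> i; rewrite !mxE.
  - move=> y; apply: (derivable_affine (rV_cons_affiner t y j)).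
    by rewrite -kE.
  - under eq_fun do rewrite -E.
    by move=> y U /cdF; exact: continuous_rV_consr.
  - by move=> y; rewrite -E.
  - exact: F0r.
rewrite -integral21_prod_meas1//; apply: integral0_eq => y _.
rewrite /fubini_G /= /G.
apply: (@integral_derive0 (fun t => F (rV_cons (t, y))) _ (a ord0 ord0) (b ord0 ord0)) => //.
- move=> t; rewrite kE.
  have A := rV_cons_affinel t y.
  have E := @derive_affine _ _ _ F (fun t : R => rV_cons (t, y)) t 1 _ A.
  apply: DeriveDef; last exact: E.
  by apply: (derivable_affine A); rewrite -kE.
- by move=> t U /cdF; exact: continuous_rV_consl.
- by move=> t; exact: F0l.
Qed.

End bounded_support.

(** * Test functions *)

Section Cn_algebra.
Context {R : realType} {N : nat}.
Implicit Types f g : 'rV[R]_N -> R.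

Lemma continuous_mul f g : continuous f -> continuous g ->
  continuous (fun x => f x * g x).
Proof. by move=> cf cg x; apply: continuousM; [exact: cf|exact: cg]. Qed.

Lemma partialM f g (k : 'I_N) x :
  derivable f x 'e_k -> derivable g x 'e_k ->
  'D_('e_k) (fun x => f x * g x) x = f x * 'D_('e_k) g x + g x * 'D_('e_k) f x.
Proof. exact: deriveM. Qed.

Lemma partialD f g (k : 'I_N) x :
  derivable f x 'e_k -> derivable g x 'e_k ->
  'D_('e_k) (fun x => f x + g x) x = 'D_('e_k) f x + 'D_('e_k) g x.
Proof. exact: deriveD. Qed.

Lemma partial_cst (c : R) (k : 'I_N) (x : 'rV[R]_N) :
  'D_('e_k) (fun=> c) x = 0.
Proof. exact: derive_cst. Qed.

Lemma CnW n f : Cn n.+1 f -> Cn n f.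
Proof.
elim: n f => [|n ih] f; first by case=> cf _.
move=> [cf df]; split => // k; have [? ?] := df k; split => //.
exact: ih.
Qed.

Lemma Cn_cst n (c : R) : Cn n (fun _ : 'rV[R]_N => c).
Proof.
have cc (c' : R) : continuous (fun _ : 'rV[R]_N => c') by exact: cst_continuous.
elim: n c => [|n ih] c; split => //.
move=> k; split; first by move=> x; exact: derivable_cst.
by under eq_fun do rewrite partial_cst; exact: ih.
Qed.

Lemma CnD n f g : Cn n f -> Cn n g -> Cn n (fun x => f x + g x).
Proof.
elim: n f g => [|n ih] f g [cf df] [cg dg].
  by split => // x; apply: continuousD; [exact: cf|exact: cg].
split; first by move=> x; apply: continuousD; [exact: cf|exact: cg].
move=> k; have [df1 df2] := df k; have [dg1 dg2] := dg k.
split; first by move=> x; exact: derivableD.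
by under eq_fun do rewrite partialD//; exact: ih.
Qed.

Lemma CnM n f g : Cn n f -> Cn n g -> Cn n (fun x => f x * g x).
Proof.
elim: n f g => [|n ih] f g Cf Cg.
  have [cf df] := Cf; have [cg dg] := Cg.
  by split => // x; apply: continuousM; [exact: cf|exact: cg].
have [cf df] := Cf; have [cg dg] := Cg.
split; first by move=> x; apply: continuousM; [exact: cf|exact: cg].
move=> k; have [df1 df2] := df k; have [dg1 dg2] := dg k.
split; first by move=> x; exact: derivableM.
under eq_fun do rewrite partialM//.
by apply: CnD; apply: ih => //; exact: CnW.
Qed.

Lemma Cn_sum n (I : Type) (s : seq I) (F : I -> 'rV[R]_N -> R) :
  (forall i, Cn n (F i)) -> Cn n (fun x => \sum_(i <- s) F i x).
Proof.
move=> CF; elim: s => [|i s ih].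
  by under eq_fun do rewrite big_nil; exact: Cn_cst.
by under eq_fun do rewrite big_cons; exact: CnD.
Qed.

Lemma Cn_prod n (I : Type) (s : seq I) (F : I -> 'rV[R]_N -> R) :
  (forall i, Cn n (F i)) -> Cn n (fun x => \prod_(i <- s) F i x).
Proof.
move=> CF; elim: s => [|i s ih].
  by under eq_fun do rewrite big_nil; exact: Cn_cst.
by under eq_fun do rewrite big_cons; exact: CnM.
Qed.

Lemma Cn_horner n (p : {poly R}) f : Cn n f -> Cn n (fun x => p.[f x]).
Proof.
move=> Cf; elim/poly_ind: p => [|p c ih].
  by under eq_fun do rewrite horner0; exact: Cn_cst.
under eq_fun do rewrite hornerMXaddC.
by apply: CnD; [exact: CnM|exact: Cn_cst].
Qed.

Lemma partial_horner (p : {poly R}) f (k : 'I_N) x : derivable f x 'e_k ->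
  derivable (fun x => p.[f x]) x 'e_k /\
  'D_('e_k) (fun x => p.[f x]) x = p^`().[f x] * 'D_('e_k) f x.
Proof.
move=> df; elim/poly_ind: p => [|p c [ih1 ih2]].
  under eq_fun do rewrite horner0; rewrite partial_cst deriv0 horner0 mul0r.
  by split => //; exact: derivable_cst.
have dpf : derivable (fun x => p.[f x] * f x) x 'e_k by exact: derivableM.
have dc : derivable (fun _ : 'rV[R]_N => c) x 'e_k by exact: derivable_cst.
under eq_fun do rewrite hornerMXaddC.
split; first exact: derivableD.
rewrite (partialD dpf dc) partialM// ih2 partial_cst derivD derivM derivX derivC.
rewrite !addr0 mulr1 hornerD hornerMX.
by move: ('D_('e_k) f x) (p^`().[_]) => u v; ring.
Qed.

End Cn_algebra.

Section test_functions.
Context {R : realType} {N : nat}.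
Implicit Types (Omega : set 'rV[R]_N) (f g : 'rV[R]_N -> R).

Definition test_fun Omega f :=
  [/\ forall n, Cn n f, compact (closure [set x | f x != 0]) &
      closure [set x | f x != 0] `<=` Omega].

Lemma test_funD Omega f g : test_fun Omega f -> test_fun Omega g ->
  test_fun Omega (fun x => f x + g x).
Proof.
move=> [Cf cf fO] [Cg cg gO].
have fgS : closure [set x | f x + g x != 0] `<=`
    closure [set x | f x != 0] `|` closure [set x | g x != 0].
  rewrite -closureU; apply: closure_subset => x /=.
  have [->|] := eqVneq (f x) 0; last by left.
  by rewrite add0r; right.
split => [n| |].
- exact: CnD.
- by apply: subclosed_compact fgS; [exact: closed_closure|exact: compactU].
- by move=> x /fgS[/fO|/gO].
Qed.

Lemma test_funMl Omega f g : test_fun Omega f -> (forall n, Cn n g) ->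
  test_fun Omega (fun x => g x * f x).
Proof.
move=> [Cf cf fO] Cg.
have fgS : closure [set x | g x * f x != 0] `<=` closure [set x | f x != 0].
  by apply: closure_subset => x /=; rewrite mulf_eq0 negb_or => /andP[].
split => [n| |].
- exact: CnM.
- by apply: subclosed_compact fgS => //; exact: closed_closure.
- exact: subset_trans fO.
Qed.

Lemma test_fun0 Omega : test_fun Omega (fun=> 0).
Proof.
rewrite /test_fun; have -> : closure [set _ | (0 : R) != 0] = set0 :> set 'rV[R]_N.
  by rewrite -subset0 -closure0; apply: closure_subset => x /=; rewrite eqxx.
by split => [n| |//]; [exact: Cn_cst|exact: compact0].
Qed.

Lemma test_fun_support Omega f : test_fun Omega f ->
  exists a b : 'rV[R]_N, (forall i, a ord0 i < b ord0 i) /\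
    forall x, ~ cbox a b x -> f x = 0.
Proof.
move=> [_ /compact_bounded[M [_ MC]] _].
pose d := `|M| + 1.
have d0 : 0 < d by rewrite /d ltr_wpDl.
exists (const_mx (- d)), (const_mx d); split => [i|x xd].
  by rewrite !mxE; lra.
apply/eqP; apply: contra_notT xd => fx i; rewrite !mxE.
rewrite -ler_norml; apply: le_trans (_ : `|x| <= d).
  rewrite [leRHS]/Num.norm/= mx_normrE; apply/bigmax_geP; right => /=.
  by exists (ord0, i).
apply: MC; first by rewrite /d (le_lt_trans (ler_norm M))// ltrDl.
exact: subset_closure.
Qed.

Lemma cbox_compact (a b : 'rV[R]_N) : compact (cbox a b).
Proof.
rewrite (_ : cbox a b = [set x | forall i, `[a ord0 i, b ord0 i]%classic (x ord0 i)]).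
  apply: (@rV_compact R N (fun i => `[a ord0 i, b ord0 i]%classic)) => i.
  exact: segment_compact.
by apply/seteqP; split => x /= xab i; have := xab i; rewrite in_itv.
Qed.

Lemma bounded_of_support f (a b : 'rV[R]_N) : continuous f ->
  (forall x, ~ cbox a b x -> f x = 0) -> exists C, forall x, `|f x| <= C.
Proof.
move=> cf f0; have /compact_bounded[M [_ MC]] : compact (f @` cbox a b).
  apply: continuous_compact; last exact: cbox_compact.
  exact: continuous_subspaceT.
exists (`|M| + 1) => x.
have [xab|/f0->] := pselect (cbox a b x); last by rewrite normr0 addr_ge0.
by apply: MC; [rewrite (le_lt_trans (ler_norm M))// ltrDl|exists x].
Qed.

Lemma test_fun_out Omega f x : test_fun Omega f -> ~ Omega x ->
  f x = 0 /\ forall k, 'D_('e_k) f x = 0.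
Proof.
move=> [_ _ fO] Ox.
have nx : nbhs x (~` closure [set x | f x != 0]).
  apply: open_nbhs_nbhs; split; last by move=> /fO.
  by apply: closed_openC; exact: closed_closure.
have f0 : \near x, f x = 0.
  apply: filterS nx => y yf; apply/eqP; apply: contra_notT yf => fy.
  exact: subset_closure.
split; first exact: nbhs_singleton f0.
by move=> k; rewrite (@near_eq_derive _ _ _ _ (cst 0)) ?derive_cst.
Qed.

Lemma test_fun_deriv Omega f (k : 'I_N) : test_fun Omega f ->
  [/\ continuous f, forall x, derivable f x 'e_k &
      continuous (fun x => 'D_('e_k) f x)].
Proof.
move=> [Cf _ _]; have [cf df] := Cf 1%N; have [? [? _]] := df k.
by split.
Qed.

Lemma test_funM_integrable Omega f g : test_fun Omega f -> continuous g ->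
  (lebesgueN N).-integrable setT (EFin \o (fun x => f x * g x)).
Proof.
move=> tf cg; have [a [b [_ f0]]] := test_fun_support tf.
have [Cf _ _] := tf; have [cf _] := Cf 0%N.
have cfg : continuous (fun x => f x * g x).
  by move=> x; apply: continuousM; [exact: cf|exact: cg].
have fg0 x : ~ cbox a b x -> f x * g x = 0 by move=> /f0->; rewrite mul0r.
have [C fC] := bounded_of_support cfg fg0.
exact: (bounded_support_integrable (continuous_measurable_rV cfg) fC fg0).
Qed.

Lemma partial_integrable Omega f g (k : 'I_N) :
  test_fun Omega f -> continuous g ->
  (lebesgueN N).-integrable setT (EFin \o (fun x => 'D_('e_k) f x * g x)).
Proof.
move=> tf cg; have [a [b [_ f0]]] := test_fun_support tf.
have [_ _ cdf] := test_fun_deriv k tf.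
have cfg : continuous (fun x => 'D_('e_k) f x * g x).
  exact: (continuous_mul cdf cg).
have fg0 x : ~ cbox a b x -> 'D_('e_k) f x * g x = 0.
  by move=> xab; rewrite (derive_out_support _ f0 xab) mul0r.
have [C fC] := bounded_of_support cfg fg0.
exact: (bounded_support_integrable (continuous_measurable_rV cfg) fC fg0).
Qed.

(** No boundary term and no regularity of [Omega]: both integrands vanish off [Omega], and over the
    whole space the partial derivative of the test function f g has integral 0. *)
Lemma test_fun_ibp Omega f g (k : 'I_N) : test_fun Omega f -> test_fun Omega g ->
  \int[lebesgueN N]_(x in Omega) (f x * 'D_('e_k) g x) =
  - \int[lebesgueN N]_(x in Omega) ('D_('e_k) f x * g x).
Proof.
move=> tf tg; have [Cf _ _] := tf.
have [cf df cdf] := test_fun_deriv k tf; have [cg dg cdg] := test_fun_deriv k tg.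
rewrite Rintegral_mkcond [in RHS]Rintegral_mkcond.
have -> : (fun x => f x * 'D_('e_k) g x) \_ Omega = (fun x => f x * 'D_('e_k) g x).
  apply/funext => x; rewrite patchE; case: ifPn => // /negP xO.
  have xO' : ~ Omega x by move/mem_set.
  by have [-> _] := test_fun_out tf xO'; rewrite mul0r.
have -> : (fun x => 'D_('e_k) f x * g x) \_ Omega = (fun x => 'D_('e_k) f x * g x).
  apply/funext => x; rewrite patchE; case: ifPn => // /negP xO.
  have xO' : ~ Omega x by move/mem_set.
  by have [_ ->] := test_fun_out tf xO'; rewrite mul0r.
apply/eqP; rewrite -addr_eq0 -RintegralD//; last 2 first.
- exact: (test_funM_integrable tf cdg).
- exact: (partial_integrable k tf cg).
have thg : test_fun Omega (fun x => f x * g x) by exact: test_funMl.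
have [a [b [ab h0]]] := test_fun_support thg.
have [_ dh cdh] := test_fun_deriv k thg.
have [C hC] := bounded_of_support cdh
  (fun x => @derive_out_support _ _ _ _ _ x _ h0).
have := integral_partial0 ab dh cdh hC h0.
move=> h; apply/eqP; rewrite /Rintegral -[RHS]/(fine 0) -h; congr fine.
apply: eq_integral => x _.
by rewrite partialM// [X in _ + X]mulrC.
Qed.

End test_functions.

(** * The fundamental lemma of the calculus of variations *)

Lemma scaleRE (R : realType) (a b : R) : a *: b = a * b.
Proof. by []. Qed.

Section flat_function.
Context {R : realType}.
Implicit Types (p : {poly R}) (t : R).

(** The functions p(1/t) exp(-1/t), extended by 0, form a family closed under differentiation (p
    becomes X^2 (p - p')), so smoothness at 0 follows by induction on the order. *)
Definition hexp p t : R := if 0 < t then p.[t^-1] * expR (- t^-1) else 0.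

(** With s = 1/t the claim for the monomial of degree i is s^(i+1) <= (i+1)! exp s, a single term of
    the exponential series. *)
Lemma hexp_bound p : exists2 K, 0 <= K & forall t, `|hexp p t| <= K * `|t|.
Proof.
exists (\sum_(i < size p) `|p`_i| * i.+1`!%:R).
  by apply: sumr_ge0 => i _; rewrite mulr_ge0.
move=> t; rewrite /hexp; case: ifPn => [t0|_]; last first.
  by rewrite normr0 mulr_ge0// sumr_ge0// => i _; rewrite mulr_ge0.
rewrite horner_coef mulr_suml mulr_suml.
apply: le_trans (ler_norm_sum _ _ _) _; apply: ler_sum => i _.
rewrite -mulrA normrM -mulrA ler_wpM2l//.
set s := t^-1; have s0 : 0 < s by rewrite invr_gt0.
rewrite (gtr0_norm t0) -[t]invrK -/s.
rewrite ger0_norm ?mulr_ge0 ?expR_ge0 ?exprn_ge0 ?(ltW s0)//.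
rewrite expRN ler_pdivrMr ?expR_gt0// -(ler_pM2r s0) -exprSr.
rewrite (mulrAC _ _ (expR s)) mulfVK ?gt_eqF//.
have := expR_ge1Dxn i (ltW s0).
rewrite -ler_pdivrMl ?ltr0n ?fact_gt0// [_ / _]mulrC => h.
by apply: le_trans h; rewrite lerDr.
Qed.

Lemma hexpMX p t : hexp ('X * p) t * t = hexp p t.
Proof.
rewrite /hexp; case: ifPn => [t0|]; last by rewrite mul0r.
rewrite hornerM hornerX.
by field; rewrite gt_eqF.
Qed.

Lemma hexp_continuous0 p : {for 0, continuous (hexp p)}.
Proof.
have [K K0 pK] := hexp_bound p.
have h0 : hexp p 0 = 0 by rewrite /hexp ltxx.
apply/cvgrPdist_lt => e e0; near=> t; rewrite h0 sub0r normrN.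
apply: le_lt_trans (pK t) _.
have : `|t| < e / (K + 1).
  near: t; apply: cvgr0_norm_lt; first exact: cvg_id.
  by rewrite divr_gt0// ltr_wpDl.
rewrite ltr_pdivlMr ?ltr_wpDl// mulrC; apply: le_lt_trans.
by rewrite ler_wpM2r// lerDl.
Unshelve. all: by end_near. Qed.

Lemma is_derive_hexp p t :
  is_derive t 1 (hexp p) (hexp ('X^2 * (p - p^`())) t).
Proof.
have [t0|t0|->] := ltrgtP t 0.
- rewrite {2}/hexp ltNge (ltW t0)/=.
  apply: (@near_eq_is_derive R R R (cst 0)).
  near=> u; rewrite /hexp ltNge (_ : u <= 0)//.
  by apply: ltW; near: u; exact: lt_nbhsl.
- rewrite {2}/hexp t0.
  apply: (@near_eq_is_derive R R R (fun u => p.[u^-1] * expR (- u^-1))).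
    near=> u; rewrite /hexp (_ : 0 < u)//.
    by near: u; exact: lt_nbhsr.
  have tN0 : t != 0 by rewrite gt_eqF.
  have d1 : is_derive t 1 (fun u : R => u^-1) (- t ^- 2).
    have := @is_deriveV R id t 1 1 tN0 (is_derive_id _ _).
    by rewrite /= [_ *: _]mulr1.
  have d2 := @is_derive1_comp R (horner p) _ _ _ _ (is_derive_poly p t^-1) d1.
  have d3 := is_deriveN d1.
  have d4 := @is_derive1_comp R expR (fun u => - u^-1) t _ _
    (is_derive_expR (- t^-1)) d3.
  have d5 : is_derive t 1 (fun u : R => p.[u^-1] * expR (- u^-1)) _ :=
    is_deriveM d2 d4.
  apply: (@is_derive_eq _ _ _ _ _ _ _ _ d5).
  rewrite /= hornerM hornerXn hornerD hornerN !scaleRE /=.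
  move: (p^`().[t^-1]) (p.[t^-1]) (expR _) => u v w.
  by field.
(* At 0 the difference quotient of [hexp p] is [hexp ('X * p)], which belongs to the same family and
   is therefore continuous at 0 with value 0. *)
- apply/is_derive1_caratheodory; exists (hexp ('X * p)); split.
  + by move=> z; rewrite subr0 hexpMX {2}/hexp ltxx subr0.
  + exact: hexp_continuous0.
  + by rewrite /hexp ltxx.
Unshelve. all: by end_near. Qed.

Lemma Cn_hexp N n p (c d : R) (i : 'I_N) :
  Cn n (fun x : 'rV[R]_N => hexp p (c * x ord0 i + d)).
Proof.
have ch q : continuous (fun x : 'rV[R]_N => hexp q (c * x ord0 i + d)).
  move=> x.
  have cl : {for x, continuous (fun x : 'rV[R]_N => c * x ord0 i + d)}.
    apply: continuousD; last exact: cst_continuous.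
    by apply: continuousM; [exact: cst_continuous|exact: coord_continuous].
  apply: continuous_comp cl _; apply: differentiable_continuous.
  by apply/derivable1_diffP; case: (is_derive_hexp q (c * x ord0 i + d)).
have dh q k (x : 'rV[R]_N) :
  derivable (fun x : 'rV[R]_N => hexp q (c * x ord0 i + d)) x 'e_k /\
  'D_('e_k) (fun x : 'rV[R]_N => hexp q (c * x ord0 i + d)) x =
    c * (i == k)%:R * hexp ('X^2 * (q - q^`())) (c * x ord0 i + d).
  have A (h : R) : c * (h *: 'e_k + x) ord0 i + d =
      h *: (c * (i == k)%:R) + (c * x ord0 i + d).
    by rewrite shift_delta scaleRE; ring.
  have [dq1 dq2] := is_derive_hexp q (c * x ord0 i + d).
  have dq : differentiable (hexp q) (c * x ord0 i + d) by exact/derivable1_diffP.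
  split; first by apply: (derivable_affine A); exact: diff_derivable.
  rewrite (derive_affine (hexp q) A) deriveE//.
  by rewrite -[X in 'd _ _ X]mulr1 -scaleRE linearZ /= -deriveE// dq2.
elim: n p => [|n ih] p; split => // k; split; first by move=> x; have [] := dh p k x.
rewrite (_ : (fun x => _) = fun x : 'rV[R]_N =>
    c * (i == k)%:R * hexp ('X^2 * (p - p^`())) (c * x ord0 i + d)).
  by apply: CnM; [exact: Cn_cst|exact: ih].
by apply/funext => x; have [_] := dh p k x.
Qed.

Lemma hexp1_ge0 t : 0 <= hexp 1 t.
Proof. by rewrite /hexp; case: ifP => // _; rewrite hornerC mul1r expR_ge0. Qed.

Lemma hexp1_le1 t : hexp 1 t <= 1.
Proof.
rewrite /hexp; case: ifPn => // t0; rewrite hornerC mul1r -expR0 ler_expR.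
by rewrite oppr_le0 invr_ge0 ltW.
Qed.

Lemma hexp1_cvg t : 0 < t -> hexp 1 (n.+1%:R * t) @[n --> \oo] --> (1 : R).
Proof.
move=> t0; rewrite (_ : (fun n => _) = fun n : nat => expR (- (n.+1%:R^-1 * t^-1))).
  rewrite -[X in _ --> X]expR0 -[X in expR X]oppr0 -[X in - X](mul0r t^-1).
  apply: (@cvg_comp _ _ _ (fun n : nat => - (n.+1%:R^-1 / t)) expR);
    last exact: continuous_expR.
  apply: cvgN; apply: cvgMl; exact: cvg_harmonic.
apply/funext => n; rewrite /hexp mulr_gt0// hornerC mul1r invfM.
by [].
Qed.

End flat_function.

Section bump.
Context {R : realType} {N : nat}.
Implicit Types (a b x : 'rV[R]_N).

Lemma cvg_prod_seq (I : Type) (s : seq I) (u : I -> nat -> R) (l : I -> R) :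
  (forall i, u i n @[n --> \oo] --> l i) ->
  \prod_(i <- s) u i n @[n --> \oo] --> \prod_(i <- s) l i.
Proof.
move=> ul; elim: s => [|i s ih].
  by under eq_fun do rewrite big_nil; rewrite big_nil; exact: cvg_cst.
by under eq_fun do rewrite big_cons; rewrite big_cons; exact: cvgM.
Qed.

(** Smooth approximations of the indicator of the open box: values in [0, 1], zero off the box,
    tending to 1 inside as n grows. *)
Definition bump a b n x : R := \prod_(i < N)
  (hexp 1 (n.+1%:R * (x ord0 i - a ord0 i)) *
   hexp 1 (n.+1%:R * (b ord0 i - x ord0 i))).

Lemma bump_ge0_le1 a b n x : 0 <= bump a b n x <= 1.
Proof.
rewrite /bump; elim/big_rec : _ => [|i y _ /andP[y0 y1]]; first by rewrite lexx ler01.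
rewrite !mulr_ge0 ?hexp1_ge0//=.
by rewrite !mulr_ile1 ?mulr_ge0 ?hexp1_ge0 ?hexp1_le1.
Qed.

Lemma bump_out a b n x : ~ obox a b x -> bump a b n x = 0.
Proof.
move=> /existsNP[i xi]; rewrite /bump (bigD1 i)//= [X in X * _](_ : _ = 0) ?mul0r//.
apply/eqP; rewrite mulf_eq0 /hexp; apply/orP.
have [xa|xa] := ltP (a ord0 i) (x ord0 i).
  right; rewrite pmulr_rgt0// subr_gt0; case: ifPn => //.
  by move=> xb; exfalso; apply: xi; rewrite xa xb.
by left; rewrite pmulr_rgt0// subr_gt0 ltNge xa.
Qed.

Lemma bump_cvg a b x : obox a b x -> bump a b n x @[n --> \oo] --> (1 : R).
Proof.
move=> xab; rewrite /bump.
rewrite [X in _ --> X](_ : _ = \prod_(i < N) (1 * 1)); last first.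
  by rewrite big1// => i _; rewrite mulr1.
apply: cvg_prod_seq => i; have /andP[xa xb] := xab i.
by apply: cvgM; apply: hexp1_cvg; rewrite subr_gt0.
Qed.

Lemma test_fun_bump Omega a b n : cbox a b `<=` Omega ->
  test_fun Omega (bump a b n).
Proof.
move=> abO.
have S : closure [set x | bump a b n x != 0] `<=` cbox a b.
    rewrite [X in _ `<=` X](closure_id _).1; last exact: closed_cbox.
  apply: closure_subset => x /= bx; apply: obox_cbox.
  by apply: contrapT => /bump_out bx0; move: bx; rewrite bx0 eqxx.
split; last exact: subset_trans abO.
- move=> k; apply: Cn_prod => i; apply: CnM.
  + rewrite (_ : (fun x => _) = fun x : 'rV[R]_N =>
      hexp 1 (n.+1%:R * x ord0 i + - (n.+1%:R * a ord0 i))).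
      exact: Cn_hexp.
    by apply/funext => x; rewrite mulrBr.
  + rewrite (_ : (fun x => _) = fun x : 'rV[R]_N =>
      hexp 1 (- n.+1%:R * x ord0 i + n.+1%:R * b ord0 i)).
      exact: Cn_hexp.
    by apply/funext => x; rewrite mulrBr mulNr addrC.
- apply: subclosed_compact S; first exact: closed_closure.
  exact: cbox_compact.
Qed.

End bump.

Section obox_generates.
Context {R : realType} {N : nat}.

Definition oboxes : set (set 'rV[R]_N) :=
  [set obox ab.1 ab.2 | ab in [set: 'rV[R]_N * 'rV[R]_N]].

Lemma oboxI (a b c d : 'rV[R]_N) : obox a b `&` obox c d =
  obox (\row_i Num.max (a ord0 i) (c ord0 i))
       (\row_i Num.min (b ord0 i) (d ord0 i)).
Proof.
apply/seteqP; split => x.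
  move=> [xab xcd] i; rewrite !mxE gt_max lt_min.
  by have /andP[-> ->] := xab i; have /andP[-> ->] := xcd i.
move=> xm; split => i; have := xm i; rewrite !mxE gt_max lt_min.
  by move=> /andP[/andP[-> _] /andP[-> _]].
by move=> /andP[/andP[_ ->] /andP[_ ->]].
Qed.

Lemma oboxes_setI : setI_closed oboxes.
Proof.
move=> _ _ [[a b] _ <-] [[c d] _ <-] /=; rewrite oboxI.
by exists (\row_i Num.max (a ord0 i) (c ord0 i),
           \row_i Num.min (b ord0 i) (d ord0 i)).
Qed.

Lemma oboxes_open (U : set 'rV[R]_N) : open U -> <<s oboxes >> U.
Proof.
move=> oU; have [ab _ abU] := @rV_box_basis R N.
have mB : @measurable _ (g_sigma_algebraType oboxes)
    (\bigcup_(j in [set j | cbox (ab j).1 (ab j).2 `<=` U])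
      obox (ab j).1 (ab j).2).
  apply: bigcup_measurable => j _.
  by apply: sub_sigma_algebra; exists (ab j).
suff -> : U = \bigcup_(j in [set j | cbox (ab j).1 (ab j).2 `<=` U])
    obox (ab j).1 (ab j).2 by exact: mB.
apply/seteqP; split => x.
  by move=> /(abU _ _ oU)[j [? ?]]; exists j.
by move=> [j /= jU /obox_cbox]; exact: jU.
Qed.

(** Open boxes are stable under intersection and generate the measurable sets, so an identity
    between integrals need only be checked on boxes. *)
Lemma oboxes_measurable : @measurable _ 'rV[R]_N = <<s oboxes >>.
Proof.
apply/seteqP; split; last first.
  apply: smallest_sub; first exact: sigma_algebra_measurable.
  by move=> _ [[a b] _ <-]; exact: measurable_obox.
apply: smallest_sub; first exact: smallest_sigma_algebra.
rewrite -bigcup_seq => A [i _ [B mB <-]] /=.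
have mi : measurable_fun [set: g_sigma_algebraType oboxes]
    (fun x : g_sigma_algebraType oboxes => (x : 'rV[R]_N) ord0 i).
  apply: (measurability _ (RGenOpens.measurableE R)).
  move=> _ [_ [c [d ->] <-]]; rewrite setTI; apply: oboxes_open.
  have /continuousP := @coord_continuous R 1 N ord0 i.
  by apply; exact: interval_open.
exact: mi.
Qed.

End obox_generates.

Section fundamental_lemma.
Context {R : realType} {N : nat}.
Variables (Omega : set 'rV[R]_N) (g : 'rV[R]_N -> R).
Notation mu := (lebesgueN N).
Hypothesis oO : open Omega.
Hypothesis gint : forall a b, cbox a b `<=` Omega ->
  mu.-integrable (cbox a b) (EFin \o g).
Hypothesis g0 : forall psi, test_fun Omega psi ->
  \int[mu]_(x in Omega) (g x * psi x) = 0.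

Let gint_obox a b : cbox a b `<=` Omega -> mu.-integrable (obox a b) (EFin \o g).
Proof.
move=> abO; apply: integrableS (gint abO) => //; last exact: obox_cbox.
- exact: measurable_cbox.
- exact: measurable_obox.
Qed.

(** Test against the bumps of the box and let n grow; |g| dominates. *)
Let obox0 a b : cbox a b `<=` Omega -> \int[mu]_(x in obox a b) g x = 0.
Proof.
move=> abO; have mo := measurable_obox a b.
have mg : measurable_fun (obox a b) g.
  by apply/measurable_EFinP; case/integrableP: (gint_obox abO).
have mb n : measurable_fun (obox a b) (bump a b n).
  apply: measurable_funTS; apply: continuous_measurable_rV.
  by have [/(_ 0%N)[]] := test_fun_bump n abO.
have gb n : (\int[mu]_(x in obox a b) (g x * bump a b n x)%:E = 0)%E.
  have := g0 (test_fun_bump n abO).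
  rewrite Rintegral_mkcond (_ : _ \_ _ = (fun x => g x * bump a b n x) \_ (obox a b)).
    rewrite -Rintegral_mkcond /Rintegral => h; rewrite -[LHS]fineK ?h//.
    apply: integrable_fin_num => //.
    apply: le_integrable (gint_obox abO) => //.
      exact/measurable_EFinP/measurable_funM.
    move=> x _ /=; rewrite lee_fin normrM ler_piMr//.
    by have /andP[b0 b1] := bump_ge0_le1 a b n x; rewrite ger0_norm.
  apply/funext => x; rewrite !patchE.
  have [/set_mem xab|/negP xab] := boolP (x \in obox a b).
    by rewrite mem_set//; exact/abO/obox_cbox.
  by rewrite bump_out ?mulr0; [case: ifP|move/mem_set].
have [|||||_ _] := @dominated_convergence _ _ R mu (obox a b) mo
  (fun n x => (g x * bump a b n x)%:E) (EFin \o g) (fun x => `|g x|%:E).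
- by move=> n; exact/measurable_EFinP/measurable_funM.
- exact/measurable_EFinP.
- apply: aeW => x xab; apply/cvg_EFin; first exact: nearW.
  rewrite /comp /= -[X in _ --> X]mulr1.
  by apply: cvgM; [exact: cvg_cst|exact: bump_cvg].
- by have := integrable_abse (gint_obox abO).
- apply: aeW => x n _; rewrite /= lee_fin normrM ler_piMr//.
  by have /andP[b0 b1] := bump_ge0_le1 a b n x; rewrite ger0_norm.
under eq_fun do rewrite gb.
by move=> /cvg_lim; rewrite lim_cst// /Rintegral => <-.
Qed.

(** Dynkin's theorem: the sets S with this property contain the boxes and are stable under
    complement and countable disjoint union. *)
Let measurable0 a b S : cbox a b `<=` Omega -> measurable S ->
  \int[mu]_(x in S `&` obox a b) g x = 0.
Proof.
move=> abO; have mo := measurable_obox a b; have go := gint_obox abO.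
have gS T : measurable T -> mu.-integrable (T `&` obox a b) (EFin \o g).
  by move=> mT; apply: integrableS go => //; exact: measurableI.
rewrite oboxes_measurable; move: S.
apply: (dynkin_induction oboxes_measurable oboxes_setI).
- by rewrite setTI; exact: obox0.
- move=> _ [[c d] _ <-] /=; rewrite oboxI; apply: obox0.
  move=> x xm; apply: abO => i; have := xm i.
  rewrite !mxE ge_max le_min.
  by move=> /andP[/andP[_ ->] /andP[_ ->]].
- move=> S mS PS; have := obox0 abO.
  have -> : obox a b = (S `&` obox a b) `|` (~` S `&` obox a b).
    by rewrite -setIUl setUv setTI.
  rewrite Rintegral_setU ?PS ?add0r//.
  + by rewrite -setIUl setUv setTI.
  + exact: measurableI.
  + by apply: measurableI => //; exact: measurableC.
  + by rewrite -setIUl setUv setTI.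
  + by apply/disj_setPS => x [[Sx _] [nSx _]].
- move=> F mF tF PF; rewrite setI_bigcupl /Rintegral integral_bigcup//.
  + rewrite eseries0// => n _ _; rewrite -[LHS]fineK ?[fine _]PF//.
    by apply: integrable_fin_num (gS _ (mF n)); exact: measurableI.
  + exact: trivIset_setIr.
  + by move=> k; exact: measurableI.
  + by rewrite -setI_bigcupl; apply: gS; exact: bigcupT_measurable.
Qed.

Let ae_obox a b : cbox a b `<=` Omega ->
  mu.-negligible [set x | obox a b x /\ g x != 0].
Proof.
move=> abO; have mo := measurable_obox a b.
have mg : measurable_fun (obox a b) g.
  by apply/measurable_EFinP; case/integrableP: (gint_obox abO).
(* On the set where s g > 0 the integral of |s g| is s times the integral of g, which is 0. The
   cases s = 1 and s = -1 together cover g <> 0. *)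
have half (s : R) : mu.-negligible [set x | obox a b x /\ 0 < s * g x].
  pose S := obox a b `&` (fun x => s * g x) @^-1` `]0, +oo[.
  have mS : measurable S by exact: measurable_funM.
  have SE : S = S `&` obox a b by rewrite /S setIAC setIid.
  have mgS : measurable_fun S g by apply: measurable_funS mg => // x [].
  have gS : mu.-integrable S (EFin \o g).
    by apply: integrableS (gint_obox abO) => // x [].
  have S0 : (\int[mu]_(x in S) `|(s * g x)%:E| = 0)%E.
    transitivity (\int[mu]_(x in S) (s%:E * (g x)%:E))%E.
      apply: eq_integral => x /set_mem[_ /=]; rewrite in_itv/= andbT => sg.
      by rewrite gtr0_norm// EFinM.
    rewrite integralZl// -[X in (_ * X)%E]fineK; last exact: integrable_fin_num.
    have := measurable0 abO mS; rewrite -SE /Rintegral => ->.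
    by rewrite mule0.
  have /ae_eq_integral_abs : measurable_fun S (EFin \o (fun x => s * g x)).
    by apply/measurable_EFinP; exact: measurable_funM.
  move=> /(_ mu mS)[/(_ S0)] [A [mA A0 SA]] _.
  exists A; split => // x [xab sg]; apply: SA => /= /(_ _)/wrap[].
    by split => //=; rewrite in_itv/= sg.
  by move=> -[] sg0; move: sg; rewrite sg0 ltxx.
have := negligibleU (half 1) (half (-1)); apply: negligibleS => x [xab].
rewrite neq_lt => /orP[g0'|g0']; [right|left]; split => //.
  by rewrite mulN1r oppr_gt0.
by rewrite mul1r.
Qed.

(** Countably many boxes whose closed versions lie in [Omega] cover [Omega], so the null sets of the
    boxes add up to a null set. *)
Lemma test_fun_orthogonal0 : {ae mu, forall x, Omega x -> g x = 0}.
Proof.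
have [ab _ abO] := @rV_box_basis R N.
pose F (j : nat) := if pselect (cbox (ab j).1 (ab j).2 `<=` Omega)
  then [set x | obox (ab j).1 (ab j).2 x /\ g x != 0] else set0.
have : mu.-negligible (\bigcup_j F j).
  apply: negligible_bigcup => j; rewrite /F; case: pselect => jO; last exact: negligible_set0.
  exact: ae_obox.
apply: negligibleS => x /= /not_implyP[Ox gx].
have [j [xj jO]] := abO _ _ oO Ox; exists j => //.
by rewrite /F; case: pselect => // jO0; split => //; exact/eqP.
Qed.

End fundamental_lemma.

(** * Polynomial approximation of radial multipliers *)

Section continuity.
Context {R : realType} {T : topologicalType}.
Implicit Types f g : T -> R.

Lemma cont_add f g : continuous f -> continuous g ->
  continuous (fun x => f x + g x).
Proof. by move=> cf cg x; apply: continuousD; [exact: cf|exact: cg]. Qed.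

Lemma cont_sub f g : continuous f -> continuous g ->
  continuous (fun x => f x - g x).
Proof. by move=> cf cg x; apply: continuousB; [exact: cf|exact: cg]. Qed.

Lemma cont_mul f g : continuous f -> continuous g ->
  continuous (fun x => f x * g x).
Proof. by move=> cf cg x; apply: continuousM; [exact: cf|exact: cg]. Qed.

Lemma cont_cst (k : R) : continuous (fun _ : T => k).
Proof. exact: cst_continuous. Qed.

Lemma cont_inv f : (forall x, f x != 0) -> continuous f ->
  continuous (fun x => (f x)^-1).
Proof. by move=> f0 cf x; apply: continuousV; [exact: f0|exact: cf]. Qed.

Lemma cont_comp f (h : R -> R) : continuous f -> continuous h ->
  continuous (fun x => h (f x)).
Proof. by move=> cf ch x; apply: continuous_comp; [exact: cf|exact: ch]. Qed.

End continuity.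

(** * Bernstein polynomials and the Weierstrass theorem *)

Section weierstrass.
Context {R : realType}.
Implicit Types (f : R -> R) (x y : R).

(** Only x is confined to the compact interval. The point y may lie outside it, as happens below for
    shifts s + d past the right end. *)
Lemma continuous_compact_uniform f (a b e : R) : continuous f -> 0 < e ->
  exists2 d, 0 < d & forall x y, x \in `[a, b] -> `|x - y| < d -> `|f x - f y| < e.
Proof.
move=> cf e0.
have /compact_near_coveringP cab := @segment_compact R a b.
have [|d /= d0 dP] := cab _ (0 : R)^'+
    (fun d x => forall y, `|x - y| < d -> `|f x - f y| < e) _.
  move=> x _; have e20 : 0 < e / 2 by rewrite divr_gt0.
  have /cvgrPdist_lt/(_ _ e20)/nbhs_ballP[r /= r0 rP] := cf x.
  have r20 : 0 < r / 2 by rewrite divr_gt0.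
  exists (ball x (r / 2), [set d | d < r / 2]).
    split; first exact: nbhsx_ballx.
    by apply: nbhs_right_lt.
  move=> [z d] /= [xz dr] y zy.
  have fz : `|f x - f z| < e / 2.
    by apply: rP; rewrite /ball/= in xz *; lra.
  have fy : `|f x - f y| < e / 2.
    apply: rP; rewrite /ball/= in xz *.
    by have := ler_distD z x y; lra.
  have := ler_distD (f x) (f z) (f y); rewrite (distrC (f z) (f x)); lra.
exists (d / 2); first by rewrite divr_gt0.
move=> x y xab xy; apply: (dP (d / 2)) => //.
- by rewrite /= /ball/= sub0r normrN gtr0_norm ?divr_gt0//; lra.
- by rewrite divr_gt0.
Qed.

(** The binomial law with n trials and success probability x. The lemmas [sum_bern], [mean_bern] and
    [var_bern] give its total mass, mean and variance. *)
Definition bern (n k : nat) x : R := x ^+ k * (1 - x) ^+ (n - k) *+ 'C(n, k).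

Lemma bern_ge0 n k x : 0 <= x <= 1 -> 0 <= bern n k x.
Proof.
move=> /andP[x0 x1]; rewrite mulrn_wge0// mulr_ge0 ?exprn_ge0//.
by rewrite subr_ge0.
Qed.

Lemma sum_bern n x : \sum_(k < n.+1) bern n k x = 1.
Proof.
have -> : (1 : R) = ((1 - x) + x) ^+ n by rewrite subrK expr1n.
rewrite exprDn; apply: eq_bigr => k _.
by rewrite /bern mulrC.
Qed.

(** Absorbing the factor k lowers n by one, which reduces the first and second moments to the total
    mass. *)
Lemma bernS n k x : k.+1%:R * bern n.+1 k.+1 x = n.+1%:R * x * bern n k x.
Proof.
rewrite /bern subSS exprS -!(mulr_natr (_ * _)).
have := mul_bin_diag n.+1 k; rewrite /= => /(congr1 (fun m => m%:R : R)).
rewrite !natrM => h.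
transitivity (x * x ^+ k * (1 - x) ^+ (n - k) * (k.+1%:R * 'C(n.+1, k.+1)%:R)).
  by ring.
by rewrite -h; ring.
Qed.

Lemma mean_bern n x : \sum_(k < n.+1) k%:R * bern n k x = n%:R * x.
Proof.
case: n => [|n]; first by rewrite big_ord1 !mul0r.
rewrite big_ord_recl mul0r add0r.
under eq_bigr do rewrite bernS.
by rewrite -mulr_sumr sum_bern mulr1.
Qed.

Lemma var_bern n x :
  \sum_(k < n.+1) (k%:R - n%:R * x) ^+ 2 * bern n k x = n%:R * x * (1 - x).
Proof.
have sq : \sum_(k < n.+1) k%:R ^+ 2 * bern n k x =
    n%:R * x * (1 + (n%:R - 1) * x).
  case: n => [|n]; first by rewrite big_ord1 expr0n !mul0r.
  rewrite big_ord_recl expr0n mul0r add0r.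
  rewrite (eq_bigr (fun k : 'I_n.+1 => n.+1%:R * x *
      (k%:R * bern n k x + bern n k x))); last first.
    move=> k _; rewrite !lift0 expr2 -mulrA bernS -(natr1 k); ring.
  by rewrite -mulr_sumr big_split/= mean_bern sum_bern -natr1; ring.
rewrite (eq_bigr (fun k : 'I_n.+1 => k%:R ^+ 2 * bern n k x
    - 2 * n%:R * x * (k%:R * bern n k x) + (n%:R * x) ^+ 2 * bern n k x));
  last by move=> k _; ring.
rewrite !big_split/= sumrN -!mulr_sumr sq mean_bern sum_bern; ring.
Qed.

Lemma weierstrass01 f (e : R) : continuous f -> 0 < e ->
  exists p : {poly R}, forall x, 0 <= x <= 1 -> `|p.[x] - f x| <= e.
Proof.
move=> cf e0; have e20 : 0 < e / 2 by rewrite divr_gt0.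
have [d d0 dP] := continuous_compact_uniform 0 1 cf e20.
have [C fC] : exists C, forall x, x \in `[0, 1] -> `|f x| <= C.
  have /compact_bounded[M [_ MC]] : compact (f @` `[0, 1]).
    apply: continuous_compact; last exact: segment_compact.
    exact: continuous_subspaceT.
  exists (`|M| + 1) => x x01; apply: MC; last by exists x.
  by rewrite (le_lt_trans (ler_norm M))// ltrDl.
have C0 : 0 <= C by apply: le_trans (fC 0 _) => //; rewrite in_itv/= lexx ler01.
(* The Chebyshev term below is at most 2 C / (d^2 (n+1)), and n is chosen to make this at most e /
   2. *)
have [n nP] : exists n : nat, 2 * C / d ^+ 2 <= e / 2 * n.+1%:R.
  have [m mP] : exists m : nat, 2 * C / d ^+ 2 / (e / 2) < m%:R.
    exists (Num.bound (2 * C / d ^+ 2 / (e / 2))); apply: archi_boundP.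
    by rewrite !divr_ge0// ?mulr_ge0// ?sqr_ge0// ltW.
  exists m; rewrite -ler_pdivrMl// mulrC; apply: (le_trans (ltW mP)).
  by rewrite ler_nat.
pose p : {poly R} := \sum_(k < n.+2)
  f (k%:R / n.+1%:R) *: (('X ^+ k * (1 - 'X) ^+ (n.+1 - k)) *+ 'C(n.+1, k)).
exists p => x x01; have n0 : 0 < n.+1%:R :> R by rewrite ltr0n.
have -> : p.[x] = \sum_(k < n.+2) f (k%:R / n.+1%:R) * bern n.+1 k x.
  rewrite /p horner_sum; apply: eq_bigr => k _.
  by rewrite hornerZ hornerMn hornerM !horner_exp hornerD hornerN hornerC hornerX.
have -> : f x = \sum_(k < n.+2) f x * bern n.+1 k x.
  by rewrite -mulr_sumr sum_bern mulr1.
rewrite -sumrB.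
apply: le_trans (ler_norm_sum _ _ _) _.
apply: (@le_trans _ _ (\sum_(k < n.+2) (e / 2 * bern n.+1 k x +
    2 * C / (d * n.+1%:R) ^+ 2 * ((k%:R - n.+1%:R * x) ^+ 2 * bern n.+1 k x)))).
  apply: ler_sum => k _; rewrite -mulrBl normrM (ger0_norm (bern_ge0 _ _ x01)).
  rewrite mulrA -mulrDl ler_wpM2r ?bern_ge0//.
  have kn : k%:R / n.+1%:R \in `[(0:R), 1].
    rewrite in_itv/= divr_ge0//= ler_pdivrMr// mul1r ler_nat.
    by rewrite -ltnS.
  (* Chebyshev: nodes within d of x are handled by uniform continuity; for the others 1 <= (k -
     (n+1) x)^2 / (d (n+1))^2, and the sum of these weights is the variance. *)
  have [kx|kx] := ltP `|k%:R / n.+1%:R - x| d.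
    apply: (le_trans (ltW (dP _ _ kn kx))); rewrite lerDl.
    by rewrite mulr_ge0 ?sqr_ge0// divr_ge0 ?sqr_ge0// mulr_ge0.
  apply: (@le_trans _ _ (2 * C)).
    apply: le_trans (ler_normB _ _) _; have := fC _ kn.
    by have := fC x; rewrite in_itv/= x01 => /(_ isT); lra.
  rewrite -[leLHS]add0r lerD ?(ltW e20)// -mulrA ler_peMr ?mulr_ge0//.
  rewrite mulrC ler_pdivlMr ?exprn_gt0 ?mulr_gt0// mul1r.
  rewrite -[leRHS]real_normK ?num_real// lerXn2r ?nnegrE ?mulr_ge0 ?(ltW d0)//.
  have -> : k%:R - n.+1%:R * x = (k%:R / n.+1%:R - x) * n.+1%:R.
    by field; rewrite gt_eqF.
  by rewrite normrM (gtr0_norm n0) ler_wpM2r// ltW.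
rewrite big_split/= -!mulr_sumr sum_bern var_bern mulr1.
suff : 2 * C / (d * n.+1%:R) ^+ 2 * (n.+1%:R * x * (1 - x)) <= e / 2.
  by move=> h; rewrite [leRHS]splitr lerD2l.
have xx : x * (1 - x) <= 1 by case/andP: x01 => *; nra.
apply: (@le_trans _ _ (2 * C / d ^+ 2 / n.+1%:R)); last first.
  by rewrite ler_pdivrMr.
have -> : 2 * C / (d * n.+1%:R) ^+ 2 * (n.+1%:R * x * (1 - x)) =
    2 * C / d ^+ 2 / n.+1%:R * (x * (1 - x)).
  by field; rewrite !gt_eqF.
rewrite ler_piMr// divr_ge0// divr_ge0 ?sqr_ge0// mulr_ge0//.
Qed.

Lemma weierstrass f (M e : R) : continuous f -> 0 < M -> 0 < e ->
  exists p : {poly R}, forall x, 0 <= x <= M -> `|p.[x] - f x| <= e.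
Proof.
move=> cf M0 e0.
have cg : continuous (fun x => f (M * x)).
  move=> x; apply: continuous_comp; last exact: cf.
  by apply: continuousM; [exact: cst_continuous|exact: cvg_id].
have [p pf] := weierstrass01 cg e0.
exists (p \Po (M^-1 *: 'X)) => x /andP[x0 xM].
rewrite horner_comp hornerZ hornerX.
have -> : f x = f (M * (M^-1 * x)) by rewrite mulVKf// gt_eqF.
by apply: pf; rewrite mulr_ge0 ?invr_ge0 ?(ltW M0)//= ler_pdivrMl// mulr1.
Qed.

Lemma poly_primitive (p : {poly R}) (c : R) :
  exists q : {poly R}, q^`() = p /\ q.[0] = c.
Proof.
exists (c%:P + \sum_(i < size p) (p`_i / i.+1%:R) *: 'X^(i.+1)); split.
  rewrite derivD derivC add0r raddf_sum -[RHS]coefK poly_def.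
  apply: eq_bigr => i _ /=; rewrite derivZ derivXn -scalerMnr scalerMnl.
  by rewrite -(mulr_natr (_ / _)) divfK// pnatr_eq0.
rewrite hornerD hornerC horner_sum big1 ?addr0// => i _.
by rewrite hornerZ hornerXn expr0n mulr0.
Qed.

Lemma norm_incr_le (h dh : R -> R) (M e : R) : 0 <= e ->
  (forall s, 0 <= s <= M -> is_derive s 1 h (dh s)) ->
  (forall s, 0 <= s <= M -> `|dh s| <= e) ->
  forall s, 0 <= s <= M -> `|h s - h 0| <= e * s.
Proof.
move=> e0 dhs dhe s /andP[s0 sM].
have [||c + ->] := @MVT_segment R h dh 0 s s0.
- move=> x; rewrite in_itv/= => /andP[x0 xs].
  by apply: dhs; rewrite (ltW x0) (le_trans (ltW xs)).
- apply: derivable_within_continuous => x; rewrite in_itv/= => /andP[x0 xs].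
  have : 0 <= x <= M by rewrite x0 (le_trans xs).
  by move=> /dhs[].
rewrite in_itv/= => /andP[c0 cs].
rewrite normrM subr0 (ger0_norm s0) ler_wpM2r// dhe// c0.
by rewrite (le_trans cs).
Qed.

End weierstrass.

Section radial_multipliers.
Context {R : realType}.

(* t |-> t * a t is C^1 on [0, +oo[, vanishes at 0, and has the bounded
   derivative c; the map y |-> a |y| y is then C^1 and globally Lipschitz. *)
Record radialC1 (a c : R -> R) : Prop := RadialC1 {
  radial_conta : continuous a;
  radial_contc : continuous c;
  radial_at0 : a 0 = c 0;
  radial_derive : forall t : R, 0 < t ->
    is_derive t 1 (fun t : R => t * a t) (c t);
  radial_bounded : exists B, forall t, `|a t| <= B /\ `|c t| <= B }.

Lemma radial_derivea (a c : R -> R) (t : R) : radialC1 a c -> 0 < t ->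
  is_derive t 1 a ((c t - a t) / t).
Proof.
move=> rac t0; have tN0 : t != 0 by rewrite gt_eqF.
have d1 := radial_derive rac t0.
have d2 : is_derive t 1 (fun u : R => u^-1) (- t ^- 2).
  have := @is_deriveV R id t 1 1 tN0 (is_derive_id _ _).
  by rewrite /= scaleRE mulr1.
have d3 := is_deriveM d1 d2.
apply: (@near_eq_is_derive R R R (fun u => u * a u * u^-1)).
  near=> u; have u0 : 0 < u by near: u; exact: lt_nbhsr.
  by rewrite mulrAC mulfV ?mul1r// gt_eqF.
apply: (@is_derive_eq _ _ _ _ _ _ _ _ d3).
by rewrite !scaleRE /=; field.
Unshelve. all: by end_near. Qed.

Lemma is_derive_sqrt_comp (a c : R -> R) (s : R) : radialC1 a c -> 0 < s ->
  is_derive s 1 (fun s => a (Num.sqrt s))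
    ((c (Num.sqrt s) - a (Num.sqrt s)) / 2 / s).
Proof.
move=> rac s0; have r0 : 0 < Num.sqrt s by rewrite sqrtr_gt0.
have h := @is_derive1_comp R a Num.sqrt s _ _ (radial_derivea rac r0) (is_derive1_sqrt s0).
apply: (@is_derive_eq _ _ _ _ _ _ _ _ h).
move: (c _) (a _) => u v; rewrite -[X in _ = _ / X](sqr_sqrtr (ltW s0)).
by field; rewrite gt_eqF.
Qed.

(** The derivative of p(|y|^2) y has the extra term 2 p'(|y|^2) <y, dy> y, whence the second
    estimate. In the variable s = r^2 put al(s) = a(sqrt s); then al' = ga(s) / s with 2 ga = c - a,
    which may be singular at 0. Shifting by a small d gives the continuous function rho(s) = al'(s +
    d). Let q approximate rho and let P be the primitive of q with P(0) = al(d): P(s) is close to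
    al(s + d), hence to al(s), and 2 s q(s) is close to 2 ga(s). *)
Lemma radial_poly_approx (a c : R -> R) (M e : R) : radialC1 a c -> 0 < M -> 0 < e ->
  exists p : {poly R}, forall r, 0 <= r <= M ->
    `|p.[r ^+ 2] - a r| <= e /\
    `|2 * r ^+ 2 * p^`().[r ^+ 2] - (c r - a r)| <= e.
Proof.
move=> rac M0 e0; have [ca cc a0 _ [B aB]] := rac.
have csq := @sqrt_continuous R.
pose al s := a (Num.sqrt s).
pose ga s := (c (Num.sqrt s) - a (Num.sqrt s)) / 2.
have cal : continuous al by exact: (cont_comp csq ca).
have cga : continuous ga.
  exact: (cont_mul (cont_sub (cont_comp csq cc) (cont_comp csq ca)) (@cont_cst _ _ _)).
have ga0 : ga 0 = 0 by rewrite /ga sqrtr0 a0 subrr mul0r.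
have gaB s : `|ga s| <= B.
  rewrite /ga normrM [`|2^-1|]ger0_norm ?invr_ge0// ler_pdivrMr//.
  have [? ?] := aB (Num.sqrt s); apply: le_trans (ler_normB _ _) _; lra.
have B0 : 0 <= B by apply: le_trans (gaB 0).
have e20 : 0 < e / 2 by rewrite divr_gt0.
have e80 : 0 < e / 8 by rewrite divr_gt0.
have [d1 d10 alP] := continuous_compact_uniform 0 (M ^+ 2) cal e20.
have [d2 d20 gaP] := continuous_compact_uniform 0 (M ^+ 2) cga e80.
have M20 : 0 < M ^+ 2 by rewrite exprn_gt0.
(* The bounds d < d1 and d < d2 allow the shift by d in [al] and [ga]; d B <= (e/8) d2 controls the
   remainder d / (s + d) ga(s + d) away from 0. *)
have [d [d0 dd1 dd2 dB]] : exists d, [/\ 0 < d, d < d1, d < d2 & d * B <= e / 8 * d2].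
  pose d3 := e / 8 * d2 / (B + 1).
  have B1 : 0 < B + 1 by rewrite ltr_wpDl.
  have d30 : 0 < d3 by rewrite divr_gt0// mulr_gt0.
  have m0 : 0 < Num.min d1 (Num.min d2 d3) by rewrite !lt_min d10 d20 d30.
  exists (Num.min d1 (Num.min d2 d3) / 2).
  have m1 : Num.min d1 (Num.min d2 d3) <= d1 by rewrite ge_min lexx.
  have m2 : Num.min d1 (Num.min d2 d3) <= d2 by rewrite !ge_min lexx orbT.
  have m3 : Num.min d1 (Num.min d2 d3) <= d3 by rewrite !ge_min lexx !orbT.
  move: (Num.min _ _) m0 m1 m2 m3 => m m0 m1 m2 m3; split; try lra.
  have -> : e / 8 * d2 = d3 * (B + 1) by rewrite /d3 divfK// gt_eqF.
  by nra.
(* The maximum with 0 only serves to make [rho] continuous on the whole line. *)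
pose rho s := ga (Num.max s 0 + d) / (Num.max s 0 + d).
have md s : 0 < Num.max s 0 + d by rewrite ltr_wpDl// le_max lexx orbT.
have crho : continuous rho.
  have cm : continuous (fun s : R => Num.max s 0 + d).
    apply: (@cont_add _ _ (fun s : R => Num.max s 0)); last exact: cont_cst.
    by move=> s; apply: continuous_max; [exact: cvg_id|exact: cst_continuous].
  apply: (cont_mul (cont_comp cm cga) (cont_inv _ cm)) => s.
  by rewrite gt_eqF.
pose eta := e / 8 / M ^+ 2.
have eta0 : 0 < eta by rewrite divr_gt0.
have [q qP] := weierstrass crho M20 eta0.
have [P [dP P0]] := poly_primitive q (al d).
have rhoE s : 0 <= s -> rho s = ga (s + d) / (s + d).
  by move=> s0; rewrite /rho max_l.
have etaM s : 0 <= s <= M ^+ 2 -> eta * s <= e / 8.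
  by move=> /andP[s0 sM]; rewrite /eta mulrAC ler_pdivrMr// ler_wpM2l// ltW.
exists P => r /andP[r0 rM].
have sM : 0 <= r ^+ 2 <= M ^+ 2.
  by rewrite sqr_ge0 lerXn2r// nnegrE// ltW.
have rE : Num.sqrt (r ^+ 2) = r by rewrite sqrtr_sqr ger0_norm.
have -> : a r = al (r ^+ 2) by rewrite /al rE.
have -> : c r - al (r ^+ 2) = 2 * ga (r ^+ 2) by rewrite /ga /al rE; field.
have sM' : r ^+ 2 \in `[0, M ^+ 2] by rewrite in_itv.
move: (r ^+ 2) sM sM' => s sM sM'; have /andP[s0 _] := sM.
have sd : `|s - (s + d)| = d by rewrite opprD addrA subrr sub0r normrN gtr0_norm.
split.
  have h : `|(P.[s] - al (s + d)) - (P.[0] - al (0 + d))| <= eta * s.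
    apply: (@norm_incr_le _ (fun s => P.[s] - al (s + d))
      (fun s => q.[s] - rho s) (M ^+ 2)) => //; first exact: ltW.
    move=> x /andP[x0 xM]; rewrite rhoE//.
    have xd : 0 < x + d by rewrite ltr_wpDl.
    have dal := is_derive_sqrt_comp rac xd.
    have dsh : is_derive x 1 (fun x : R => x + d) 1.
      by have := is_deriveD (is_derive_id x (1 : R)) (is_derive_cst d x (1 : R)); rewrite addr0.
    have dcomp := @is_derive1_comp R al (fun x => x + d) x _ _ dal dsh.
    have dq := is_derive_poly P x; rewrite dP in dq.
    apply: (@is_derive_eq _ _ _ _ _ _ _ _ (is_deriveB dq dcomp)).
    by rewrite mulr1.
  rewrite P0 add0r subrr subr0 in h.
  have -> : P.[s] - al s = (P.[s] - al (s + d)) + (al (s + d) - al s) by ring.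
  apply: le_trans (ler_normD _ _) _.
  have := alP s (s + d) sM'; rewrite sd distrC => /(_ dd1).
  by have := etaM _ sM; lra.
rewrite dP.
have -> : 2 * s * q.[s] - 2 * ga s = 2 * (s * (q.[s] - rho s)
    + ((ga (s + d) - ga s) - d / (s + d) * ga (s + d))).
  rewrite rhoE//; field; apply/negP => /eqP sd0; move: d0; rewrite -(ltrD2l s).
  by rewrite sd0 addr0 ltNge s0.
have h1 : `|s * (q.[s] - rho s)| <= e / 8.
  rewrite normrM (ger0_norm s0) mulrC; apply: le_trans (etaM _ sM).
  by rewrite ler_wpM2r// qP.
have h2 : `|ga (s + d) - ga s| <= e / 8.
  by rewrite distrC ltW// gaP// sd.
have sd0 : 0 < s + d by rewrite ltr_wpDl.
(* This remainder comes from replacing s / (s + d) by 1. For s + d < d2 it is small because ga(0) =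
   0, otherwise because d is small against d2. *)
have h3 : `|d / (s + d) * ga (s + d)| <= e / 8.
  rewrite normrM ger0_norm ?divr_ge0 ?(ltW d0) ?(ltW sd0)//.
  have [sd2|sd2] := ltP (s + d) d2.
    have : `|ga 0 - ga (s + d)| < e / 8.
      by apply: gaP; [rewrite in_itv/= lexx ltW|rewrite sub0r normrN gtr0_norm].
    rewrite ga0 sub0r normrN => /ltW; apply: le_trans.
    by rewrite ler_piMl// ler_pdivrMr// mul1r lerDr.
  apply: (@le_trans _ _ (d / d2 * B)).
    apply: ler_pM => //; first by rewrite divr_ge0 ?(ltW d0) ?(ltW sd0).
    by rewrite ler_wpM2l ?(ltW d0)// lef_pV2.
  by rewrite mulrAC ler_pdivrMr.
rewrite normrM ger0_norm//.
have := ler_normD (s * (q.[s] - rho s)) ((ga (s + d) - ga s) - d / (s + d) * ga (s + d)).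
have := ler_normB (ga (s + d) - ga s) (d / (s + d) * ga (s + d)).
by lra.
Qed.

End radial_multipliers.

Lemma cont_seq (R : realType) (h : R -> R) (u : nat -> R) (l : R) :
  continuous h -> u n @[n --> \oo] --> l -> h (u n) @[n --> \oo] --> h l.
Proof. by move=> ch ul; exact: (cvg_comp _ _ ul (ch l)). Qed.

Lemma norm_squeeze0 (R : realType) (u v : nat -> R) :
  (forall n, `|u n| <= v n) -> v n @[n --> \oo] --> (0 : R) ->
  u n @[n --> \oo] --> (0 : R).
Proof.
move=> uv v0; apply: norm_cvg0.
apply: (@squeeze_cvgr _ _ _ _ (cst 0) v) => //; last exact: cvg_cst.
by apply: nearW => n; rewrite normr_ge0 uv.
Qed.

Section euclidean_norm.
Context {R : realType} {I : finType}.
Implicit Types y : I -> R.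

Definition sqn y : R := \sum_i y i ^+ 2.
Definition nrm y : R := Num.sqrt (sqn y).

Lemma sqn_ge0 y : 0 <= sqn y.
Proof. by apply: sumr_ge0 => i _; exact: sqr_ge0. Qed.

Lemma nrm_ge0 y : 0 <= nrm y. Proof. exact: sqrtr_ge0. Qed.

Lemma nrm_sqr y : nrm y ^+ 2 = sqn y.
Proof. by rewrite sqr_sqrtr ?sqn_ge0. Qed.

Lemma sqr_le_sqn y i : y i ^+ 2 <= sqn y.
Proof.
by rewrite /sqn (bigD1 i)//= lerDl sumr_ge0// => j _; exact: sqr_ge0.
Qed.

Lemma norm_mul_le_sqn y i j : `|y i * y j| <= sqn y.
Proof.
rewrite normrM; have := sqr_le_sqn y i; have := sqr_le_sqn y j.
rewrite -(real_normK (num_real (y i))) -(real_normK (num_real (y j))).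
move: `|y i| `|y j| => u v hu hv; have := sqr_ge0 (u - v); nra.
Qed.

Lemma sqn_eq0 y i : sqn y = 0 -> y i = 0.
Proof.
move=> y0; have := sqr_le_sqn y i; rewrite y0 => yi.
by apply/eqP; rewrite -sqrf_eq0 eq_le yi sqr_ge0.
Qed.

Lemma sqn_cvg (y_ : nat -> I -> R) y :
  (forall i, y_ n i @[n --> \oo] --> y i) -> sqn (y_ n) @[n --> \oo] --> sqn y.
Proof.
move=> yy; rewrite /sqn.
suff : forall s : seq I, \sum_(i <- s) y_ n i ^+ 2 @[n --> \oo] -->
    \sum_(i <- s) y i ^+ 2 by [].
elim=> [|i s ih]; first by under eq_fun do rewrite big_nil; rewrite big_nil; exact: cvg_cst.
under eq_fun do rewrite big_cons expr2; rewrite big_cons expr2.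
by apply: cvgD => //; exact: cvgM.
Qed.

Lemma nrm_cvg (y_ : nat -> I -> R) y :
  (forall i, y_ n i @[n --> \oo] --> y i) -> nrm (y_ n) @[n --> \oo] --> nrm y.
Proof.
by move=> /sqn_cvg yy; exact: (cont_seq (@sqrt_continuous R) yy).
Qed.

End euclidean_norm.

Section radial_limit.
Context {R : realType} {I : finType}.
Variables (a c : R -> R) (y_ : nat -> I -> R) (y : I -> R).
Hypothesis rac : radialC1 a c.
Hypothesis yy : forall i, y_ n i @[n --> \oo] --> y i.

Lemma small_cvg (u v : nat -> R) (l : R) :
  (forall n, `|u n - v n| <= n.+1%:R^-1) ->
  v n @[n --> \oo] --> l -> u n @[n --> \oo] --> l.
Proof.
move=> uv vl.
have d0 : u n - v n @[n --> \oo] --> (0 : R).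
  by apply: norm_squeeze0 uv _; exact: cvg_harmonic.
have -> : u = (fun n => (u n - v n) + v n) by apply/funext => n; rewrite subrK.
by rewrite -[l]add0r; exact: cvgD.
Qed.

Lemma radial_value_cvg (u : nat -> R) :
  (forall n, `|u n - a (nrm (y_ n))| <= n.+1%:R^-1) ->
  u n @[n --> \oo] --> a (nrm y).
Proof.
move=> /small_cvg; apply.
exact: (cont_seq (radial_conta rac) (nrm_cvg yy)).
Qed.

(** The weight [w n] may blow up where y = 0; only its product with |y_n|^2 is controlled. There
    that product tends to c(0) - a(0) = 0, which is why [radialC1] requires a(0) = c(0). *)
Lemma radial_weight_cvg (w : nat -> R) i j :
  (forall n, `|w n * sqn (y_ n) - (c (nrm (y_ n)) - a (nrm (y_ n)))| <= n.+1%:R^-1) ->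
  w n * y_ n j * y_ n i @[n --> \oo] -->
    (c (nrm y) - a (nrm y)) / nrm y ^+ 2 * y j * y i.
Proof.
have cb : continuous (fun t => c t - a t).
  exact: (cont_sub (radial_contc rac) (radial_conta rac)).
move=> /small_cvg wl.
have {}wl : w n * sqn (y_ n) @[n --> \oo] --> c (nrm y) - a (nrm y).
  by apply: wl; exact: (cont_seq cb (nrm_cvg yy)).
rewrite nrm_sqr; have sy := sqn_cvg yy.
have [y0|y0] := eqVneq (sqn y) 0.
  rewrite (@sqn_eq0 _ _ y i y0) mulr0.
  have b0 : c (nrm y) - a (nrm y) = 0.
    by rewrite /nrm y0 sqrtr0 (radial_at0 rac) subrr.
  have {}wl : `|w n * sqn (y_ n)| @[n --> \oo] --> (0 : R).
    by rewrite b0 in wl; rewrite -(normr0 R); exact: cvg_norm.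
  apply: norm_squeeze0 wl => n; rewrite -mulrA !(normrM (w n)).
  by rewrite ler_wpM2l// (ger0_norm (sqn_ge0 _)) norm_mul_le_sqn.
apply: cvgM; last exact: yy.
apply: cvgM; last exact: yy.
have h : (w n * sqn (y_ n)) / sqn (y_ n) @[n --> \oo] -->
    (c (nrm y) - a (nrm y)) / sqn y by apply: cvgM => //; exact: cvgV.
apply: cvg_trans h; apply: near_eq_cvg.
have : \forall n \near \oo, sqn (y_ n) != 0.
  by apply: cvgr_neq0; [exact: sy|exact: y0].
apply: filterS => n ny.
by rewrite mulfK.
Qed.

End radial_limit.

Section admissible_sequences.
Context {R : realType} {N : nat} {I : finType}.
Notation mu := (lebesgueN N).
Implicit Types (Omega : set 'rV[R]_N) (f : I -> 'rV[R]_N -> R)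
  (g : I -> 'I_N -> 'rV[R]_N -> R).

(* By completeness of L^2 and dominated convergence, this says that f is in
   the H^1-closure of the test functions, with gradient g. *)
Definition dominated_limit Omega f g :=
  exists (chi : nat -> I -> 'rV[R]_N -> R) (D : 'rV[R]_N -> R),
    [/\ forall n i, test_fun Omega (chi n i),
        mu.-integrable Omega (EFin \o D) &
        {ae mu, forall x, Omega x -> forall i,
          [/\ forall n, chi n i x ^+ 2 <= D x,
              forall n k, ('D_('e_k) (chi n i) x) ^+ 2 <= D x,
              chi n i x @[n --> \oo] --> f i x &
              forall k, 'D_('e_k) (chi n i) x @[n --> \oo] --> g i k x]}].

Lemma partial_sqn (y : I -> 'rV[R]_N -> R) (k : 'I_N) x :
  (forall i, derivable (y i) x 'e_k) ->
  derivable (fun x => sqn (y^~ x)) x 'e_k /\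
  'D_('e_k) (fun x => sqn (y^~ x)) x = 2 * \sum_i y i x * 'D_('e_k) (y i) x.
Proof.
move=> dy; rewrite /sqn.
suff : forall s : seq I,
    derivable (fun x => \sum_(i <- s) y i x ^+ 2) x 'e_k /\
    'D_('e_k) (fun x => \sum_(i <- s) y i x ^+ 2) x =
      2 * \sum_(i <- s) y i x * 'D_('e_k) (y i) x by [].
elim=> [|i s [ih1 ih2]].
  under eq_fun do rewrite big_nil; rewrite big_nil mulr0 partial_cst.
  by split => //; exact: derivable_cst.
have dyi : derivable (fun x => y i x ^+ 2) x 'e_k.
  by under eq_fun do rewrite expr2; exact: (derivableM (dy i) (dy i)).
under eq_fun do rewrite big_cons.
split; first exact: (derivableD dyi ih1).
rewrite (partialD dyi ih1) ih2 big_cons.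
under eq_fun do rewrite expr2.
apply: (etrans (congr1 (fun z => z + _) (partialM (dy i) (dy i)))).
by rewrite [RHS]mulrDr; congr (_ + _); rewrite mulr_natl mulr2n.
Qed.

(** The new approximants are p_n(|chi_n|^2) chi_n, with p_n accurate to 1/(n+1) on the range of
    |chi_n|; they remain test functions because p_n is a polynomial in the squared norm. *)
Lemma dominated_limit_radial Omega f g a c : measurable Omega -> radialC1 a c ->
  dominated_limit Omega f g ->
  dominated_limit Omega (fun i x => a (nrm (f^~ x)) * f i x)
    (fun i k x => a (nrm (f^~ x)) * g i k x +
       (c (nrm (f^~ x)) - a (nrm (f^~ x))) / nrm (f^~ x) ^+ 2 *
       (\sum_j f j x * g j k x) * f i x).
Proof.
move=> mO rac [chi [D [tchi Dint chiP]]]; have [B aB] := radial_bounded rac.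
have B0 : 0 <= B by apply: le_trans (proj1 (aB 0)).
have /choice[p pP] (n : nat) : exists p : {poly R}, forall x,
    `|p.[sqn (fun i => chi n i x)] - a (nrm (fun i => chi n i x))| <= n.+1%:R^-1 /\
    `|2 * sqn (fun i => chi n i x) * p^`().[sqn (fun i => chi n i x)] -
      (c (nrm (fun i => chi n i x)) - a (nrm (fun i => chi n i x)))| <= n.+1%:R^-1.
  (* The bound M of |chi_n| depends on n, so the polynomial has to be chosen anew for every n. *)
  have [M M0 chiM] : exists2 M, 0 < M & forall x, nrm (fun i => chi n i x) <= M.
    have /choice[C chiC] i : exists C, forall x, `|chi n i x| <= C.
      have [A [A' [_ chi0]]] := test_fun_support (tchi n i).
      apply: (bounded_of_support (a := A) (b := A')) => //.
      by have [/(_ 0%N)[]] := tchi n i.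
    exists (Num.sqrt (\sum_i C i ^+ 2) + 1).
      by rewrite ltr_wpDl// sqrtr_ge0.
    move=> x; apply: (@le_trans _ _ (Num.sqrt (\sum_i C i ^+ 2))).
      rewrite ler_wsqrtr//; apply: ler_sum => i _.
      rewrite -real_normK ?num_real// lerXn2r ?nnegrE//.
      exact: le_trans (chiC i x).
    by rewrite lerDl.
  have [p pP] := radial_poly_approx rac M0 (ltac:(by rewrite invr_gt0 ltr0n) : 0 < n.+1%:R^-1 :> R).
  exists p => x; have := pP (nrm (fun i => chi n i x)).
  by rewrite nrm_ge0 chiM nrm_sqr; apply.
pose q n x := (p n).[sqn (fun i => chi n i x)].
pose w n x := 2 * (p n)^`().[sqn (fun i => chi n i x)].
pose chi' n i x := q n x * chi n i x.
have dchi' n i k x : 'D_('e_k) (chi' n i) x = q n x * 'D_('e_k) (chi n i) x +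
    \sum_j w n x * chi n j x * chi n i x * 'D_('e_k) (chi n j) x.
  have dc j z : derivable (chi n j) z 'e_k.
    by have [_ + _] := test_fun_deriv k (tchi n j); apply.
  have [ds1 ds2] := partial_sqn (fun i => dc i x).
  have [dp1 dp2] := partial_horner (p n) ds1.
  rewrite /chi' (partialM dp1 (dc i x)) dp2 ds2; congr (_ + _).
  rewrite /w mulrC 2!mulr_sumr !mulr_suml; apply: eq_bigr => j _; ring.
(* B + 1 bounds |q n|, the 1 being the approximation error, and 2 B + 1 bounds each of the #|I|
   coefficients [w n x * chi n j x * chi n i x], since |c - a| <= 2 B. *)
pose K := (B + 1) + #|I|%:R * (2 * B + 1).
exists chi', (fun x => K ^+ 2 * D x); split.
- move=> n i; apply: test_funMl => // l; apply: Cn_horner.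
  rewrite /sqn; apply: Cn_sum => j.
  by under eq_fun do rewrite expr2; apply: CnM; have [] := tchi n j.
- rewrite (_ : _ \o _ = (fun x => (K ^+ 2)%:E * (EFin \o D) x)%E).
    exact: integrableZl.
  by apply/funext => x; rewrite /= EFinM.
have nV1 (n : nat) : n.+1%:R^-1 <= 1 :> R.
  by rewrite invf_le1 ?ltr0n// ler1n.
have KB : B + 1 <= K by rewrite /K lerDl mulr_ge0// addr_ge0// mulr_ge0.
have K0 : 0 <= K by apply: le_trans KB; rewrite addr_ge0.
apply: filterS chiP => x xP Ox i; have {}xP := xP Ox.
have D0 : 0 <= D x by have [/(_ 0%N) + _ _ _] := xP i; apply: le_trans; exact: sqr_ge0.
have sqle (u v : R) : 0 <= v -> `|u| <= v * Num.sqrt (D x) -> u ^+ 2 <= v ^+ 2 * D x.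
  move=> v0 uv; rewrite -[D x in leRHS]sqr_sqrtr// -exprMn.
  rewrite -(real_normK (num_real u)) lerXn2r// nnegrE//.
  by rewrite mulr_ge0// sqrtr_ge0.
have lesq (u : R) : u ^+ 2 <= D x -> `|u| <= Num.sqrt (D x).
  by move=> uD; rewrite -sqrtr_sqr ler_wsqrtr.
have qB n : `|q n x| <= B + 1.
  have [+ _] := pP n x; have [+ _] := aB (nrm (fun i => chi n i x)).
  have := nV1 n; have := ler_normD (q n x - a (nrm (fun i => chi n i x))) (a (nrm (fun i => chi n i x))).
  rewrite subrK => h1 h2 h3 h4; apply: le_trans h1 _; rewrite addrC.
  by apply: lerD => //; exact: le_trans h4 h2.
have wB n j : `|w n x * chi n j x * chi n i x| <= 2 * B + 1.
  apply: (@le_trans _ _ `|w n x * sqn (fun i => chi n i x)|).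
    rewrite -mulrA !(normrM (w n x)) ler_wpM2l// (ger0_norm (sqn_ge0 _)).
    exact: (norm_mul_le_sqn (fun i => chi n i x)).
  have [_] := pP n x; have [] := aB (nrm (fun i => chi n i x)).
  rewrite /w (mulrAC 2).
  set s := 2 * _ * _; set u := a _; set v := c _ => h1 h2 h3.
  have h4 := le_trans h3 (nV1 n).
  have := ler_normD (s - (v - u)) (v - u); have := ler_normB v u.
  by rewrite subrK; lra.
split.
- move=> n; have [/(_ n) cD _ _ _] := xP i.
  apply: sqle => //; rewrite /chi' normrM.
  by apply: ler_pM => //; [exact: le_trans (qB n) KB|exact: lesq].
- move=> n k; rewrite dchi'; apply: sqle => //.
  have [_ /(_ n k) cD _ _] := xP i.
  apply: le_trans (ler_normD _ _) _; rewrite /K mulrDl; apply: lerD.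
    by rewrite normrM; apply: ler_pM => //; exact: lesq.
  apply: le_trans (ler_norm_sum _ _ _) _.
  apply: (@le_trans _ _ (\sum_(j : I) (2 * B + 1) * Num.sqrt (D x))).
    apply: ler_sum => j _; rewrite normrM; apply: ler_pM => //.
    by apply: lesq; have [_ /(_ n k)] := xP j.
  by rewrite sumr_const -[leLHS]mulr_natl mulrA.
- have [_ _ cf _] := xP i; rewrite /chi'; apply: cvgM => //.
  apply: (@radial_value_cvg _ _ a c (fun n i => chi n i x)) => //.
    by move=> j; have [] := xP j.
  by move=> n; have [] := pP n x.
- move=> k; have [_ _ cf /(_ k) cg] := xP i.
  under eq_fun do rewrite dchi'.
  apply: cvgD.
    apply: cvgM => //.
    apply: (@radial_value_cvg _ _ a c (fun n i => chi n i x)) => //.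
      by move=> j; have [] := xP j.
    by move=> n; have [] := pP n x.
  rewrite [X in _ --> X](_ : _ = \sum_j ((c (nrm (f^~ x)) - a (nrm (f^~ x))) /
      nrm (f^~ x) ^+ 2 * f j x * f i x * g j k x)); last first.
    by rewrite mulr_sumr mulr_suml; apply: eq_bigr => j _; ring.
  suff : forall s : seq I, \sum_(j <- s) w n x * chi n j x * chi n i x *
      'D_('e_k) (chi n j) x @[n --> \oo] -->
      \sum_(j <- s) ((c (nrm (f^~ x)) - a (nrm (f^~ x))) /
      nrm (f^~ x) ^+ 2 * f j x * f i x * g j k x) by [].
  elim=> [|j s ih].
    by under eq_fun do rewrite big_nil; rewrite big_nil; exact: cvg_cst.
  under eq_fun do rewrite big_cons; rewrite big_cons; apply: cvgD => //.
  apply: cvgM; last by have [_ _ _] := xP j.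
  apply: (@radial_weight_cvg _ _ a c (fun n i => chi n i x) (f^~ x)) => //.
    by move=> l; have [] := xP l.
  by move=> n; have [_] := pP n x; rewrite /w (mulrAC 2).
Qed.

End admissible_sequences.

(** * Weak derivatives and dominated limits of test functions *)

Section square_integrable.
Context {R : realType} {N : nat}.
Variable Omega : set 'rV[R]_N.
Hypothesis oO : open Omega.
Notation mu := (lebesgueN N).
Implicit Types f g D : 'rV[R]_N -> R.

Let mO : measurable Omega := open_measurable_rV oO.

Definition sqint f := measurable_fun Omega f /\
  mu.-integrable Omega (EFin \o (fun x => f x ^+ 2)).

Lemma integrableZ k D : mu.-integrable Omega (EFin \o D) ->
  mu.-integrable Omega (EFin \o (fun x => k * D x)).
Proof.
move=> iD; rewrite (_ : _ \o _ = (fun x => k%:E * (EFin \o D) x)%E).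
  exact: integrableZl.
by apply/funext => x; rewrite /= EFinM.
Qed.

Lemma ae_integrable_le f D : measurable_fun Omega f ->
  mu.-integrable Omega (EFin \o D) ->
  {ae mu, forall x, Omega x -> `|f x| <= D x} ->
  mu.-integrable Omega (EFin \o f).
Proof.
move=> mf iD fD; apply/integrableP; split; first exact/measurable_EFinP.
have /integrableP[mD] := iD; apply: le_lt_trans.
apply: ae_ge0_le_integral => //.
- by apply: measurableT_comp => //; exact/measurable_EFinP.
- by apply: measurableT_comp.
- apply: filterS fD => x fD Ox; rewrite /= lee_fin.
  by apply: le_trans (fD Ox) _; exact: ler_norm.
Qed.

Lemma integrableM_le f g D : measurable_fun Omega f -> measurable_fun Omega g ->
  mu.-integrable Omega (EFin \o D) ->
  {ae mu, forall x, Omega x -> f x ^+ 2 <= D x /\ g x ^+ 2 <= D x} ->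
  mu.-integrable Omega (EFin \o (fun x => f x * g x)).
Proof.
move=> mf mg iD fgD; apply: ae_integrable_le iD _; first exact: measurable_funM.
apply: filterS fgD => x fgD /fgD[fD gD]; rewrite normrM.
move: fD gD; rewrite -(real_normK (num_real (f x))) -(real_normK (num_real (g x))).
move: `|f x| `|g x| => u v; have := sqr_ge0 (u - v); nra.
Qed.

Lemma sqint_le f D : measurable_fun Omega f -> mu.-integrable Omega (EFin \o D) ->
  {ae mu, forall x, Omega x -> f x ^+ 2 <= D x} -> sqint f.
Proof.
move=> mf iD fD; split => //; apply: ae_integrable_le iD _.
  by under eq_fun do rewrite expr2; exact: measurable_funM.
by apply: filterS fD => x fD /fD; rewrite ger0_norm ?sqr_ge0.
Qed.

Lemma sqintM f g : sqint f -> sqint g ->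
  mu.-integrable Omega (EFin \o (fun x => f x * g x)).
Proof.
move=> [mf f2] [mg g2].
apply: (@integrableM_le _ _ (fun x => f x ^+ 2 + g x ^+ 2)) => //.
  exact: (integrableD mO f2 g2).
by apply: aeW => x _; rewrite lerDl lerDr !sqr_ge0.
Qed.

Lemma sqintD f g : sqint f -> sqint g -> sqint (fun x => f x + g x).
Proof.
move=> [mf f2] [mg g2]; have fg := integrableD mO f2 g2.
apply: (@sqint_le _ (fun x => 2 * (f x ^+ 2 + g x ^+ 2))).
- exact: measurable_funD.
- exact: (@integrableZ 2 (fun x => f x ^+ 2 + g x ^+ 2)).
- apply: aeW => x _; have := sqr_ge0 (f x - g x); nra.
Qed.

Lemma sqintZ k f : sqint f -> sqint (fun x => k * f x).
Proof.
move=> [mf f2]; split; first exact: measurable_funM.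
by under eq_fun do rewrite exprMn; exact: (@integrableZ _ (fun x => f x ^+ 2)).
Qed.

Lemma sqintN f : sqint f -> sqint (fun x => - f x).
Proof. by move=> /(sqintZ (-1)); under eq_fun do rewrite mulN1r. Qed.

Lemma sqintB f g : sqint f -> sqint g -> sqint (fun x => f x - g x).
Proof. by move=> sf /sqintN; exact: sqintD. Qed.

Lemma test_fun_sqint f : test_fun Omega f ->
  sqint f /\ forall k, sqint (fun x => 'D_('e_k) f x).
Proof.
move=> tf; have [/(_ 0%N)[cf _] _ _] := tf; split => [|k].
  split; first by apply: measurable_funTS; exact: continuous_measurable_rV.
  apply: (@integrableS _ _ _ _ setT) => //.
  by under eq_fun do rewrite expr2; exact: test_funM_integrable tf cf.
have [_ _ cdf] := test_fun_deriv k tf.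
split; first by apply: measurable_funTS; exact: continuous_measurable_rV.
apply: (@integrableS _ _ _ _ setT) => //.
by under eq_fun do rewrite expr2; exact: (partial_integrable k tf cdf).
Qed.

Lemma sqint_bounded_integrable f (A : set 'rV[R]_N) : sqint f -> measurable A ->
  A `<=` Omega -> (mu A < +oo)%E -> mu.-integrable A (EFin \o f).
Proof.
move=> [mf f2] mA AO muA.
have f2A : mu.-integrable A (EFin \o (fun x => f x ^+ 2)) by exact: integrableS f2.
have cA : mu.-integrable A (EFin \o (fun=> 1 : R)).
  apply: measurable_bounded_integrable => //.
  exists 1; split; first exact: num_real.
  by move=> M M1 x _ /=; rewrite normr1 ltW.
apply: le_integrable (integrableD mA f2A cA) => //.
  by apply/measurable_EFinP; exact: measurable_funS mf.
move=> x _ /=; rewrite lee_fin [leRHS]ger0_norm ?addr_ge0 ?sqr_ge0//.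
rewrite -(real_normK (num_real (f x))); move: `|f x| (normr_ge0 (f x)) => u u0.
have := sqr_ge0 (u - 1); nra.
Qed.

Lemma sqint_orthogonal0 f : sqint f ->
  (forall psi, test_fun Omega psi -> \int[mu]_(x in Omega) (f x * psi x) = 0) ->
  {ae mu, forall x, Omega x -> f x = 0}.
Proof.
move=> sf f0; apply: test_fun_orthogonal0 => // a b abO.
apply: sqint_bounded_integrable => //; first exact: measurable_cbox.
exact: lebesgueN_cbox_lty.
Qed.

Lemma Rdominated_cvg (u_ : nat -> 'rV[R]_N -> R) (u D : 'rV[R]_N -> R) :
  (forall n, measurable_fun Omega (u_ n)) -> measurable_fun Omega u ->
  mu.-integrable Omega (EFin \o D) ->
  {ae mu, forall x, Omega x -> (forall n, `|u_ n x| <= D x) /\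
                                u_ n x @[n --> \oo] --> u x} ->
  mu.-integrable Omega (EFin \o u) /\
  \int[mu]_(x in Omega) u_ n x @[n --> \oo] --> \int[mu]_(x in Omega) u x.
Proof.
move=> mu_ muu iD uD.
have [|||||iu _ h] := @dominated_convergence _ _ R mu Omega mO
  (fun n => EFin \o u_ n) (EFin \o u) (EFin \o D).
- by move=> n; exact/measurable_EFinP.
- exact/measurable_EFinP.
- apply: filterS uD => x uD /uD[_ cu]; apply/cvg_EFin => //; exact: nearW.
- by [].
- by apply: filterS uD => x uD n /uD[ud _]; rewrite /= lee_fin.
split => //.
rewrite /Rintegral; apply: fine_cvg.
by rewrite fineK//; exact: integrable_fin_num.
Qed.

Lemma sqint_mul_cvg (u_ : nat -> 'rV[R]_N -> R) (u D psi : 'rV[R]_N -> R) :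
  (forall n, measurable_fun Omega (u_ n)) -> measurable_fun Omega u ->
  mu.-integrable Omega (EFin \o D) -> sqint psi ->
  {ae mu, forall x, Omega x -> (forall n, u_ n x ^+ 2 <= D x) /\
                                u_ n x @[n --> \oo] --> u x} ->
  \int[mu]_(x in Omega) (u_ n x * psi x) @[n --> \oo] -->
    \int[mu]_(x in Omega) (u x * psi x).
Proof.
move=> mu_ muu iD [mp p2] uD.
apply: (proj2 (@Rdominated_cvg _ _ (fun x => D x + psi x ^+ 2) _ _ _ _)).
- by move=> n; exact: measurable_funM.
- exact: measurable_funM.
- exact: (integrableD mO iD p2).
- apply: filterS uD => x uD /uD[ud cu]; split; last by apply: cvgM => //; exact: cvg_cst.
  move=> n; have := ud n; rewrite normrM.
  rewrite -(real_normK (num_real (u_ n x))) -(real_normK (num_real (psi x))).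
  move: `|u_ n x| `|psi x| => v w; have := sqr_ge0 (v - w); nra.
Qed.

Lemma sqr_lim_le (u_ : nat -> R) (u d : R) :
  (forall n, u_ n ^+ 2 <= d) -> u_ n @[n --> \oo] --> u -> u ^+ 2 <= d.
Proof.
move=> ud cu; have cu2 : u_ n ^+ 2 @[n --> \oo] --> u ^+ 2.
  by under eq_fun do rewrite expr2; rewrite expr2; exact: cvgM.
by apply: (cvgr_to_le cu2); exact: nearW.
Qed.

End square_integrable.

(** * Reduction of complex functions to their real components *)

Section complex_parts.
Context {R : realType}.
Implicit Types z w : R[i].

(** Indexing the two parts by a boolean turns a complex function into a finite family of real ones,
    to which results over a [finType] apply. *)
Definition cpart (b : bool) z : R := if b then complex.Im z else complex.Re z.

Lemma Re_addc z w : complex.Re (z + w) = complex.Re z + complex.Re w.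
Proof. by case: z w => ? ? [? ?]. Qed.
Lemma Im_addc z w : complex.Im (z + w) = complex.Im z + complex.Im w.
Proof. by case: z w => ? ? [? ?]. Qed.
Lemma Re_oppc z : complex.Re (- z) = - complex.Re z. Proof. by case: z. Qed.
Lemma Im_oppc z : complex.Im (- z) = - complex.Im z. Proof. by case: z. Qed.
Lemma Re_mulc z w : complex.Re (z * w) =
  complex.Re z * complex.Re w - complex.Im z * complex.Im w.
Proof. by case: z w => ? ? [? ?]. Qed.
Lemma Im_mulc z w : complex.Im (z * w) =
  complex.Re z * complex.Im w + complex.Im z * complex.Re w.
Proof. by case: z w => ? ? [? ?]. Qed.

Lemma cpartD b z w : cpart b (z + w) = cpart b z + cpart b w.
Proof. by case: b; [exact: Im_addc|exact: Re_addc]. Qed.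
Lemma cpartN b z : cpart b (- z) = - cpart b z.
Proof. by case: b; [exact: Im_oppc|exact: Re_oppc]. Qed.
Lemma cpartB b z w : cpart b (z - w) = cpart b z - cpart b w.
Proof. by rewrite cpartD cpartN. Qed.
Lemma cpartZ b (k : R) z : cpart b (k%:C * z) = k * cpart b z.
Proof. by case: b; case: z => ? ?; rewrite /= mul0r ?addr0 ?subr0. Qed.

Lemma cpart_inj z w : (forall b, cpart b z = cpart b w) -> z = w.
Proof.
by case: z w => [a b] [c d] h; have /= -> := h false; have /= -> := h true.
Qed.

Lemma cpart_eq0 z : z = 0 <-> forall b, cpart b z = 0.
Proof. by split => [-> []|h] //; apply: cpart_inj => b; rewrite h; case: b. Qed.

Lemma normc_sqr z : Normc.normc z ^+ 2 = \sum_b cpart b z ^+ 2.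
Proof.
case: z => a b; rewrite /Normc.normc sqr_sqrtr ?addr_ge0 ?sqr_ge0//.
by rewrite big_bool /= addrC.
Qed.

End complex_parts.

Section complex_sobolev.
Context {R : realType} {N : nat}.
Variable Omega : set 'rV[R]_N.
Hypothesis oO : open Omega.
Notation mu := (lebesgueN N).
Notation sqint := (sqint Omega).
Implicit Types F G : 'rV[R]_N -> R[i].

Let mO : measurable Omega := open_measurable_rV oO.

Lemma L2_normc_integrable F : L2 Omega F ->
  mu.-integrable Omega (EFin \o (fun x => Normc.normc (F x) ^+ 2)).
Proof.
move=> [[mR mI] F2].
have mF c : measurable_fun Omega (fun x => cpart c (F x)) by case: c.
apply/integrableP; split.
  apply/measurable_EFinP; under eq_fun do rewrite normc_sqr big_bool/=.
  by apply: measurable_funD; under eq_fun do rewrite expr2;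
    apply: measurable_funM; [exact: (mF true)..|exact: (mF false)|exact: (mF false)].
by under eq_integral do rewrite /= ger0_norm ?sqr_ge0//.
Qed.

Lemma L2P F : L2 Omega F <-> forall b, sqint (fun x => cpart b (F x)).
Proof.
split=> [LF b|sF].
  have mF : measurable_fun Omega (fun x => cpart b (F x)) by case: b; case: LF => -[].
  apply: (sqint_le oO mF (L2_normc_integrable LF)); apply: aeW => x _.
  by rewrite normc_sqr (bigD1 b)//= lerDl sumr_ge0// => c _; exact: sqr_ge0.
split; first by split; [have [] := sF false|have [] := sF true].
under eq_integral do rewrite normc_sqr big_bool.
have := integrableD mO (proj2 (sF true)) (proj2 (sF false)).
move=> /integrableP[_]; apply: le_lt_trans; rewrite le_eqVlt; apply/orP; left.
apply/eqP; apply: eq_integral => x _.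
by rewrite /= ger0_norm// addr_ge0 ?sqr_ge0.
Qed.

Lemma CcinftyP (psi : 'rV[R]_N -> R[i]) :
  Ccinfty Omega psi <-> forall b, test_fun Omega (fun x => cpart b (psi x)).
Proof.
have S : closure [set x | psi x != 0] =
    closure [set x | cpart true (psi x) != 0] `|`
    closure [set x | cpart false (psi x) != 0].
  rewrite -closureU; congr closure; apply/seteqP; split => x /=.
    move=> /eqP px; apply: contrapT => /not_orP[/negP h1 /negP h2]; apply: px.
    apply/cpart_eq0 => -[]; apply/eqP; by rewrite -[_ == _]negbK.
  by case; apply: contra => /eqP ->; rewrite /= eqxx.
split=> [[CR CI cp pO] b|tp].
  have sb : closure [set x | cpart b (psi x) != 0] `<=`
      closure [set x | psi x != 0] by rewrite S; case: b => x; [left|right].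
  split; first by case: b {sb}.
  - by apply: subclosed_compact cp sb; exact: closed_closure.
  - exact: subset_trans pO.
have [Ct ct tO] := tp true; have [Cf cf fO] := tp false; split => //.
- by rewrite S; exact: compactU.
- by rewrite S => x [/tO|/fO].
Qed.

Lemma cpart_partial b k (psi : 'rV[R]_N -> R[i]) x :
  cpart b (partial k psi x) = 'D_('e_k) (fun y => cpart b (psi y)) x.
Proof. by case: b. Qed.

Lemma cpart_cintegral b F :
  cpart b (cintegral Omega F) = \int[mu]_(x in Omega) cpart b (F x).
Proof. by case: b. Qed.

(** A real test function is a complex one with zero imaginary part, and a complex test function
    splits into two real ones; so real test functions and each part of F and G separately
    suffice. *)
Lemma is_wpartialP k F G : L2 Omega F -> is_wpartial Omega k F G <->
  L2 Omega G /\ forall b psi, test_fun Omega psi ->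
    \int[mu]_(x in Omega) (cpart b (F x) * 'D_('e_k) psi x) =
    - \int[mu]_(x in Omega) (cpart b (G x) * psi x).
Proof.
move=> /L2P sF; split=> [[LG FG]|[/[dup] LG /L2P sG FG]]; split => //.
  move=> b psi tpsi.
  have /FG : Ccinfty Omega (fun x => (psi x)%:C).
    by apply/CcinftyP => -[]//=; exact: test_fun0.
  move=> /(congr1 (cpart b)); rewrite cpartN !cpart_cintegral => h.
  transitivity (\int[mu]_(x in Omega) cpart b (F x * partial k (fun x => (psi x)%:C) x)).
    apply: eq_Rintegral => x _.
    rewrite (_ : partial k _ x = ('D_('e_k) psi x)%:C); first by rewrite mulrC [in RHS]mulrC cpartZ.
    by apply: cpart_inj => -[]; rewrite cpart_partial//= derive_cst.
  by rewrite h; congr (- _); apply: eq_Rintegral => x _; rewrite mulrC [in RHS]mulrC cpartZ.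
move=> psi /CcinftyP tpsi.
have iFp b c : mu.-integrable Omega
    (EFin \o (fun x => cpart b (F x) * 'D_('e_k) (fun y => cpart c (psi y)) x)).
  by apply: (sqintM oO) => //; have [_] := test_fun_sqint oO (tpsi c); apply.
have iGp b c : mu.-integrable Omega
    (EFin \o (fun x => cpart b (G x) * cpart c (psi x))).
  by apply: (sqintM oO) => //; have [] := test_fun_sqint oO (tpsi c).
apply: cpart_inj => b; rewrite cpartN !cpart_cintegral.
case: b => /=.
- under eq_Rintegral do rewrite Im_mulc.
  under [in RHS]eq_Rintegral do rewrite Im_mulc.
  rewrite (RintegralD mO (iFp false true) (iFp true false)).
  rewrite (RintegralD mO (iGp false true) (iGp true false)) opprD.
  by rewrite -!FG.
- under eq_Rintegral do rewrite Re_mulc.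
  under [in RHS]eq_Rintegral do rewrite Re_mulc.
  rewrite (RintegralB mO (iFp false false) (iFp true true)).
  rewrite (RintegralB mO (iGp false false) (iGp true true)) opprD.
  by rewrite -!FG.
Qed.

Lemma L2B F G : L2 Omega F -> L2 Omega G -> L2 Omega (fun x => F x - G x).
Proof.
move=> /L2P sF /L2P sG; apply/L2P => b.
by under eq_fun do rewrite cpartB; exact: (sqintB oO).
Qed.

Lemma Ccinfty_L2 k psi : Ccinfty Omega psi ->
  L2 Omega psi /\ L2 Omega (partial k psi).
Proof.
move=> /CcinftyP tp; split; apply/L2P => b.
  by have [] := test_fun_sqint oO (tp b).
under eq_fun do rewrite cpart_partial.
by have [_] := test_fun_sqint oO (tp b); apply.
Qed.

Lemma Ccinfty_is_wpartial k psi : Ccinfty Omega psi ->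
  is_wpartial Omega k psi (partial k psi).
Proof.
move=> Cpsi; have [L2p L2dp] := Ccinfty_L2 k Cpsi.
apply/is_wpartialP => //; split => // b chi tchi.
rewrite (test_fun_ibp k (proj1 (CcinftyP psi) Cpsi b) tchi).
by congr (- _); apply: eq_Rintegral => x _; rewrite cpart_partial.
Qed.

Lemma is_wpartialB k F F' G G' : L2 Omega F -> L2 Omega F' ->
  is_wpartial Omega k F G -> is_wpartial Omega k F' G' ->
  is_wpartial Omega k (fun x => F x - F' x) (fun x => G x - G' x).
Proof.
move=> LF LF' /(is_wpartialP _ _ LF)[LG FG] /(is_wpartialP _ _ LF')[LG' FG'].
apply/is_wpartialP; first exact: L2B.
split=> [|b psi tpsi]; first exact: L2B.
have [sp sdp] := test_fun_sqint oO tpsi.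
under eq_Rintegral do rewrite cpartB mulrBl.
under [in RHS]eq_Rintegral do rewrite cpartB mulrBl.
move/L2P : LF => sF; move/L2P : LF' => sF'.
move/L2P : LG => sG; move/L2P : LG' => sG'.
rewrite (RintegralB mO (sqintM oO (sF b) (sdp k)) (sqintM oO (sF' b) (sdp k))).
rewrite (RintegralB mO (sqintM oO (sG b) sp) (sqintM oO (sG' b) sp)).
by rewrite FG// FG'// opprD.
Qed.

Lemma is_wpartial_unique k F G G' : L2 Omega F ->
  is_wpartial Omega k F G -> is_wpartial Omega k F G' ->
  {ae mu, forall x, Omega x -> G x = G' x}.
Proof.
move=> LF /(is_wpartialP _ _ LF)[LG FG] /(is_wpartialP _ _ LF)[LG' FG'].
move/L2P : LG => sG; move/L2P : LG' => sG'.
have h b : {ae mu, forall x, Omega x -> cpart b (G x) - cpart b (G' x) = 0}.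
  apply: (sqint_orthogonal0 oO) => [|psi tpsi]; first exact: (sqintB oO).
  have [sp _] := test_fun_sqint oO tpsi.
  under eq_Rintegral do rewrite mulrBl.
  rewrite (RintegralB mO (sqintM oO (sG b) sp) (sqintM oO (sG' b) sp)).
  by apply/eqP; rewrite subr_eq0 -eqr_opp -FG// -FG'.
apply: filterS2 (h true) (h false) => x ht hf Ox.
by apply: cpart_inj => -[]; apply/eqP; rewrite -subr_eq0; apply/eqP; auto.
Qed.

Lemma wpartialP k F : (exists G, is_wpartial Omega k F G) ->
  is_wpartial Omega k F (wpartial Omega k F).
Proof. by move=> FG; exact: (xgetPex (fun=> 0) FG). Qed.

Lemma wpartial_ae k F G : L2 Omega F -> is_wpartial Omega k F G ->
  {ae mu, forall x, Omega x -> wpartial Omega k F x = G x}.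
Proof.
move=> LF FG; have wF : is_wpartial Omega k F (wpartial Omega k F).
  by apply: wpartialP; exists G.
exact: (is_wpartial_unique LF wF FG).
Qed.

End complex_sobolev.

(** * From fast convergence in mean to dominated pointwise convergence *)

Section fast_convergence.
Context {R : realType} {N : nat}.
Variable Omega : set 'rV[R]_N.
Hypothesis oO : open Omega.
Notation mu := (lebesgueN N).
Notation sqint := (sqint Omega).

Let mO : measurable Omega := open_measurable_rV oO.

(** The squared errors have summable integrals, so their sum S is integrable and finite a.e. This
    gives pointwise convergence (terms of a convergent series) and domination at once, without
    extracting a subsequence. *)
Lemma fast_cvg1 (f : 'rV[R]_N -> R) (f_ : nat -> 'rV[R]_N -> R) :
  sqint f -> (forall n, sqint (f_ n)) ->
  (forall n, \int[mu]_(x in Omega) ((f_ n x - f x) ^+ 2) <= 1 / (2 ^ n.+1)%:R) ->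
  exists D : 'rV[R]_N -> R, [/\ mu.-integrable Omega (EFin \o D),
    forall x, 0 <= D x &
    {ae mu, forall x, Omega x -> (forall n, f_ n x ^+ 2 <= D x) /\
      f_ n x @[n --> \oo] --> f x}].
Proof.
move=> sf sf_ f_f.
pose u n x := (f_ n x - f x) ^+ 2.
have su n : mu.-integrable Omega (EFin \o u n).
  by have [] := sqintB oO (sf_ n) sf.
have mu_ n : measurable_fun Omega (EFin \o u n) by have /integrableP[] := su n.
have u0 n x : (0 <= (EFin \o u n) x)%E by rewrite lee_fin sqr_ge0.
pose S x := (\sum_(n <oo) (EFin \o u n) x)%E.
have mS : measurable_fun Omega S by apply: ge0_emeasurable_sum => // n _.
have S0 x : (0 <= S x)%E by apply: nneseries_ge0 => n _ _; exact: u0.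
have iS : (\int[mu]_(x in Omega) S x < +oo)%E.
  rewrite integral_nneseries//.
  apply: (@le_lt_trans _ _ 1%E); last exact: ltry.
  apply: le_trans (epsilon_trick0 (fun=> true) (ler01 : 0 <= 1 :> R)).
  apply: lee_nneseries => [n _ _|n _]; first exact: integral_ge0.
  rewrite -[leLHS]fineK ?lee_fin; first exact: f_f.
  exact: integrable_fin_num.
have SI : mu.-integrable Omega S.
  apply/integrableP; split => //.
  by under eq_integral do rewrite gee0_abs//.
have fS : mu.-integrable Omega (EFin \o (fun x => fine (S x))).
  apply/integrableP; split.
    by apply/measurable_EFinP; exact: measurableT_comp.
  apply: le_lt_trans iS; apply: ge0_le_integral => //.
  - apply/measurable_EFinP; apply: measurableT_comp => //.
    exact: measurableT_comp.
  - move=> x _; rewrite /= ger0_norm ?fine_ge0//.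
    by have := S0 x; case: (S x) => //= *; exact: leey.
have [_ f2] := sf.
(* From f_n^2 <= 2 f^2 + 2 (f_n - f)^2, where the last square is a term of S. *)
exists (fun x => 2 * (f x ^+ 2 + fine (S x))); split.
- apply: (@integrableZ _ _ _ oO 2 (fun x => f x ^+ 2 + fine (S x))).
  exact: (integrableD mO f2 fS).
- by move=> x; rewrite mulr_ge0// addr_ge0 ?sqr_ge0 ?fine_ge0.
apply: filterS (integrable_ae mO SI) => x Sx Ox; have {}Sx := Sx Ox.
have part k : \sum_(0 <= n < k) u n x <= fine (S x).
  rewrite -lee_fin fineK// -sumEFin.
  by apply: nneseries_lim_ge => n _ _; exact: u0.
have uS n : u n x <= fine (S x).
  apply: le_trans (part n.+1); rewrite big_nat_recr//= lerDr.
  by apply: sumr_ge0 => i _; exact: sqr_ge0.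
split=> [n|].
  have := uS n; rewrite /u; have := sqr_ge0 (f_ n x - 2 * f x); nra.
have cu : u n x @[n --> \oo] --> (0 : R).
  apply: cvg_series_cvg_0; apply: nondecreasing_is_cvgn.
    apply/nondecreasing_seqP => n; rewrite /series /= big_nat_recr//= lerDl.
    exact: sqr_ge0.
  by exists (fine (S x)) => _ [n _ <-]; exact: part.
have d0 : f_ n x - f x @[n --> \oo] --> (0 : R).
  apply: (@norm_squeeze0 _ _ (fun n => Num.sqrt (u n x))).
    by move=> n; rewrite /u sqrtr_sqr.
  by rewrite -(sqrtr0 R); exact: (cont_seq (@sqrt_continuous R) cu).
rewrite (_ : (fun n => f_ n x) = fun n => (f_ n x - f x) + f x).
  by rewrite -[X in _ --> X]add0r; apply: cvgD d0 _; exact: cvg_cst.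
by apply/funext => n; rewrite subrK.
Qed.

Lemma fast_cvg (I : finType) (f : I -> 'rV[R]_N -> R)
    (f_ : nat -> I -> 'rV[R]_N -> R) :
  (forall i, sqint (f i)) -> (forall n i, sqint (f_ n i)) ->
  (forall n i, \int[mu]_(x in Omega) ((f_ n i x - f i x) ^+ 2) <=
    1 / (2 ^ n.+1)%:R) ->
  exists D : 'rV[R]_N -> R, [/\ mu.-integrable Omega (EFin \o D),
    forall x, 0 <= D x &
    {ae mu, forall x, Omega x -> forall i, (forall n, f_ n i x ^+ 2 <= D x) /\
      f_ n i x @[n --> \oo] --> f i x}].
Proof.
move=> sf sf_ f_f.
have /choice[D DP] i := fast_cvg1 (sf i) (fun n => sf_ n i) (fun n => f_f n i).
exists (fun x => \sum_i D i x); split.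
- rewrite (_ : _ \o _ = fun x => (\sum_i (EFin \o D i) x)%E).
    by apply: integrable_sum => // i _; have [] := DP i.
  by apply/funext => x; rewrite /= sumEFin.
- by move=> x; apply: sumr_ge0 => i _; have [] := DP i.
suff : {ae mu, forall x, forall i, Omega x -> (forall n, f_ n i x ^+ 2 <= D i x) /\
      f_ n i x @[n --> \oo] --> f i x}.
  apply: filterS => x xD Ox i; have [fD cf] := xD i Ox; split => // n.
  apply: le_trans (fD n) _; rewrite (bigD1 i)//= lerDl sumr_ge0// => j _.
  by have [] := DP j.
by apply: filter_forall => i; have [] := DP i.
Qed.

End fast_convergence.

Section H10_closure.
Context {R : realType} {N : nat}.
Variable Omega : set 'rV[R]_N.
Hypothesis oO : open Omega.
Notation mu := (lebesgueN N).
Implicit Types F G : 'rV[R]_N -> R[i].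

Let mO : measurable Omega := open_measurable_rV oO.

(** [H1norm] is computed from the chosen weak derivatives; by uniqueness a.e. explicit ones, such as
    those of F - psi, may replace them. *)
Lemma H1normE F (G : 'I_N -> 'rV[R]_N -> R[i]) : L2 Omega F ->
  (forall k, is_wpartial Omega k F (G k)) ->
  H1norm Omega F = Num.sqrt (\int[mu]_(x in Omega) (Normc.normc (F x) ^+ 2) +
    \sum_(k < N) \int[mu]_(x in Omega) (Normc.normc (G k x) ^+ 2)).
Proof.
move=> LF FG; rewrite /H1norm; congr (Num.sqrt (_ + _)); apply: eq_bigr => k _.
have wF : is_wpartial Omega k F (wpartial Omega k F) by apply: wpartialP; exists (G k).
have [LG _] := FG k; have [LW _] := wF.
rewrite /Rintegral; congr fine; apply: ae_eq_integral => //.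
- by have /integrableP[] := L2_normc_integrable LW.
- by have /integrableP[] := L2_normc_integrable LG.
- by apply: filterS (wpartial_ae oO LF (FG k)) => x h /h ->.
Qed.

Lemma Rintegral_cpart_le F b : L2 Omega F ->
  \int[mu]_(x in Omega) (cpart b (F x) ^+ 2) <=
  \int[mu]_(x in Omega) (Normc.normc (F x) ^+ 2).
Proof.
move=> LF; apply: le_Rintegral => //.
- by have [_] := (L2P oO F).1 LF b.
- exact: L2_normc_integrable.
- move=> x _; rewrite normc_sqr (bigD1 b)//= lerDl sumr_ge0// => c _.
  exact: sqr_ge0.
Qed.

Lemma H10_dominated_limit F : H10 Omega F ->
  dominated_limit Omega (fun b x => cpart b (F x))
    (fun b k x => cpart b (wpartial Omega k F x)).
Proof.
move=> [[LF wF] dF]; have wp k := wpartialP (wF k).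
have e0 n : 0 < 1 / (2 ^ n.+1)%:R :> R by rewrite divr_gt0// ltr0n expn_gt0.
have /choice[psi psiP] (n : nat) : exists psi, Ccinfty Omega psi /\
    H1norm Omega (fun x => F x - psi x) < Num.sqrt (1 / (2 ^ n.+1)%:R).
  have [|psi Cpsi psiF] := dF (Num.sqrt (1 / (2 ^ n.+1)%:R)); first by rewrite sqrtr_gt0.
  by exists psi.
(* [None] stands for the function and [Some k] for its k-th derivative, so that one majorant serves
   F and all its derivatives. *)
pose f (j : bool * option 'I_N) x := cpart j.1
  (if j.2 is Some k then wpartial Omega k F x else F x).
pose f_ n (j : bool * option 'I_N) x := cpart j.1
  (if j.2 is Some k then partial k (psi n) x else psi n x).
have sf j : sqint Omega (f j).
  case: j => b [k|]; last exact: (L2P oO F).1.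
  by have [LW _] := wp k; exact: (L2P oO _).1.
have sf_ n j : sqint Omega (f_ n j).
  have [Cpsi _] := psiP n; case: j => b [k|].
    by have [_ L] := Ccinfty_L2 oO k Cpsi; exact: (L2P oO _).1.
  by have [] := test_fun_sqint oO ((CcinftyP Omega (psi n)).1 Cpsi b).
have f_f n j : \int[mu]_(x in Omega) ((f_ n j x - f j x) ^+ 2) <= 1 / (2 ^ n.+1)%:R.
  have [Cpsi] := psiP n.
  have Lp : L2 Omega (psi n).
    apply/(L2P oO) => b; by have [] := test_fun_sqint oO ((CcinftyP Omega (psi n)).1 Cpsi b).
  have LFp := L2B oO LF Lp.
  have wFp k := is_wpartialB oO LF Lp (wp k) (Ccinfty_is_wpartial oO k Cpsi).
  rewrite (H1normE LFp wFp) ltr_sqrt// => h.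
  have A0 : 0 <= \int[mu]_(x in Omega) (Normc.normc (F x - psi n x) ^+ 2).
    by apply: Rintegral_ge0 => x _; exact: sqr_ge0.
  have B0 k : 0 <= \int[mu]_(x in Omega)
      (Normc.normc (wpartial Omega k F x - partial k (psi n) x) ^+ 2).
    by apply: Rintegral_ge0 => x _; exact: sqr_ge0.
  under eq_Rintegral do rewrite -sqrrN opprB.
  case: j => b [k|].
    have [LG _] := wFp k.
    apply: le_trans (ltW h); apply: le_trans (_ : _ <= \sum_(k < N) \int[mu]_(x in Omega)
      (Normc.normc (wpartial Omega k F x - partial k (psi n) x) ^+ 2)) _; last by rewrite lerDr.
    rewrite (bigD1 k)//= -[leLHS]addr0 lerD ?sumr_ge0//.
    apply: le_trans (Rintegral_cpart_le b LG).
    by under [leRHS]eq_Rintegral do rewrite cpartB.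
  apply: le_trans (ltW h); rewrite -[leLHS]addr0 lerD ?sumr_ge0//.
  apply: le_trans (Rintegral_cpart_le b LFp).
  by under [leRHS]eq_Rintegral do rewrite cpartB.
have [D [iD D0 fD]] := fast_cvg oO sf sf_ f_f.
exists (fun n b x => cpart b (psi n x)), D; split => //.
- by move=> n; apply/CcinftyP; have [] := psiP n.
- apply: filterS fD => x xP Ox b; have {}xP := xP Ox; split.
  + by move=> n; have [/(_ n)] := xP (b, None).
  + by move=> n k; have [/(_ n) + _] := xP (b, Some k); rewrite /f_ /= cpart_partial.
  + by have [] := xP (b, None).
  + by move=> k; have [_] := xP (b, Some k); rewrite /f_ /=; under eq_fun do rewrite cpart_partial.
Qed.

(** Converse of [H10_dominated_limit]: integration by parts passes to the limit and identifies g as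
    the weak gradient, then dominated convergence of the squared differences gives convergence in
    the H^1 norm. *)
Lemma dominated_limit_H10 F (g : bool -> 'I_N -> 'rV[R]_N -> R) :
  (forall b, measurable_fun Omega (fun x => cpart b (F x))) ->
  (forall b k, measurable_fun Omega (g b k)) ->
  dominated_limit Omega (fun b x => cpart b (F x)) g ->
  H10 Omega F /\ forall k, is_wpartial Omega k F (fun x => g false k x +i* g true k x).
Proof.
move=> mF mg [chi [D [tchi iD chiP]]].
pose G k x := g false k x +i* g true k x.
have GE b k x : cpart b (G k x) = g b k x by case: b.
have sF b : sqint Omega (fun x => cpart b (F x)).
  apply: (sqint_le oO (mF b) iD); apply: filterS chiP => x xP Ox.
  by have [h1 _ h2 _] := xP Ox b; exact: sqr_lim_le h1 h2.
have sg b k : sqint Omega (g b k).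
  apply: (sqint_le oO (mg b k) iD); apply: filterS chiP => x xP Ox.
  by have [_ h1 _ h2] := xP Ox b; exact: sqr_lim_le (h1^~ k) (h2 k).
have LF : L2 Omega F by apply/(L2P oO).
have LG k : L2 Omega (G k) by apply/(L2P oO) => b; under eq_fun do rewrite GE.
have stchi n b := test_fun_sqint oO (tchi n b).
have FG k : is_wpartial Omega k F (G k).
  apply/(is_wpartialP oO) => //; split => // b psi tpsi.
  have [sp sdp] := test_fun_sqint oO tpsi.
  have h1 : \int[mu]_(x in Omega) (chi n b x * 'D_('e_k) psi x) @[n --> \oo] -->
      \int[mu]_(x in Omega) (cpart b (F x) * 'D_('e_k) psi x).
    apply: (sqint_mul_cvg oO _ (mF b) iD (sdp k)).
      by move=> n; have [[]] := stchi n b.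
    by apply: filterS chiP => x xP Ox; have [] := xP Ox b.
  have h2 : \int[mu]_(x in Omega) ('D_('e_k) (chi n b) x * psi x) @[n --> \oo] -->
      \int[mu]_(x in Omega) (cpart b (G k x) * psi x).
    under [X in _ --> X]eq_Rintegral do rewrite GE.
    apply: (sqint_mul_cvg oO _ (mg b k) iD sp).
      by move=> n; have [_ /(_ k)[]] := stchi n b.
    by apply: filterS chiP => x xP Ox; have [_ + _ +] := xP Ox b; split; auto.
  have h3 : \int[mu]_(x in Omega) (chi n b x * 'D_('e_k) psi x) @[n --> \oo] -->
      - \int[mu]_(x in Omega) (cpart b (G k x) * psi x).
    by under eq_fun do rewrite (test_fun_ibp k (tchi _ b) tpsi); exact: cvgN.
  by apply: (cvg_unique _ h1 h3); exact: Rhausdorff.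
split => //; split; first by split => // k; exists (G k).
move=> eps eps0.
pose psi n x := chi n false x +i* chi n true x.
have psiE b n x : cpart b (psi n x) = chi n b x by case: b.
have Cpsi n : Ccinfty Omega (psi n).
  by apply/CcinftyP => b; under eq_fun do rewrite psiE.
have Lpsi n : L2 Omega (psi n).
  by apply/(L2P oO) => b; under eq_fun do rewrite psiE; have [] := stchi n b.
have wpsi n k := Ccinfty_is_wpartial oO k (Cpsi n).
have small (H : 'rV[R]_N -> R[i]) (h : nat -> 'rV[R]_N -> R[i]) :
    L2 Omega H -> (forall n, L2 Omega (h n)) ->
    {ae mu, forall x, Omega x -> forall b,
      (forall n, cpart b (h n x) ^+ 2 <= D x) /\
      cpart b (h n x) @[n --> \oo] --> cpart b (H x)} ->
    \int[mu]_(x in Omega) (Normc.normc (H x - h n x) ^+ 2) @[n --> \oo] --> (0 : R).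
  move=> LH Lh hH.
  have -> : (0 : R) = \int[mu]_(x in Omega) 0 by rewrite Rintegral_cst// mul0r.
  apply: (proj2 (@Rdominated_cvg _ _ _ oO _ _ (fun x => 8 * D x) _ _ _ _)).
  (* The majorant 8 D: for each of the two parts the approximant and the limit have squares at most
     D, so their difference has square at most 4 D. *)
  - move=> n; apply/measurable_EFinP.
    by have /integrableP[] := L2_normc_integrable (L2B oO LH (Lh n)).
  - exact: measurable_cst.
  - exact: (integrableZ oO).
  - apply: filterS hH => x hH Ox; have {}hH := hH Ox; split.
      move=> n; rewrite ger0_norm ?sqr_ge0// normc_sqr big_bool !cpartB.
      have hb b : (cpart b (H x) - cpart b (h n x)) ^+ 2 <= 4 * D x.
        have [h1 h2] := hH b; have := sqr_lim_le h1 h2; have := h1 n.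
        move: (cpart b (H x)) (cpart b (h n x)) => u v; have := sqr_ge0 (u + v); nra.
      by have := hb true; have := hb false; rewrite /=; lra.
    under eq_fun do rewrite normc_sqr big_bool.
    have hb b : cpart b (H x - h n x) ^+ 2 @[n --> \oo] --> (0 : R).
      have [_ ch] := hH b.
      have cz : cpart b (H x) - cpart b (h n x) @[n --> \oo] --> (0 : R).
        by rewrite -(subrr (cpart b (H x))); apply: cvgB => //; exact: cvg_cst.
      have -> : (fun n => cpart b (H x - h n x) ^+ 2) = (fun n =>
          (cpart b (H x) - cpart b (h n x)) * (cpart b (H x) - cpart b (h n x))).
        by apply/funext => n; rewrite cpartB expr2.
      by rewrite -(mulr0 (0 : R)); exact: cvgM.
    by have := cvgD (hb true) (hb false); rewrite addr0; apply.
have X0 : Num.sqrt (\int[mu]_(x in Omega) (Normc.normc (F x - psi n x) ^+ 2) +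
    \sum_(k < N) \int[mu]_(x in Omega) (Normc.normc (G k x - partial k (psi n) x) ^+ 2))
    @[n --> \oo] --> (0 : R).
  have cA : \int[mu]_(x in Omega) (Normc.normc (F x - psi n x) ^+ 2)
      @[n --> \oo] --> (0 : R).
    apply: small => //; apply: filterS chiP => x xP Ox b.
    have [h1 _ h2 _] := xP Ox b; split; first by move=> n; rewrite psiE.
    by under eq_fun do rewrite psiE.
  have cB k : \int[mu]_(x in Omega) (Normc.normc (G k x - partial k (psi n) x) ^+ 2)
      @[n --> \oo] --> (0 : R).
    apply: small => //.
      by move=> n; have [] := Ccinfty_L2 oO k (Cpsi n).
    apply: filterS chiP => x xP Ox b.
    have [_ h1 _ h2] := xP Ox b.
    have E n : cpart b (partial k (psi n) x) = 'D_('e_k) (chi n b) x.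
      by rewrite cpart_partial; congr ('D_('e_k) _ x); apply/funext => y; rewrite psiE.
    split; first by move=> n; rewrite E.
    by rewrite GE; under eq_fun do rewrite E; exact: h2.
  have cS (s : seq 'I_N) : \sum_(k <- s) \int[mu]_(x in Omega)
      (Normc.normc (G k x - partial k (psi n) x) ^+ 2) @[n --> \oo] --> (0 : R).
    elim: s => [|k s ih].
      by under eq_fun do rewrite big_nil; exact: cvg_cst.
    under eq_fun do rewrite big_cons.
    by have := cvgD (cB k) ih; rewrite addr0; apply.
  have := cvgD cA (cS (index_enum 'I_N)); rewrite addr0 => c0.
  by have := cont_seq (@sqrt_continuous R) (c0 _); rewrite sqrtr0; apply.
have /cvgrPdist_lt/(_ _ eps0)[n _ /(_ n (leqnn n)) nP] := X0.
exists (psi n) => //.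
rewrite (H1normE (L2B oO LF (Lpsi n)) (fun k => is_wpartialB oO LF (Lpsi n) (FG k) (wpsi n k))).
by apply: le_lt_trans (ler_norm _) _; rewrite sub0r normrN in nP.
Qed.

End H10_closure.

(** * The chain rule for radial multipliers *)

Section hermitian_parts.
Context {R : realType} {m : nat}.
Implicit Types u w : 'cV[R[i]]_m.

Definition vpart u (j : 'I_m * bool) : R := cpart j.2 (u j.1 ord0).

Lemma vpart_inj u w : (forall j, vpart u j = vpart w j) -> u = w.
Proof.
move=> h; apply/colP => i; apply: cpart_inj => b; exact: (h (i, b)).
Qed.

Lemma vpartD u w j : vpart (u + w) j = vpart u j + vpart w j.
Proof. by rewrite /vpart mxE cpartD. Qed.

Lemma vpartZ (k : R) u j : vpart (k%:C *: u) j = k * vpart u j.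
Proof. by rewrite /vpart mxE cpartZ. Qed.

Lemma Re_hdot u w : complex.Re (hdot u w) = \sum_j vpart u j * vpart w j.
Proof.
rewrite hdotE -(pair_big xpredT xpredT (fun i b => vpart u (i, b) * vpart w (i, b)))/=.
elim/big_ind2 : _ => // [z1 r1 z2 r2 <- <-|i _]; first exact: Re_addc.
rewrite big_bool /vpart /= Re_mulc addrC.
by case: (w i ord0) => ? ? /=; rewrite mulrN opprK.
Qed.

Lemma hnormE u : hnorm u = nrm (vpart u).
Proof.
by rewrite /hnorm /nrm Re_hdot.
Qed.

Lemma hnorm_ge0 u : 0 <= hnorm u. Proof. exact: sqrtr_ge0. Qed.

Lemma hnorm_sqr u : hnorm u ^+ 2 = complex.Re (hdot u u).
Proof.
rewrite hnormE nrm_sqr Re_hdot /sqn.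
by apply: eq_bigr => j _; rewrite expr2.
Qed.

Lemma hnorm0_eq0 u : hnorm u = 0 -> u = 0.
Proof.
move=> u0; apply: vpart_inj => j.
have -> : vpart (0 : 'cV[R[i]]_m) j = 0 by rewrite /vpart mxE; case: (j.2).
by apply: sqn_eq0; rewrite -nrm_sqr -hnormE u0 expr0n.
Qed.

Lemma hnormZ (k : R) u : hnorm (k%:C *: u) = `|k| * hnorm u.
Proof.
rewrite !hnormE /nrm /sqn; under eq_bigr do rewrite vpartZ exprMn.
by rewrite -mulr_sumr sqrtrM ?sqr_ge0// sqrtr_sqr.
Qed.

End hermitian_parts.

Section measurability.
Context {R : realType}.

Lemma measurable_invR : measurable_fun setT (fun x : R => x^-1).
Proof.
have -> : [set: R] = [set 0] `|` ~` [set 0] by rewrite setUv.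
apply/measurable_funU.
- exact: measurable_set1.
- by apply: measurableC; exact: measurable_set1.
- split; first exact: measurable_fun_set1.
  apply: open_continuous_measurable_fun.
    by apply: closed_openC; exact: closed_eq.
  by move=> x /set_mem /= /eqP x0; exact: inv_continuous.
Qed.

Lemma continuous_measurable_comp d (T : measurableType d) (D : set T)
    (h : R -> R) (f : T -> R) : continuous h -> measurable_fun D f ->
  measurable_fun D (fun x => h (f x)).
Proof.
by move=> ch mf; apply: measurableT_comp mf; exact: continuous_measurable_fun.
Qed.

End measurability.

Section vector_sobolev.
Context {R : realType} {N m : nat}.
Variable Omega : set 'rV[R]_N.
Hypothesis oO : open Omega.
Notation mu := (lebesgueN N).
Implicit Types u v p : 'rV[R]_N -> 'cV[R[i]]_m.

Let mO : measurable Omega := open_measurable_rV oO.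

Lemma H10v_sqint v j : H10v Omega v ->
  sqint Omega (fun x => vpart (v x) j) /\
  forall k, sqint Omega (fun x => vpart (wpartialv Omega k v x) j).
Proof.
move=> Hv; have [[LF wF] _] := Hv j.1.
split=> [|k]; first exact: ((L2P oO _).1 LF j.2).
rewrite /vpart /wpartialv; under eq_fun do rewrite mxE.
have [LW _] := wpartialP (wF k); exact: ((L2P oO _).1 LW j.2).
Qed.

Lemma H10v_dominated_limit v : H10v Omega v ->
  dominated_limit Omega (fun j x => vpart (v x) j)
    (fun j k x => vpart (wpartialv Omega k v x) j).
Proof.
move=> Hv.
have /choice[chi /choice[D chiP]] := fun i => H10_dominated_limit oO (Hv i).
exists (fun n j x => chi j.1 n j.2 x), (fun x => \sum_i D i x); split.
- by move=> n j; have [] := chiP j.1.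
- rewrite (_ : _ \o _ = fun x => (\sum_i (EFin \o D i) x)%E).
    by apply: integrable_sum => // i _; have [] := chiP i.
  by apply/funext => x; rewrite /= sumEFin.
suff : {ae mu, forall x, forall i, Omega x -> forall b,
  [/\ forall n, chi i n b x ^+ 2 <= D i x,
      forall n k, ('D_('e_k) (chi i n b) x) ^+ 2 <= D i x,
      chi i n b x @[n --> \oo] --> cpart b (v x i ord0) &
      forall k, 'D_('e_k) (chi i n b) x @[n --> \oo] -->
        cpart b (wpartial Omega k (fun y => v y i ord0) x)]}.
  apply: filterS => x xP Ox [i b] /=.
  have le i' : D i' x <= \sum_j D j x.
    rewrite (bigD1 i')//= lerDl sumr_ge0// => j _.
    by have [/(_ 0%N) + _ _ _] := xP j Ox true; apply: le_trans; exact: sqr_ge0.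
  have [h1 h2 h3 h4] := xP i Ox b; split => //.
  + by move=> n; exact: le_trans (h1 n) (le i).
  + by move=> n k; exact: le_trans (h2 n k) (le i).
  + by move=> k; rewrite /vpart /wpartialv mxE; exact: h4.
by apply: filter_forall => i; have [] := chiP i.
Qed.

Lemma dominated_limit_H10v v (G : 'I_N -> 'rV[R]_N -> 'cV[R[i]]_m) :
  (forall j, measurable_fun Omega (fun x => vpart (v x) j)) ->
  (forall j k, measurable_fun Omega (fun x => vpart (G k x) j)) ->
  dominated_limit Omega (fun j x => vpart (v x) j) (fun j k x => vpart (G k x) j) ->
  H10v Omega v /\
  {ae mu, forall x, Omega x -> forall k, wpartialv Omega k v x = G k x}.
Proof.
move=> mv mG [chi [D [tchi iD chiP]]].
have h i : H10 Omega (fun x => v x i ord0) /\ forall k, is_wpartial Omega k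
    (fun x => v x i ord0) (fun x => vpart (G k x) (i, false) +i* vpart (G k x) (i, true)).
  apply: (@dominated_limit_H10 _ _ Omega oO (fun x => v x i ord0)
    (fun b k x => vpart (G k x) (i, b)) (fun b => mv (i, b)) (fun b k => mG (i, b) k)).
  exists (fun n b => chi n (i, b)), D; split => //.
  by apply: filterS chiP => x xP Ox b; exact: xP Ox (i, b).
split=> [i|]; first by have [] := h i.
have ae1 : {ae mu, forall x, forall i, forall k, Omega x ->
    wpartial Omega k (fun x => v x i ord0) x =
    vpart (G k x) (i, false) +i* vpart (G k x) (i, true)}.
  apply: filter_forall => i; apply: filter_forall => k.
  have [[[LF _] _] wG] := h i; exact: (wpartial_ae oO LF (wG k)).
apply: filterS ae1 => x xP Ox k; apply: vpart_inj => -[i b].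
by rewrite /vpart /wpartialv mxE xP//; case: b.
Qed.

Lemma measurable_hnorm v : (forall j, measurable_fun Omega (fun x => vpart (v x) j)) ->
  measurable_fun Omega (fun x => hnorm (v x)).
Proof.
move=> mv; under eq_fun do rewrite hnormE.
apply: continuous_measurable_comp; first exact: sqrt_continuous.
apply: measurable_sum => j; under eq_fun do rewrite expr2.
exact: measurable_funM.
Qed.

(** At zeros of p the formula reduces to a(0) dp, because the second summand carries the factor p x;
    the default value of the division by 0 is harmless. *)
Theorem H10v_radial a c p : radialC1 a c -> H10v Omega p ->
  H10v Omega (nscale a p) /\
  {ae mu, forall x, Omega x -> forall k, wpartialv Omega k (nscale a p) x =
    (a (hnorm (p x)))%:C *: wpartialv Omega k p x +
    ((c (hnorm (p x)) - a (hnorm (p x))) / hnorm (p x) ^+ 2 *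
      complex.Re (hdot (p x) (wpartialv Omega k p x)))%:C *: p x}.
Proof.
move=> rac Hp.
have mp j : measurable_fun Omega (fun x => vpart (p x) j).
  by have [[]] := H10v_sqint j Hp.
have mdp j k : measurable_fun Omega (fun x => vpart (wpartialv Omega k p x) j).
  by have [_ /(_ k)[]] := H10v_sqint j Hp.
have mn := measurable_hnorm mp.
have ma : measurable_fun Omega (fun x => a (hnorm (p x))).
  exact: continuous_measurable_comp (radial_conta rac) mn.
have mc : measurable_fun Omega (fun x => c (hnorm (p x))).
  exact: continuous_measurable_comp (radial_contc rac) mn.
apply: (@dominated_limit_H10v _ (fun k x => (a (hnorm (p x)))%:C *: wpartialv Omega k p x +
    ((c (hnorm (p x)) - a (hnorm (p x))) / hnorm (p x) ^+ 2 *
      complex.Re (hdot (p x) (wpartialv Omega k p x)))%:C *: p x)).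
- by move=> j; under eq_fun do rewrite /nscale vpartZ; exact: measurable_funM.
- move=> j k; under eq_fun do rewrite vpartD !vpartZ Re_hdot.
  apply: measurable_funD; first exact: measurable_funM.
  apply: measurable_funM => //; apply: measurable_funM.
    apply: measurable_funM; first exact: measurable_funB.
    apply: (measurableT_comp measurable_invR).
    by under eq_fun do rewrite expr2; exact: measurable_funM.
  by apply: measurable_sum => l; exact: measurable_funM.
have := dominated_limit_radial mO rac (H10v_dominated_limit Hp).
congr dominated_limit.
- by apply/funext => j; apply/funext => x; rewrite /nscale vpartZ hnormE.
- apply/funext => j; apply/funext => k; apply/funext => x.
  by rewrite vpartD !vpartZ Re_hdot hnormE.
Qed.

Lemma H10vD u v : H10v Omega u -> H10v Omega v ->
  H10v Omega (fun x => u x + v x) /\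
  {ae mu, forall x, Omega x -> forall k, wpartialv Omega k (fun x => u x + v x) x =
    wpartialv Omega k u x + wpartialv Omega k v x}.
Proof.
move=> Hu Hv.
have su j := H10v_sqint j Hu; have sv j := H10v_sqint j Hv.
apply: (@dominated_limit_H10v _ (fun k x => wpartialv Omega k u x + wpartialv Omega k v x)).
- move=> j; under eq_fun do rewrite vpartD.
  by apply: measurable_funD; [have [[]] := su j|have [[]] := sv j].
- move=> j k; under eq_fun do rewrite vpartD.
  by apply: measurable_funD; [have [_ /(_ k)[]] := su j|have [_ /(_ k)[]] := sv j].
have [chi [D [tchi iD chiP]]] := H10v_dominated_limit Hu.
have [chi' [D' [tchi' iD' chiP']]] := H10v_dominated_limit Hv.
have dp n j k x : 'D_('e_k) (fun x => chi n j x + chi' n j x) x =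
    'D_('e_k) (chi n j) x + 'D_('e_k) (chi' n j) x.
  have [_ d1 _] := test_fun_deriv k (tchi n j).
  have [_ d2 _] := test_fun_deriv k (tchi' n j).
  exact: partialD.
exists (fun n j x => chi n j x + chi' n j x), (fun x => 2 * (D x + D' x)); split.
- by move=> n j; exact: test_funD.
- apply: (@integrableZ _ _ _ oO 2 (fun x => D x + D' x)).
  exact: (integrableD mO iD iD').
apply: filterS2 chiP chiP' => x h1 h2 Ox j.
have [a1 b1 c1 d1] := h1 Ox j; have [a2 b2 c2 d2] := h2 Ox j.
have sq (y z : R) : y ^+ 2 <= D x -> z ^+ 2 <= D' x -> (y + z) ^+ 2 <= 2 * (D x + D' x).
  by move=> yD zD; have := sqr_ge0 (y - z); nra.
split.
- by move=> n; exact: sq.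
- by move=> n k; rewrite dp; exact: sq.
- by rewrite vpartD; exact: cvgD.
- by move=> k; under eq_fun do rewrite dp; rewrite vpartD; exact: cvgD.
Qed.

End vector_sobolev.

(** * Functions of one variable on the positive half-line *)

Section one_variable.
Context {R : realType}.
Implicit Types f g df dg E e : R -> R.

Lemma is_derive_mul f g (df dg x : R) : is_derive x 1 f df -> is_derive x 1 g dg ->
  is_derive x 1 (fun y : R => f y * g y) (df * g x + f x * dg).
Proof.
move=> h1 h2; apply: (@is_derive_eq _ _ _ _ _ _ _ _ (is_deriveM h1 h2)).
by rewrite !scaleRE addrC [g x * _]mulrC.
Qed.

Lemma is_derive_inv f (df x : R) : f x != 0 -> is_derive x 1 f df ->
  is_derive x 1 (fun y : R => (f y)^-1) (- df / f x ^+ 2).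
Proof.
move=> f0 h1; apply: (@is_derive_eq _ _ _ _ _ _ _ _ (is_deriveV f0 h1)).
by rewrite !scaleRE mulrC !mulNr mulrN.
Qed.

Lemma is_derive_div f g (df dg x : R) : g x != 0 ->
  is_derive x 1 f df -> is_derive x 1 g dg ->
  is_derive x 1 (fun y : R => f y / g y) ((df * g x - f x * dg) / g x ^+ 2).
Proof.
move=> g0 h1 h2.
apply: (@is_derive_eq _ _ _ _ _ _ _ _ (is_derive_mul h1 (is_derive_inv g0 h2))).
by field.
Qed.

Lemma is_derive_exp f (n : nat) (df x : R) : is_derive x 1 f df ->
  is_derive x 1 (fun y : R => f y ^+ n.+1) (n.+1%:R * f x ^+ n * df).
Proof.
move=> h1; rewrite -(exprfctE f).
by apply: (@is_derive_eq _ _ _ _ _ _ _ _ (is_deriveX n.+1 h1)); rewrite scaleRE.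
Qed.

Lemma is_derive_add f g (df dg x : R) : is_derive x 1 f df -> is_derive x 1 g dg ->
  is_derive x 1 (fun y : R => f y + g y) (df + dg).
Proof. by move=> h1 h2; exact: is_deriveD. Qed.

Lemma is_derive_chain f g (df dg x : R) : is_derive (g x) 1 f df -> is_derive x 1 g dg ->
  is_derive x 1 (fun y : R => f (g y)) (df * dg).
Proof. by move=> h1 h2; exact: (is_derive1_comp h1 h2). Qed.

Lemma is_derive_continuous f (df x : R) : is_derive x 1 f df -> {for x, continuous f}.
Proof. by move=> [h _]; apply: differentiable_continuous; apply/derivable1_diffP. Qed.

Lemma mean_value f df (x y : R) : x <= y ->
  (forall t : R, x <= t <= y -> is_derive t 1 f (df t)) ->
  exists2 c, x <= c <= y & f y - f x = df c * (y - x).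
Proof.
move=> xy fd; have [||c + ->] := @MVT_segment R f df x y xy.
- by move=> t; rewrite in_itv/= => /andP[xt ty]; apply: fd; rewrite !ltW.
- by apply: derivable_within_continuous => t; rewrite in_itv/= => /fd[].
by rewrite in_itv/=; exists c.
Qed.

(** The right end is an extended real: [+oo] for monotonicity on the whole half-line, a finite value
    for the neighbourhood of 0 on which (iv) speaks. *)
Lemma ndecr_pos f df (x0 : \bar R) : 
  (forall t : R, 0 < t -> (t%:E < x0)%E -> is_derive t 1 f (df t)) ->
  (forall t : R, 0 < t -> (t%:E < x0)%E -> 0 <= df t) ->
  forall x y, 0 < x -> x <= y -> (y%:E < x0)%E -> f x <= f y.
Proof.
move=> fd df0 x y x0' xy yx.
have lt0 t : x <= t <= y -> 0 < t /\ (t%:E < x0)%E.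
  move=> /andP[xt ty]; split; first exact: lt_le_trans xt.
  by apply: le_lt_trans yx; rewrite lee_fin.
have [t ht|c hc] := @mean_value f df x y xy; first by apply: fd; have [] := lt0 t ht.
rewrite -subr_ge0 => ->; rewrite mulr_ge0 ?subr_ge0// df0//; by have [] := lt0 c hc.
Qed.

Section inverse.
Variables g dg : R -> R.
Hypothesis gd : forall s : R, 0 < s -> is_derive s 1 g (dg s).
Hypothesis dg0 : forall s : R, 0 < s -> 0 < dg s.

Lemma incr_pos x y : 0 < x -> x < y -> g x < g y.
Proof.
move=> x0 xy; have t0 t : x <= t <= y -> 0 < t by move=> /andP[xt _]; exact: lt_le_trans xt.
have [t /t0|c /t0 c0] := @mean_value g dg x y (ltW xy); first exact: gd.
by rewrite -subr_gt0 => ->; rewrite mulr_gt0 ?subr_gt0 ?dg0.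
Qed.

Lemma incr_posE x y : 0 < x -> 0 < y -> (g x < g y) = (x < y).
Proof.
move=> x0 y0; case: (ltgtP x y) => [/(incr_pos x0)->//| |->]; last by rewrite ltxx.
by move=> /(incr_pos y0) h; rewrite ltNge (ltW h).
Qed.

Lemma inj_pos x y : 0 < x -> 0 < y -> g x = g y -> x = y.
Proof.
move=> x0 y0 gxy; case: (ltgtP x y) => //; rewrite -incr_posE// gxy ltxx//.
Qed.

(** Strict monotonicity of g makes a right inverse z strictly increasing and continuous, which is
    what the inverse function rule needs. *)
Lemma inverse_pos (z : R -> R) : (forall t : R, 0 < t -> 0 < z t /\ g (z t) = t) ->
  forall t : R, 0 < t -> is_derive t 1 z (dg (z t))^-1.
Proof.
move=> zP t t0; have [zt0 gz] := zP t t0.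
have zE (t1 t2 : R) : 0 < t1 -> 0 < t2 -> (z t1 < z t2) = (t1 < t2).
  move=> t10 t20; have [z1 g1] := zP _ t10; have [z2 g2] := zP _ t20.
  by rewrite -(incr_posE z1 z2) g1 g2.
have zg (s : R) : 0 < s -> 0 < g s -> z (g s) = s.
  by move=> s0 gs0; have [zs gs] := zP _ gs0; exact: inj_pos.
have cz (u : R) : 0 < u -> {for u, continuous z}.
  move=> u0; have [zu gu] := zP _ u0.
  apply/cvgrPdist_lt => eps e0 /=.
  (* The lower comparison point has to stay positive, since nothing is known about g elsewhere. *)
  pose a := Num.max (z u - eps) (z u / 2).
  have a0 : 0 < a by rewrite lt_max divr_gt0// orbT.
  have au : a < z u.
    by rewrite gt_max ltr_pdivrMr// ltr_pMr// ltr1n andbT; lra.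
  near=> v.
  have v0 : 0 < v by near: v; exact: lt_nbhsr.
  have [zv gv] := zP _ v0.
  have h1 : g a < v by near: v; apply: lt_nbhsr; rewrite -[ltRHS]gu incr_posE.
  have h2 : v < g (z u + eps).
    by near: v; apply: lt_nbhsl; rewrite -[ltLHS]gu incr_posE// ?ltrDl// addr_gt0.
  have {}h1 : a < z v by rewrite -incr_posE// gv.
  have {}h2 : z v < z u + eps by rewrite -incr_posE ?gv// addr_gt0.
  have : z u - eps < z v by apply: le_lt_trans h1; rewrite le_max lexx.
  rewrite ltr_norml; move: h2; lra.
have pos_near : \forall y \near t, 0 < y by exact: lt_nbhsr.
rewrite -[t in is_derive t]gz.
have nz : \forall s \near z t, z (g s) = s.
  have cg : {for z t, continuous g} by exact: is_derive_continuous (gd zt0).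
  near=> s; apply: zg; near: s; first exact: lt_nbhsr.
  by apply: (cg [set y | 0 < y]); rewrite /= gz; exact: lt_nbhsr.
apply: (@is_derive_inverse R g z (dg (z t)) (z t)) => //; last by rewrite gt_eqF// dg0.
  near=> s; apply: is_derive_continuous; apply: gd; near: s; exact: lt_nbhsr.
exact: gd.
Unshelve. all: by end_near. Qed.

Lemma inverse_pos_ex : (forall t : R, 0 < t -> exists s1 s2 : R, [/\ 0 < s1, s1 <= s2, g s1 <= t & t <= g s2]) ->
  exists z, forall t : R, 0 < t -> 0 < z t /\ g (z t) = t.
Proof.
move=> gr; have zE (t : R) : exists s : R, 0 < t -> 0 < s /\ g s = t.
  have [t0|tn] := ltP 0 t; last by exists 0.
  have [s1 [s2 [s10 s12 g1 g2]]] := gr t t0.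
  have [|| s] := @IVT R g s1 s2 t s12.
  - apply: derivable_within_continuous => s; rewrite in_itv/= => /andP[s1s _].
    by have [] := gd (lt_le_trans s10 s1s).
  - by rewrite ge_min g1 le_max g2 orbT.
  by rewrite in_itv/= => /andP[s1s _] gs; exists s => _; rewrite (lt_le_trans s10 s1s).
by have [z zP] := choice zE; exists z.
Qed.

End inverse.

End one_variable.

(** * Radial multipliers from functions on the open half-line *)

Section radial_construction.
Context {R : realType}.

Lemma continuous_if_pos (f : R -> R) (l : R) :
  (forall t : R, 0 < t -> {for t, continuous f}) -> f t @[t --> 0^'+] --> l ->
  continuous (fun t : R => if 0 < t then f t else l).
Proof.
move=> cf f0 t; have [t0|t0|<-] := ltgtP 0 t.
- rewrite /continuous_at t0; have := cf t t0; rewrite /continuous_at.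
  move=> h; apply: cvg_trans h; apply: near_eq_cvg; near=> s.
  by rewrite ifT//; near: s; exact: lt_nbhsr.
- rewrite /continuous_at (ltNge 0 t) (ltW t0) /=.
  apply: cvg_near_cst; near=> s; rewrite ltNge ifF//.
  by apply/negbF; rewrite ltW//; near: s; exact: lt_nbhsl.
rewrite /continuous_at ltxx; apply/cvgrPdist_lt => eps e0 /=.
have /cvgrPdist_lt /(_ _ e0) := f0; rewrite near_withinE => h.
near=> s; case: ifPn => [s0|_]; last by rewrite subrr normr0.
by move: s0; near: s; apply: filterS h => s hs s0; exact: hs.
Unshelve. all: by end_near. Qed.

(** Since X tends to 0 at 0, the mean value theorem gives X t / t the same limit k as [dX]. This
    yields continuity of the first multiplier at 0 and the common value at 0 of the pair. *)
Lemma radial_of (X dX : R -> R) (k B : R) :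
  (forall t : R, 0 < t -> is_derive t 1 X (dX t)) ->
  (forall t : R, 0 < t -> {for t, continuous dX}) ->
  (forall t : R, 0 < t -> `|dX t| <= B) ->
  X t @[t --> 0^'+] --> 0 -> dX t @[t --> 0^'+] --> k ->
  radialC1 (fun t => if 0 < t then X t / t else k)
           (fun t => if 0 < t then dX t else k).
Proof.
move=> Xd cdX dXB X0 dX0.
(* Used twice: with e small near 0 for the limit of X t / t, and with e = B + |k| on all of the
   half-line for its boundedness. *)
have diffle (e eta : R) : 0 <= e -> (forall s : R, 0 < s -> s < eta -> `|dX s - k| <= e) ->
    forall t : R, 0 < t -> t < eta -> `|X t / t - k| <= e.
  move=> e0 he t t0 teta.
  pose Y (s : R) := X s - k * s.
  have Yd (s : R) : 0 < s -> is_derive s 1 Y (dX s - k).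
    move=> s0; have h1 := Xd s s0.
    have h2 := is_derive_mul (is_derive_cst k s 1) (is_derive_id s 1).
    apply: (@is_derive_eq _ _ _ _ _ _ _ _ (is_deriveB h1 h2)).
    by rewrite /=; ring.
  have Y0 : Y s @[s --> 0^'+] --> 0.
    have h : k * s @[s --> 0^'+] --> (k * 0 : R).
      apply: cvgM; first exact: cvg_cst.
      exact: cvg_at_right_filter.
    by have := cvgB X0 h; rewrite mulr0 subr0; exact.
  have Yle : `|Y t| <= e * t.
    apply/ler_addgt0Pr => eps eps0.
    have /cvgrPdist_lt /(_ _ eps0) := Y0 => hY.
    (* Nothing is known of X at 0 itself, so the mean value theorem is applied on [s, t] with s
       small enough that Y s is negligible. *)
    have [s [s0 st Ys]] : exists s : R, [/\ 0 < s, s < t & `|Y s| < eps].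
      have : \forall s \near 0^'+, [/\ 0 < s, s < t & `|Y s| < eps].
        near=> s; split.
        - by near: s; exact: nbhs_right_gt.
        - by near: s; exact: nbhs_right_lt.
        by rewrite -normrN -[- Y s]sub0r; near: s.
      by move=> /filter_ex.
    have [u hu|c /andP[sc ct] E] := @mean_value _ Y (fun s => dX s - k) s t (ltW st).
      by apply: Yd; case/andP: hu => su _; exact: lt_le_trans su.
    have -> : Y t = (Y t - Y s) + Y s by rewrite subrK.
    apply: (le_trans (ler_normD _ _)); apply: lerD; last exact: ltW.
    have ts : 0 <= t - s by rewrite subr_ge0 ltW.
    rewrite E normrM (ger0_norm ts).
    apply: ler_pM => //.
      by apply: he; [exact: lt_le_trans sc|exact: le_lt_trans teta].
    by rewrite gerBl ltW.
  have -> : X t / t - k = Y t / t by rewrite /Y; field; rewrite gt_eqF.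
  by rewrite normrM normfV (gtr0_norm t0) ler_pdivrMr.
have Xt0 : X t / t @[t --> 0^'+] --> k.
  apply/cvgrPdist_le => eps e0.
  have /cvgrPdist_le /(_ _ e0) := dX0.
  rewrite near_withinE => -[/= eta eta0 he].
  near=> t; rewrite distrC; apply: (diffle eps eta (ltW e0)).
  - move=> s s0 seta; rewrite distrC; apply: he => //.
    by rewrite /ball_/= sub0r normrN gtr0_norm.
  - by near: t; exact: nbhs_right_gt.
  - by near: t; exact: nbhs_right_lt.
have B0 : 0 <= B by apply: le_trans (dXB 1 ltr01).
split.
- apply: continuous_if_pos Xt0 => t t0.
  apply: cvgM; first exact: is_derive_continuous (Xd t t0).
  by apply: cvgV; rewrite ?gt_eqF//.
- exact: continuous_if_pos.
- by rewrite ltxx.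
- move=> t t0; rewrite t0; apply: near_eq_is_derive (Xd t t0).
  near=> s; have s0 : 0 < s by near: s; exact: lt_nbhsr.
  by rewrite s0; field; rewrite gt_eqF.
exists (B + `|k| + `|k|) => t; case: ifPn => t0; last by rewrite lerDr addr_ge0//; split.
split; last by rewrite (le_trans (dXB _ t0))// -addrA lerDl addr_ge0.
have -> : X t / t = (X t / t - k) + k by rewrite subrK.
apply: (le_trans (ler_normD _ _)); rewrite lerD2r.
apply: (diffle _ (t + 1)) => //; first by rewrite addr_ge0.
- move=> s s0 _; apply: (le_trans (ler_normB _ _)); rewrite lerD2r; exact: dXB.
- by rewrite ltrDl.
Unshelve. all: by end_near. Qed.

End radial_construction.

(** * Truncation *)

Section truncation.
Context {R : realType}.

(* cutoff n d t <= t ^+ n.+1 / d ^+ n; moreover cutoff n d t <= 1 / d for all t,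
   and cutoff n d t --> t as d --> 0. The derivative is dcutoff. *)
Definition tden n (d t : R) := t ^+ n + d ^+ n + d * t ^+ n.+1.
Definition cutoff n (d t : R) := t ^+ n.+1 / tden n d t.
Definition dcutoff n (d t : R) :=
  (t ^+ n * t ^+ n + n.+1%:R * t ^+ n * d ^+ n) / tden n d t ^+ 2.

Section fixed.
Variables (n : nat) (d t : R).
Hypotheses (d0 : 0 < d) (t0 : 0 < t).

Lemma tden_gt0 : 0 < tden n d t.
Proof. by rewrite !addr_gt0 ?mulr_gt0 ?exprn_gt0. Qed.

Lemma cutoff_gt0 : 0 < cutoff n d t.
Proof. by rewrite divr_gt0 ?tden_gt0 ?exprn_gt0. Qed.

Lemma cutoff_le : cutoff n d t <= t.
Proof.
rewrite ler_pdivrMr ?tden_gt0// exprS; apply: ler_wpM2l; first exact: ltW.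
by rewrite /tden -addrA lerDl addr_ge0 ?mulr_ge0 ?exprn_ge0 ?(ltW d0) ?(ltW t0).
Qed.

Lemma cutoff_leV : cutoff n d t <= d^-1.
Proof.
rewrite ler_pdivrMr ?tden_gt0// ler_pdivlMl// /tden ler_wpDl// addr_ge0//.
  by rewrite exprn_ge0// ltW.
by rewrite exprn_ge0// ltW.
Qed.

Lemma cutoff_le_exp : cutoff n d t <= t ^+ n.+1 / d ^+ n.
Proof.
apply: ler_wpM2l; first by rewrite exprn_ge0// ltW.
rewrite lef_pV2 ?posrE ?tden_gt0 ?exprn_gt0//.
by rewrite /tden addrAC lerDr addr_ge0 ?mulr_ge0 ?exprn_ge0 ?ltW.
Qed.

Lemma dcutoff_ge0 : 0 <= dcutoff n d t.
Proof. by rewrite divr_ge0 ?addr_ge0 ?mulr_ge0 ?exprn_ge0 ?(ltW d0) ?(ltW t0) ?ltW ?tden_gt0. Qed.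

Lemma dcutoff_le : dcutoff n d t <= n.+1%:R * (cutoff n d t / t).
Proof.
have D0 := tden_gt0.
have -> : cutoff n d t / t = t ^+ n * tden n d t / tden n d t ^+ 2.
  by rewrite /cutoff exprS; field; rewrite !gt_eqF.
rewrite mulrA; apply: ler_wpM2r; first by rewrite invr_ge0 ltW// exprn_gt0.
rewrite /tden; have := exprn_gt0 n t0; have := exprn_gt0 n d0; have := exprn_gt0 n.+1 t0.
have : 1 <= n.+1%:R :> R by rewrite ler1n.
move: (t ^+ n) (d ^+ n) (t ^+ n.+1) n.+1%:R => x y z w w1 z0 y0 x0.
have : 0 <= (w - 1) * x * x by rewrite !mulr_ge0 ?subr_ge0// ltW.
have : 0 <= w * (x * (d * z)) by rewrite !mulr_ge0// ?ltW//; lra.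
lra.
Qed.

End fixed.

Lemma is_derive_cutoff n (d t : R) : 0 < d -> 0 < t ->
  is_derive t 1 (cutoff n.+1 d) (dcutoff n.+1 d t).
Proof.
move=> d0 t0; have D0 := tden_gt0 n.+1 d0 t0.
have h1 := is_derive_exp n.+1 (is_derive_id t 1).
have h2 := is_derive_exp n (is_derive_id t 1).
have h3 := is_derive_add (is_derive_add h2 (is_derive_cst (d ^+ n.+1) t 1))
  (is_derive_mul (is_derive_cst d t 1) h1).
apply: (@is_derive_eq _ _ _ _ _ _ _ _ (is_derive_div (lt0r_neq0 D0) h1 h3)).
rewrite /dcutoff /= -/(tden n.+1 d t); congr (_ / _); rewrite /tden !exprS.
move: (t ^+ n) (d ^+ n) => x y; rewrite -[n.+2]addn1 natrD -[n.+1]addn1 natrD.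
by move: n%:R => m; ring.
Qed.

Lemma continuous_expr n : continuous (fun t : R => t ^+ n).
Proof. exact: exprn_continuous. Qed.

Lemma continuous_dcutoff n (d t : R) : 0 < d -> 0 < t -> {for t, continuous (dcutoff n d)}.
Proof.
move=> d0 t0; have D0 := tden_gt0 n d0 t0.
have cn j := @continuous_expr j.
have cD : continuous (tden n d).
  apply: cont_add; first exact: (cont_add (cn n) (@cont_cst _ _ (d ^+ n))).
  exact: (cont_mul (@cont_cst _ _ d) (cn n.+1)).
apply: cvgM.
  have h : continuous (fun t : R => t ^+ n * t ^+ n + n.+1%:R * t ^+ n * d ^+ n).
    apply: (cont_add (cont_mul (cn n) (cn n))).
    apply: (cont_mul _ (@cont_cst _ _ (d ^+ n))).
    exact: (cont_mul (@cont_cst _ _ _) (cn n)).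
  exact: h.
have h2 : continuous (fun t : R => tden n d t ^+ 2).
  rewrite (_ : (fun t : R => _) = fun t => tden n d t * tden n d t).
    exact: (cont_mul cD cD).
  by apply/funext => s; rewrite expr2.
by apply: cvgV; [rewrite expf_neq0// gt_eqF|exact: h2].
Qed.

Lemma cutoff_cvg n (t : R) : 0 < t ->
  (fun j : nat => cutoff n.+1 j.+1%:R^-1 t) @ \oo --> t /\
  (fun j : nat => dcutoff n.+1 j.+1%:R^-1 t) @ \oo --> (1 : R).
Proof.
move=> t0; pose d (j : nat) : R := j.+1%:R^-1.
have d0 : d @ \oo --> (0 : R) by exact: cvg_harmonic.
have dn : (fun j => d j ^+ n.+1) @ \oo --> (0 : R).
  have := cvg_comp d (fun x : R => x ^+ n.+1) d0 (@continuous_expr n.+1 0).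
  by rewrite expr0n.
have tn0 : t ^+ n.+1 != 0 by rewrite expf_neq0// gt_eqF.
have D0 : (fun j => tden n.+1 (d j) t) @ \oo --> t ^+ n.+1.
  have h1 : (fun j => t ^+ n.+1 + d j ^+ n.+1) @ \oo --> t ^+ n.+1 + 0.
    by apply: cvgD => //; exact: cvg_cst.
  have h2 : (fun j => d j * t ^+ n.+2) @ \oo --> 0 * t ^+ n.+2.
    by apply: cvgM => //; exact: cvg_cst.
  by have := cvgD h1 h2; rewrite mul0r !addr0; exact.
have Dv : (fun j => (tden n.+1 (d j) t)^-1) @ \oo --> (t ^+ n.+1)^-1 by exact: cvgV.
split.
  have h1 : (fun j => t ^+ n.+2 * (tden n.+1 (d j) t)^-1) @ \oo -->
      t ^+ n.+2 * (t ^+ n.+1)^-1 by apply: cvgM => //; exact: cvg_cst.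
  by move: h1; rewrite [in X in _ --> X]exprS mulfK//; exact.
have h : (fun j => t ^+ n.+1 * t ^+ n.+1 + n.+2%:R * t ^+ n.+1 * d j ^+ n.+1) @ \oo -->
    t ^+ n.+1 * t ^+ n.+1 + n.+2%:R * t ^+ n.+1 * 0.
  apply: cvgD; first exact: cvg_cst.
  by apply: cvgM => //; exact: cvg_cst.
have h1 : (fun j => (t ^+ n.+1 * t ^+ n.+1 + n.+2%:R * t ^+ n.+1 * d j ^+ n.+1) *
    ((tden n.+1 (d j) t)^-1 * (tden n.+1 (d j) t)^-1)) @ \oo -->
    (t ^+ n.+1 * t ^+ n.+1 + n.+2%:R * t ^+ n.+1 * 0) * ((t ^+ n.+1)^-1 * (t ^+ n.+1)^-1).
  by apply: cvgM => //; exact: cvgM.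
move: h1; rewrite mulr0 addr0 [in X in _ --> X]mulrA mulfK// mulfV// => h1.
rewrite (_ : (fun j => _) = fun j => (t ^+ n.+1 * t ^+ n.+1 + n.+2%:R * t ^+ n.+1 * d j ^+ n.+1) *
  ((tden n.+1 (d j) t)^-1 * (tden n.+1 (d j) t)^-1)); first exact: h1.
by apply/funext => j; rewrite /dcutoff expr2 invfM.
Qed.

(** Here e is the logarithmic derivative x E'(x) / E(x). Its lower bound near 0 makes E vanish there
    at least as fast as a multiple of x^(1/(q+1)); its upper bound 2 keeps the derivative of a
    truncation comparable with its quotient by t. *)
Record elastic (E e : R -> R) (q : nat) : Prop := Elastic {
  elastic_gt0 : forall x : R, 0 < x -> 0 < E x;
  elastic_derive : forall x : R, 0 < x -> is_derive x 1 E (e x * (E x / x));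
  elastic_cont : forall x : R, 0 < x -> {for x, continuous e};
  elastic_ge0_le2 : forall x : R, 0 < x -> 0 <= e x <= 2;
  elastic_origin : exists2 x0 : R, 0 < x0 &
    forall x : R, 0 < x -> x < x0 -> 1 <= q.+1%:R * e x }.

Section elastic_theory.
Variables (E e : R -> R) (q : nat).
Hypothesis Ee : elastic E e q.

Lemma elastic_le x y : 0 < x -> x <= y -> E x <= E y.
Proof.
move=> x0 xy; have [E0 Ed _ e2 _] := Ee.
apply: (@ndecr_pos _ E (fun x => e x * (E x / x)) +oo%E) => // [t t0 _|t t0 _|].
- exact: Ed.
- by have /andP[? _] := e2 t t0; rewrite mulr_ge0// divr_ge0 ?ltW ?E0.
- by rewrite ltry.
Qed.

(** E^(q+1) / x is nondecreasing near 0, since its derivative has the sign of (q+1) e - 1. C is its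
    value at x0 / 2, a point strictly inside the interval where the origin condition holds. *)
Lemma elastic_origin_bound : exists2 x1 : R, 0 < x1 &
  exists2 C, 0 < C & forall x : R, 0 < x -> x <= x1 -> E x ^+ q.+1 <= C * x.
Proof.
have [E0 Ed _ _ [x0 x00 eq1]] := Ee.
have x2 : 0 < x0 / 2 by rewrite divr_gt0.
exists (x0 / 2) => //; exists (E (x0 / 2) ^+ q.+1 / (x0 / 2)).
  by rewrite divr_gt0 ?exprn_gt0 ?E0.
move=> x xp xle; rewrite -ler_pdivrMr//.
apply: (@ndecr_pos _ (fun x => E x ^+ q.+1 / x)
  (fun x => E x ^+ q.+1 / x ^+ 2 * (q.+1%:R * e x - 1)) x0%:E) => // [t t0 tx|t t0 tx|].
- have tN := lt0r_neq0 t0.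
  apply: (@is_derive_eq _ _ _ _ _ _ _ _ (is_derive_div tN (is_derive_exp q (Ed t t0)) (is_derive_id t 1))).
  by rewrite exprS; field.
- rewrite mulr_ge0//; first by rewrite divr_ge0 ?exprn_ge0 ?ltW ?E0.
  by rewrite subr_ge0 eq1.
- by rewrite lte_fin ltr_pdivrMr// ltr_pMr// ltr1n.
Qed.

(** With [elastic_slope], the pair (a, c) of the radial map y |-> E (cutoff n d |y|) y / |y|. *)
Definition elastic_value (n : nat) (d t : R) :=
  if 0 < t then E (cutoff n d t) / t else 0.

Definition elastic_slope (n : nat) (d t : R) :=
  if 0 < t then e (cutoff n d t) * (E (cutoff n d t) / cutoff n d t) * dcutoff n d t
  else 0.

Lemma elastic_value_ge0 n (d t : R) : 0 < d -> 0 <= elastic_value n d t.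
Proof.
move=> d0; rewrite /elastic_value; case: ifP => // t0.
by rewrite divr_ge0 ?(ltW t0)// ltW// (elastic_gt0 Ee)// cutoff_gt0.
Qed.

(** The constant comes from e <= 2 and [dcutoff_le]. It does not depend on d, which is what allows a
    majorant uniform in the truncation. *)
Lemma elastic_slope_bound n (d t : R) : 0 < d ->
  0 <= elastic_slope n d t <= 2 * n.+1%:R * elastic_value n d t.
Proof.
move=> d0; rewrite /elastic_slope /elastic_value; case: ifP => t0; last by rewrite mulr0 lexx.
have Tt := cutoff_gt0 n d0 t0; have /andP[e0 e2] := elastic_ge0_le2 Ee Tt.
have dT0 := dcutoff_ge0 n d0 t0; have dT1 := dcutoff_le n d0 t0.
have E0 := elastic_gt0 Ee Tt.
move: (cutoff n d t) (dcutoff n d t) Tt e0 e2 dT0 dT1 E0 => T D Tt e0 e2 dT0 dT1 E0.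
have ET : 0 <= E T / T by rewrite divr_ge0// ltW.
apply/andP; split; first by apply: mulr_ge0 => //; exact: mulr_ge0.
rewrite -mulrA -[leRHS]mulrA; apply: ler_pM => //; first exact: mulr_ge0.
apply: (le_trans (ler_wpM2l ET dT1)); rewrite le_eqVlt; apply/orP; left; apply/eqP.
by move: (E T) n.+1%:R => y w; field; rewrite !gt_eqF.
Qed.

Lemma elastic_cvg n (t : R) : 0 < t ->
  (fun j : nat => elastic_value n.+1 j.+1%:R^-1 t) @ \oo --> E t / t /\
  (fun j : nat => elastic_slope n.+1 j.+1%:R^-1 t) @ \oo --> e t * (E t / t).
Proof.
move=> t0; have [hT hD] := cutoff_cvg n t0; rewrite /elastic_value /elastic_slope t0.
have cE := is_derive_continuous (elastic_derive Ee t0); have ce := elastic_cont Ee t0.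
have hE : (fun j : nat => E (cutoff n.+1 j.+1%:R^-1 t)) @ \oo --> E t.
  exact: (cvg_comp _ _ hT cE).
have he : (fun j : nat => e (cutoff n.+1 j.+1%:R^-1 t)) @ \oo --> e t.
  exact: (cvg_comp _ _ hT ce).
split; first by apply: cvgM => //; exact: cvg_cst.
rewrite -[X in _ --> X]mulr1; apply: cvgM => //; apply: cvgM => //; apply: cvgM => //.
by apply: cvgV => //; rewrite gt_eqF.
Qed.

(* Near 0, elastic_origin gives E x ^+ q.+1 <= C x, so that with x = cutoff n d t and
   n.+1 = 2 q.+1 the quotient E x / t is O(t). *)
Lemma elastic_radial (d : R) : 0 < d ->
  radialC1 (elastic_value (q.*2).+1 d) (elastic_slope (q.*2).+1 d).
Proof.
move=> d0; set n := (q.*2).+1; pose T := cutoff n d; pose X t := E (T t).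
have [E0 Ed ce e2 _] := Ee.
have T0 t (t0 : 0 < t) := cutoff_gt0 n d0 t0.
set dX := fun t : R => e (T t) * (E (T t) / T t) * dcutoff n d t.
have Td (t : R) : 0 < t -> is_derive t 1 T (dcutoff n d t) by exact: is_derive_cutoff.
have Xd (t : R) : 0 < t -> is_derive t 1 X (dX t).
  by move=> t0; exact: (is_derive_chain (Ed _ (T0 t t0)) (Td t t0)).
have cT (t : R) : 0 < t -> {for t, continuous T}.
  by move=> /Td; exact: is_derive_continuous.
have dXle (t : R) : 0 < t -> 0 <= dX t <= 2 * n.+1%:R * (X t / t).
  by move=> t0; have := elastic_slope_bound n t d0; rewrite /elastic_slope /elastic_value t0.
have [x1 x10 [C C0 EC]] := elastic_origin_bound.
have [C2 C20 XC] : exists2 C2, 0 < C2 & forall t : R, 0 < t -> t <= x1 -> X t / t <= C2 * t.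
  pose C1 := C / d ^+ n; have C10 : 0 < C1 by rewrite divr_gt0 ?exprn_gt0.
  (* With n + 1 = 2 (q + 1), the bound on the cutoff gives (X t / t)^(q+1) <= C1 t^(q+1). Any C2
     with C1 <= C2^(q+1) would do, and 1 + C1 avoids taking a root. *)
  exists (1 + C1); first by rewrite addr_gt0.
  move=> t t0 tx; have Tt := T0 t t0.
  have h : (X t / t) ^+ q.+1 <= C1 * t ^+ q.+1.
    rewrite expr_div_n ler_pdivrMr ?exprn_gt0//.
    apply: (le_trans (EC _ Tt (le_trans (cutoff_le _ d0 t0) tx))).
    rewrite -[leRHS]mulrA -exprD addnn doubleS.
    apply: (le_trans (ler_wpM2l (ltW C0) (cutoff_le_exp n d0 t0))).
    by rewrite /C1 mulrA mulrAC.
  have Xt : 0 <= X t / t by rewrite divr_ge0 ?(ltW t0)//; exact/ltW/E0.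
  have Ct : 0 <= (1 + C1) * t by rewrite mulr_ge0 ?addr_ge0 ?(ltW t0) ?(ltW C10).
  rewrite -(@ler_pXn2r _ q.+1)//.
  apply: (le_trans h); rewrite exprMn ler_wpM2r ?exprn_ge0 ?(ltW t0)//.
  have : 1 + C1 <= (1 + C1) ^+ q.+1 by rewrite ler_eXnr// lerDl ltW.
  by apply: le_trans; rewrite lerDr.
have Xt0 : X t / t @[t --> 0^'+] --> (0 : R).
  have h : C2 * t @[t --> 0^'+] --> (0 : R).
    have : C2 * t @[t --> 0^'+] --> (C2 * 0 : R).
      by apply: cvgM; [exact: cvg_cst|exact: cvg_at_right_filter].
    by rewrite mulr0.
  apply: (squeeze_cvgr (f := fun _ => 0) _ (cvg_cst _) h).
  near=> t; have t0 : 0 < t by near: t; exact: nbhs_right_gt.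
  rewrite divr_ge0 ?(ltW t0) ?(ltW (E0 _ (T0 _ t0)))//=.
  by apply: XC => //; near: t; exact: nbhs_right_le.
(* |dX t| is at most 2 (n+1) X t / t. For t <= x1 that quotient is at most C2 x1; beyond x1 it is at
   most E (1/d) / x1, as the cutoff never exceeds 1/d. *)
apply: (@radial_of _ X dX 0 (2 * n.+1%:R * (C2 * x1 + E d^-1 / x1))) => //.
- move=> t t0; have Tt := T0 t t0.
  have cET : {for t, continuous (fun t : R => E (T t))}.
    exact: is_derive_continuous (Xd t t0).
  apply: cvgM; last exact: continuous_dcutoff.
  apply: cvgM; first exact: (continuous_comp (cT t t0) (ce _ Tt)).
  by apply: cvgM => //; apply: cvgV; [rewrite gt_eqF|exact: cT].
- move=> t t0; have /andP[h1 h2] := dXle t t0.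
  rewrite ger0_norm//; apply: (le_trans h2); apply: ler_wpM2l; first exact: mulr_ge0.
  have Ed0 : 0 <= E d^-1 / x1 by rewrite divr_ge0 ?ltW ?E0 ?invr_gt0.
  have [tx|xt] := leP t x1.
    by apply: (le_trans (XC t t0 tx)); rewrite ler_wpDr// ler_wpM2l// ltW.
  rewrite ler_wpDl//; first by rewrite mulr_ge0// ltW.
  apply: ler_pM; rewrite ?invr_ge0 ?(ltW t0) ?(ltW (E0 _ (T0 _ t0)))//.
    by apply: elastic_le (cutoff_leV n d0 t0); exact: T0.
  by rewrite lef_pV2 ?posrE// ltW.
- have h : t @[t --> 0^'+] --> (0 : R) by exact: cvg_at_right_filter.
  have h1 : X t / t * t @[t --> 0^'+] --> (0 * 0 : R) by exact: cvgM.
  rewrite mulr0 in h1; apply: cvg_trans h1; apply: near_eq_cvg.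
  near=> t; have t0 : 0 < t by near: t; exact: nbhs_right_gt.
  by rewrite /= divfK// gt_eqF.
have h : 2 * n.+1%:R * (X t / t) @[t --> 0^'+] --> (0 : R).
  have : 2 * n.+1%:R * (X t / t) @[t --> 0^'+] --> (2 * n.+1%:R * 0 : R).
    by apply: cvgM => //; exact: cvg_cst.
  by rewrite mulr0.
apply: (squeeze_cvgr (f := fun _ => 0) _ (cvg_cst _) h).
by near=> t; apply: dXle; near: t; exact: nbhs_right_gt.
Unshelve. all: by end_near. Qed.

End elastic_theory.

End truncation.

(** * Consequences of the conditions on phi *)

Section admissible.
Context {R : realType}.
Variable phi : R -> R.
Hypothesis Hphi : phi_admissible phi.

Let f (s : R) := s * phi s.
Definition dmass (s : R) := phi s + s * derive1 phi s.
Local Notation fp := dmass.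
(** The logarithmic derivative s f'(s) / f(s) of f(s) = s phi(s). In its terms Lambda t is (1 - el)
    / (1 + el) at s = zeta t. *)
Definition elast (s : R) := fp s / phi s.
Local Notation el := elast.
Let g (s : R) := s * Num.sqrt (phi s).

Lemma phi_gt0 s : 0 < s -> 0 < phi s.
Proof. by have [h _ _ _ _] := Hphi; exact: h. Qed.

Lemma is_derive_phi (s : R) : 0 < s -> is_derive s 1 phi (derive1 phi s).
Proof.
have [_ h _ _ _] := Hphi => s0; have [d _] := h s s0.
by apply: DeriveDef => //; rewrite derive1E.
Qed.

Lemma is_derive_mass (s : R) : 0 < s -> is_derive s 1 f (fp s).
Proof.
move=> s0; apply: (@is_derive_eq _ _ _ _ _ _ _ _ (is_derive_mul (is_derive_id s 1) (is_derive_phi s0))).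
by rewrite mul1r.
Qed.

Lemma derive1_mass (s : R) : 0 < s -> derive1 f s = fp s.
Proof. by move=> /is_derive_mass[_ <-]; rewrite derive1E. Qed.

Lemma dmass_gt0 (s : R) : 0 < s -> 0 < fp s.
Proof. by have [_ _ h _ _] := Hphi => s0; rewrite -derive1_mass//; exact: h. Qed.

Lemma elast_gt0 (s : R) : 0 < s -> 0 < el s.
Proof. by move=> s0; rewrite divr_gt0 ?phi_gt0 ?dmass_gt0. Qed.

Lemma continuous_phi (s : R) : 0 < s -> {for s, continuous phi}.
Proof. by move=> /is_derive_phi; exact: is_derive_continuous. Qed.

Lemma continuous_dmass (s : R) : 0 < s -> {for s, continuous fp}.
Proof.
move=> s0; have [_ /(_ s s0)[_ c] _ _ _] := Hphi.
apply: cvgD; first exact: continuous_phi.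
by apply: cvgM.
Qed.

Lemma continuous_elast (s : R) : 0 < s -> {for s, continuous el}.
Proof.
move=> s0; apply: cvgM; first exact: continuous_dmass.
by apply: cvgV; [rewrite gt_eqF ?phi_gt0|exact: continuous_phi].
Qed.

Lemma mass_gt0 (s : R) : 0 < s -> 0 < f s.
Proof. by move=> s0; rewrite mulr_gt0 ?phi_gt0. Qed.

Lemma mass_onto (t : R) : 0 < t -> exists2 s, 0 < s & f s = t.
Proof.
have [_ _ _ h _] := Hphi => t0; have : [set t : R | 0 < t] t by [].
by rewrite -h => -[s /= s0 <-]; exists s.
Qed.

Lemma mass_le (s t : R) : 0 < s -> s <= t -> f s <= f t.
Proof.
move=> s0; rewrite le_eqVlt => /orP[/eqP->//|st]; apply: ltW.
exact: (incr_pos is_derive_mass dmass_gt0).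
Qed.

(** Integrating (iv) from 0 compares s phi(s) with s^(r+1) / (r+1) from both sides; dividing the
    bounds for the derivative by these cancels the power of s. *)
Lemma elast_origin : exists s0 c1 c2 : R, [/\ 0 < s0, 0 < c1, 0 < c2 &
  forall s : R, 0 < s -> s < s0 -> c1 <= el s <= c2].
Proof.
have [_ _ _ _ [s0 [s00 [C1 [C2 [r [C10 C20 r1 hC _]]]] _]]] := Hphi.
pose p := r + 1; have p0 : 0 < p by rewrite /p; lra.
have pd (s : R) : 0 < s -> is_derive s 1 (fun x => x `^ p) (p * s `^ r).
  move=> s0'; have := is_derive1_powR p s0'.
  by rewrite /p addrK.
have pd' (C s : R) : 0 < s -> is_derive s 1 (fun x => C / p * x `^ p) (C * s `^ r).
  move=> s0'; apply: (@is_derive_eq _ _ _ _ _ _ _ _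
    (is_derive_mul (is_derive_cst (C / p) s 1) (pd s s0'))).
  by rewrite mul0r add0r /cst mulrA divfK// gt_eqF.
have hC' (s : R) : 0 < s -> (s%:E < s0%:E)%E -> C1 * s `^ r <= fp s <= C2 * s `^ r.
  by rewrite lte_fin => s0' ss0; rewrite -derive1_mass//; apply: hC; rewrite s0'.
have cv0 C : C / p * s `^ p @[s --> 0^'+] --> (0 : R).
  have : C / p * s `^ p @[s --> 0^'+] --> (C / p * 0 : R).
    by apply: cvgM; [exact: cvg_cst|exact: powR_cvg0].
  by rewrite mulr0.
have lo (s : R) : 0 < s -> s < s0 -> C1 / p * s `^ p <= f s.
  move=> s0' ss0; rewrite -subr_ge0.
  have h x : 0 < x -> x <= s -> f x - C1 / p * x `^ p <= f s - C1 / p * s `^ p.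
    move=> x0 xs; apply: (@ndecr_pos _ (fun x => f x - C1 / p * x `^ p)
      (fun x => fp x - C1 * x `^ r) s0%:E) => // t t0 ts.
    + exact: (is_deriveB (is_derive_mass t0) (pd' C1 t t0)).
    + by rewrite subr_ge0; have /andP[] := hC' t t0 ts.
  (* The comparison starts at a small x > 0 instead of 0; the power there is negligible because r >
     -1. *)
  apply/ler_addgt0Pr => e e0.
  have [x [x0 xs xe]] : exists x : R, [/\ 0 < x, x < s & C1 / p * x `^ p < e].
    have : \forall x \near 0^'+, [/\ 0 < x, x < s & C1 / p * x `^ p < e].
      near=> x; split.
      - by near: x; exact: nbhs_right_gt.
      - by near: x; exact: nbhs_right_lt.
      - by near: x; apply: (cvgr_lt 0 (cv0 C1)) => //.
    by move=> /filter_ex.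
  have := h x x0 (ltW xs); have := mass_gt0 x0; lra.
have hi (s : R) : 0 < s -> s < s0 -> f s <= C2 / p * s `^ p.
  move=> s0' ss0; rewrite -subr_ge0.
  have h x : 0 < x -> x <= s -> C2 / p * x `^ p - f x <= C2 / p * s `^ p - f s.
    move=> x0 xs; apply: (@ndecr_pos _ (fun x => C2 / p * x `^ p - f x)
      (fun x => C2 * x `^ r - fp x) s0%:E) => // t t0 ts.
    + exact: (is_deriveB (pd' C2 t t0) (is_derive_mass t0)).
    + by rewrite subr_ge0; have /andP[] := hC' t t0 ts.
  (* Here it is s phi(s) that must be small at the starting point; (iii) provides a point where it
     equals e, and monotonicity does the rest. *)
  apply/ler_addgt0Pr => e e0; have [x' x0' fx'] := mass_onto e0.
  pose x := Num.min x' s; have x0 : 0 < x by rewrite lt_min x0'.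
  have := h x x0; rewrite ge_min lexx orbT => /(_ isT).
  have : f x <= e by rewrite -fx'; apply: mass_le => //; rewrite ge_min lexx.
  have : 0 <= C2 / p * x `^ p by rewrite mulr_ge0 ?powR_ge0// divr_ge0 ?ltW.
  lra.
exists s0, (C1 / (C2 / p)), (C2 / (C1 / p)); split => //; rewrite ?divr_gt0//.
move=> s s0' ss0; have := lo s s0' ss0; have := hi s s0' ss0.
have sr : s `^ p = s * s `^ r.
  by rewrite /p addrC powRD ?powRr1 ?(ltW s0')//; rewrite (gt_eqF s0') implybT.
have /andP[h1 h2] := hC' s s0' ss0.
rewrite sr /f; have ph := phi_gt0 s0'; have q0 : 0 < s `^ r by rewrite powR_gt0.
rewrite ![_ * (s * _)]mulrCA !ler_pM2l// => h3 h4.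
have D1 : 0 < C1 / p by rewrite divr_gt0.
have D2 : 0 < C2 / p by rewrite divr_gt0.
apply/andP; split.
  rewrite ler_pdivlMr// mulrAC ler_pdivrMr//.
  apply: le_trans (ler_wpM2l (ltW C10) h3) _.
  by rewrite mulrCA [leRHS]mulrC; apply: ler_wpM2l => //; exact: ltW.
rewrite ler_pdivrMr// mulrAC ler_pdivlMr//.
apply: le_trans (ler_wpM2r (ltW D1) h2) _.
by rewrite -mulrA; apply: ler_wpM2l; [exact: ltW|rewrite mulrC].
Unshelve. all: by end_near. Qed.

End admissible.

Section admissible_inverse.
Context {R : realType}.
Variable phi : R -> R.
Hypothesis Hphi : phi_admissible phi.

Local Notation fp := (dmass phi).
Local Notation el := (elast phi).
Local Notation ph0 := (phi_gt0 Hphi).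
Local Notation fp0 := (dmass_gt0 Hphi).
Let g (s : R) := s * Num.sqrt (phi s).
Let dg (s : R) := (phi s + fp s) / (2 * Num.sqrt (phi s)).

Lemma sqrt_phi_gt0 (s : R) : 0 < s -> 0 < Num.sqrt (phi s).
Proof. by move=> s0; rewrite sqrtr_gt0 ph0. Qed.

Lemma phi_sqrt (s : R) : 0 < s -> phi s = Num.sqrt (phi s) ^+ 2.
Proof. by move=> s0; rewrite sqr_sqrtr// ltW// ph0. Qed.

Lemma is_derive_s_sqrt_phi (s : R) : 0 < s -> is_derive s 1 g (dg s).
Proof.
move=> s0; have q0 := sqrt_phi_gt0 s0.
have h := is_derive_mul (is_derive_id s 1)
  (is_derive_chain (is_derive1_sqrt (ph0 s0)) (is_derive_phi Hphi s0)).
apply: (@is_derive_eq _ _ _ _ _ _ _ _ h).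
rewrite /dg /dmass phi_sqrt//= sqrtr_sqr (gtr0_norm q0).
by field; rewrite gt_eqF.
Qed.

Lemma s_sqrt_phi_incr (s : R) : 0 < s -> 0 < dg s.
Proof.
move=> s0; apply: divr_gt0; first by apply: addr_gt0; [exact: ph0|exact: fp0].
by apply: mulr_gt0 => //; exact: sqrt_phi_gt0.
Qed.

Lemma s_sqrt_phi_sqr (s : R) : 0 < s -> g s ^+ 2 = s * (s * phi s).
Proof. by move=> s0; rewrite exprMn -phi_sqrt// expr2 mulrA. Qed.

Lemma s_sqrt_phi_onto (t : R) : 0 < t ->
  exists s1 s2 : R, [/\ 0 < s1, s1 <= s2, g s1 <= t & t <= g s2].
Proof.
move=> t0; have f1 : 0 < phi 1 by rewrite ph0.
have fm := mass_le Hphi.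
have gle (s u : R) : 0 < s -> 0 < u -> s * (s * phi s) <= u ^+ 2 -> g s <= u.
  move=> s0 u0 h; have g0 : 0 <= g s by rewrite mulr_ge0 ?sqrtr_ge0// ltW.
  by rewrite -(@ler_pXn2r _ 2)// ?nnegrE// ?(ltW u0)// s_sqrt_phi_sqr.
have leg (s u : R) : 0 < s -> 0 < u -> u ^+ 2 <= s * (s * phi s) -> u <= g s.
  move=> s0 u0 h; have g0 : 0 <= g s by rewrite mulr_ge0 ?sqrtr_ge0// ltW.
  by rewrite -(@ler_pXn2r _ 2)// ?nnegrE// ?(ltW u0)// s_sqrt_phi_sqr.
have q0 : 0 < t ^+ 2 / phi 1 by rewrite divr_gt0// exprn_gt0.
(* As g(s)^2 = s (s phi(s)) is a product of increasing factors, it is enough to compare s with t^2 /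
   phi 1, and s phi(s) with phi 1, its value at s = 1. *)
pose s1 := Num.min 1 (t ^+ 2 / phi 1); pose s2 := Num.max 1 (t ^+ 2 / phi 1).
have s10 : 0 < s1 by rewrite lt_min ltr01.
have s20 : 0 < s2 by rewrite lt_max ltr01.
exists s1, s2; split => //.
- by rewrite /s1 /s2 ge_min le_max lexx.
- apply: gle => //.
  have h1 : s1 * phi s1 <= phi 1 by rewrite -[leRHS]mul1r; apply: fm; rewrite // ge_min lexx.
  have h2 : s1 <= t ^+ 2 / phi 1 by rewrite ge_min lexx orbT.
  apply: (le_trans (ler_pM _ _ h2 h1)); rewrite ?divfK ?gt_eqF//; first exact: ltW.
  by rewrite mulr_ge0 ?ltW ?ph0.
- apply: leg => //.
  have h1 : phi 1 <= s2 * phi s2 by rewrite -[leLHS]mul1r; apply: fm; rewrite // le_max lexx.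
  have h2 : t ^+ 2 / phi 1 <= s2 by rewrite le_max lexx orbT.
  apply: le_trans (ler_pM _ _ h2 h1); rewrite ?divfK ?gt_eqF//; exact: ltW.
Qed.

Lemma zetaP (t : R) : 0 < t -> 0 < zeta phi t /\ g (zeta phi t) = t.
Proof.
have [z zP] := inverse_pos_ex is_derive_s_sqrt_phi s_sqrt_phi_onto.
by move=> /zP[z0 gz]; apply: (@xgetPex _ 0 [set s : R | 0 < s /\ g s = t]); exists (z t).
Qed.

Lemma zetaK (s : R) : 0 < s -> zeta phi (s * Num.sqrt (phi s)) = s.
Proof.
move=> s0; have [|z0 gz] := @zetaP (g s); first by rewrite mulr_gt0// sqrt_phi_gt0.
exact: (inj_pos is_derive_s_sqrt_phi s_sqrt_phi_incr z0 s0 gz).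
Qed.

Lemma is_derive_zeta (t : R) : 0 < t ->
  is_derive t 1 (zeta phi) (2 / (1 + el (zeta phi t)) * (zeta phi t / t)).
Proof.
move=> t0; have h := inverse_pos is_derive_s_sqrt_phi s_sqrt_phi_incr zetaP t0.
have [z0 gz] := zetaP t0; apply: (@is_derive_eq _ _ _ _ _ _ _ _ h) => {h}.
rewrite -[X in _ * (_ / X)]gz /dg /g /elast; move: (zeta phi t) z0 => s s0.
have q0 := sqrt_phi_gt0 s0; have f0 := fp0 s0.
rewrite phi_sqrt// sqrtr_sqr (gtr0_norm q0).
have := addr_gt0 f0 (exprn_gt0 2 q0).
move: (Num.sqrt _) (fp s) q0 f0 => q u q0 u0; rewrite addrC => h.
by field; rewrite !gt_eqF.
Qed.

(** 2 / (1 + el) is the logarithmic derivative of zeta; dividing zeta by t lowers it by 1. *)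
Lemma LambdaE (t : R) : 0 < t -> Lambda phi t = 2 / (1 + el (zeta phi t)) - 1.
Proof.
move=> t0; have [z0 _] := zetaP t0.
have h := is_derive_div (lt0r_neq0 t0) (is_derive_zeta t0) (is_derive_id t 1).
rewrite /Lambda /Theta derive1E; case: h => _ ->.
have := elast_gt0 Hphi z0; move: (zeta phi t) (el _) z0 => s e s0 e0.
have e1 : 1 + e != 0 by rewrite gt_eqF// addr_gt0.
by field; rewrite e1 !gt_eqF.
Qed.

Lemma continuous_Lambda (t : R) : 0 < t -> {for t, continuous (Lambda phi)}.
Proof.
move=> t0; have [z0 _] := zetaP t0.
have h : (fun t => 2 / (1 + el (zeta phi t)) - 1) @ t --> 2 / (1 + el (zeta phi t)) - 1.
  apply: cvgB; last exact: cvg_cst.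
  apply: cvgM; first exact: cvg_cst.
  apply: cvgV; first by rewrite gt_eqF// addr_gt0// elast_gt0.
  apply: cvgD; first exact: cvg_cst.
  apply: (continuous_comp (is_derive_continuous (is_derive_zeta t0))).
  exact: continuous_elast.
change (Lambda phi @ t --> Lambda phi t); rewrite LambdaE//; apply: cvg_trans h; apply: near_eq_cvg.
near=> u; rewrite LambdaE//; near: u; exact: lt_nbhsr.
Unshelve. all: by end_near. Qed.

(** zeta t and t^2 / zeta t are |u| and |w| as functions of t = |v|. Their logarithmic derivatives
    add up to 2, and the two-sided bound on [elast] near 0 keeps both away from 0 there. *)
Lemma zeta_elastic : exists q,
  elastic (zeta phi) (fun t => 1 + Lambda phi t) q /\
  elastic (fun t => t ^+ 2 / zeta phi t) (fun t => 1 - Lambda phi t) q.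
Proof.
have [s0 [c1 [c2 [s00 c10 c20 elc]]]] := elast_origin Hphi.
have L1 (t : R) : 0 < t -> 1 + Lambda phi t = 2 / (1 + el (zeta phi t)).
  by move=> t0; rewrite LambdaE// addrC subrK.
have L2 (t : R) : 0 < t -> 1 - Lambda phi t = 2 * el (zeta phi t) / (1 + el (zeta phi t)).
  move=> t0; rewrite LambdaE//; have [z0 _] := zetaP t0.
  have := elast_gt0 Hphi z0; move: (el _) => e e0.
  by field; rewrite gt_eqF// addr_gt0.
(* The first inequality serves 2 / (1 + el) when el <= c2, the second 2 el / (1 + el) when el >=
   c1. *)
have [q qP] : exists q : nat, 1 + c2 <= q.+1%:R /\ (1 + c1) / c1 <= q.+1%:R.
  exists (maxn (Num.truncn (1 + c2)) (Num.truncn ((1 + c1) / c1))).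
  split; apply: (le_trans (ltW (truncnS_gt _))); rewrite ler_nat ltnS.
    exact: leq_maxl.
  exact: leq_maxr.
have g0 : 0 < g s0 by rewrite mulr_gt0// sqrt_phi_gt0.
have zs (t : R) : 0 < t -> t < g s0 -> zeta phi t < s0.
  move=> t0 tg; have [z0 gz] := zetaP t0.
  by rewrite -(incr_posE is_derive_s_sqrt_phi s_sqrt_phi_incr)// gz.
exists q; split; split.
- by move=> x /zetaP[].
- by move=> x x0; rewrite L1//; exact: is_derive_zeta.
- by move=> x x0; apply: cvgD; [exact: cvg_cst|exact: continuous_Lambda].
- move=> x x0; have [z0 _] := zetaP x0; have := elast_gt0 Hphi z0; rewrite L1//.
  move: (el _) => e e0; rewrite divr_ge0 ?addr_ge0 ?(ltW e0)//=.
  by rewrite ler_pdivrMr ?addr_gt0//; lra.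
- exists (g s0) => // x x0 xg; have [z0 _] := zetaP x0.
  have /andP[_ e2] := elc _ z0 (zs x x0 xg); have := elast_gt0 Hphi z0; rewrite L1//.
  move: (el _) e2 => e e2 e0; rewrite mulrA ler_pdivlMr ?addr_gt0// mul1r.
  by case: qP; move: q.+1%:R => Q; lra.
- by move=> x x0; have [z0 _] := zetaP x0; rewrite divr_gt0// exprn_gt0.
- move=> x x0; have [z0 _] := zetaP x0.
  have h := is_derive_div (lt0r_neq0 z0) (is_derive_exp 1 (is_derive_id x 1)) (is_derive_zeta x0).
  apply: (@is_derive_eq _ _ _ _ _ _ _ _ h); rewrite LambdaE//.
  have := elast_gt0 Hphi z0; move: (zeta phi x) (el _) z0 => s e s1 e0.
  have e1 : 1 + e != 0 by rewrite gt_eqF// addr_gt0.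
  by rewrite /=; field; rewrite e1 !gt_eqF.
- by move=> x x0; apply: cvgB; [exact: cvg_cst|exact: continuous_Lambda].
- move=> x x0; have [z0 _] := zetaP x0; have := elast_gt0 Hphi z0; rewrite L2//.
  move: (el _) => e e0; rewrite divr_ge0 ?mulr_ge0 ?addr_ge0 ?(ltW e0)//=.
  by rewrite ler_pdivrMr ?addr_gt0//; lra.
- exists (g s0) => // x x0 xg; have [z0 _] := zetaP x0.
  have /andP[e1 _] := elc _ z0 (zs x x0 xg); have := elast_gt0 Hphi z0; rewrite L2//.
  move: (el _) e1 => e e1 e0; rewrite mulrA ler_pdivlMr ?addr_gt0// mul1r.
  case: qP => _; rewrite ler_pdivrMr//; have : 1 <= q.+1%:R :> R by rewrite ler1n.
  move: q.+1%:R => Q; nra.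
Qed.

(** The corresponding pair for |v| itself. It holds for every q, so the q found for zeta can be
    shared. *)
Lemma id_elastic q : elastic (fun t : R => t) (fun _ => 1) q.
Proof.
split=> //.
- move=> x x0; apply: (@is_derive_eq _ _ _ _ _ _ _ _ (is_derive_id x 1)).
  by rewrite mul1r mulfV// gt_eqF.
- by move=> x x0; exact: cvg_cst.
- by move=> x x0; rewrite ler01 ler1n.
by exists 1 => // x x0 x1; rewrite mulr1 ler1n.
Qed.

End admissible_inverse.

(** * Derivatives with respect to |p| = |u| + |w| *)

Section admissible_sum.
Context {R : realType}.
Variable phi : R -> R.
Hypothesis Hphi : phi_admissible phi.

Local Notation fp := (dmass phi).
Local Notation el := (elast phi).
Local Notation ph0 := (phi_gt0 Hphi).
Local Notation fp0 := (dmass_gt0 Hphi).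

(* Derivatives of u and of v = sqrt (phi u) u with respect to u + phi(u) u, at u = s. *)
Definition dsum_id (s : R) := (1 + fp s)^-1.
Definition dsum_sqrt (s : R) := (phi s + fp s) / (2 * Num.sqrt (phi s)) / (1 + fp s).

Lemma dsum_id_bound (s : R) : 0 < s -> 0 <= dsum_id s <= 1.
Proof.
move=> /fp0 f0; have h := addr_gt0 ltr01 f0.
by rewrite /dsum_id invr_ge0 (ltW h) (invf_le1 h) lerDl ltW.
Qed.

Lemma dsum_sqrt_ge0 (s : R) : 0 < s -> 0 <= dsum_sqrt s.
Proof.
move=> s0; have f0 := fp0 s0; have p0 := ph0 s0.
have h1 := addr_gt0 ltr01 f0; have h2 := addr_gt0 p0 f0; have q0 := sqrt_phi_gt0 Hphi s0.
by apply: divr_ge0; [apply: divr_ge0; [|rewrite mulr_ge0//]|]; exact: ltW.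
Qed.

(** The factor (1 + el)^2 / (4 el) is bounded near 0 and equals 1 when el = 1, so the behaviour of
    [dsum_sqrt] at 0 is read off from that of [dsum_id]. *)
Lemma dsum_sqrt_sqr (s : R) : 0 < s -> dsum_sqrt s ^+ 2 =
  (1 + el s) ^+ 2 / (4 * el s) * (dsum_id s * (1 - dsum_id s)).
Proof.
move=> s0; have f0 := fp0 s0; have q0 := sqrt_phi_gt0 Hphi s0.
rewrite /dsum_sqrt /dsum_id /elast (phi_sqrt Hphi s0).
rewrite sqrtr_sqr (gtr0_norm q0); have := addr_gt0 ltr01 f0.
move: (Num.sqrt _) (fp s) q0 f0 => q u q0 u0 h.
by field; rewrite !gt_eqF.
Qed.

Lemma continuous_dsum_id (s : R) : 0 < s -> {for s, continuous dsum_id}.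
Proof.
move=> s0; apply: cvgV; first by rewrite gt_eqF// addr_gt0// fp0.
by apply: cvgD; [exact: cvg_cst|exact: continuous_dmass].
Qed.

Lemma continuous_dsum_sqrt (s : R) : 0 < s -> {for s, continuous dsum_sqrt}.
Proof.
move=> s0; have cp := continuous_phi Hphi s0; have cf := continuous_dmass Hphi s0.
apply: cvgM; last exact: continuous_dsum_id.
apply: cvgM; first exact: cvgD.
apply: cvgV; first by rewrite gt_eqF// mulr_gt0// sqrt_phi_gt0.
apply: cvgM; first exact: cvg_cst.
exact: (continuous_comp cp (@sqrt_continuous R _)).
Qed.

(** The derivative of s phi(s) tends to 0, to infinity or to l > 0 according as r > 0, r < 0 or r =
    0, giving k = 1, 0 or 1 / (1 + l). The limit sqrt (k (1 - k)) is the value that makes the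
    quadratic forms agree where p = 0. *)
Lemma dsum_origin : exists2 k : R, dsum_id s @[s --> 0^'+] --> k &
  dsum_sqrt s @[s --> 0^'+] --> Num.sqrt (k * (1 - k)).
Proof.
have sq (k : R) : dsum_sqrt s ^+ 2 @[s --> 0^'+] --> k * (1 - k) ->
    dsum_sqrt s @[s --> 0^'+] --> Num.sqrt (k * (1 - k)).
  move=> h; have h2 := cvg_comp _ _ h (@sqrt_continuous R _).
  apply: cvg_trans h2; apply: near_eq_cvg; near=> s.
  rewrite /= sqrtr_sqr ger0_norm// dsum_sqrt_ge0//; near: s; exact: nbhs_right_gt.
have [s1 [c1 [c2 [s10 c10 c20 elc]]]] := elast_origin Hphi.
have [_ _ _ _ [s0 [s00 [C1 [C2 [r [C10 C20 r1 hC r0]]]] _]]] := Hphi.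
have hC' (s : R) : 0 < s -> s < s0 -> C1 * s `^ r <= fp s <= C2 * s `^ r.
  by move=> s0' ss0; rewrite -(derive1_mass Hphi s0'); apply: hC; rewrite s0'.
(* For r <> 0 one has k (1 - k) = 0, and boundedness of el suffices. For r = 0 the limit of el
   itself is needed, and the additional requirement in (iv) provides el -> 1. *)
have sq0 (k : R) : k * (1 - k) = 0 -> dsum_id s @[s --> 0^'+] --> k ->
    dsum_sqrt s @[s --> 0^'+] --> Num.sqrt (k * (1 - k)).
  move=> k0 hk; apply: sq; rewrite k0.
  have h : (1 + c2) ^+ 2 / (4 * c1) * (dsum_id s * (1 - dsum_id s)) @[s --> 0^'+] --> (0 : R).
    have : (1 + c2) ^+ 2 / (4 * c1) * (dsum_id s * (1 - dsum_id s)) @[s --> 0^'+] -->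
        ((1 + c2) ^+ 2 / (4 * c1) * (k * (1 - k)) : R).
      apply: cvgM; first exact: cvg_cst.
      by apply: cvgM => //; apply: cvgB => //; exact: cvg_cst.
    by rewrite k0 mulr0.
  apply: (squeeze_cvgr (f := fun _ => 0) _ (cvg_cst _) h); near=> s.
  have s0' : 0 < s by near: s; exact: nbhs_right_gt.
  rewrite sqr_ge0/= dsum_sqrt_sqr//; have /andP[a0 a1] := dsum_id_bound s0'.
  apply: ler_wpM2r; first by rewrite mulr_ge0// subr_ge0.
  have /andP[h1 h2] : c1 <= el s <= c2 by apply: elc => //; near: s; exact: nbhs_right_lt.
  have e0 : 0 < el s := lt_le_trans c10 h1.
  move: (el s) e0 h1 h2 => e e0 h1 h2; apply: ler_pM; rewrite ?sqr_ge0 ?invr_ge0 ?mulr_ge0 ?(ltW e0)//.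
    by rewrite ler_pXn2r ?nnegrE ?addr_ge0 ?(ltW e0) ?(ltW c20)// lerD2l.
  by rewrite lef_pV2 ?posrE ?mulr_gt0// ler_pM2l.
have idc (L : R) : 0 <= L -> fp s @[s --> 0^'+] --> L -> dsum_id s @[s --> 0^'+] --> (1 + L)^-1.
  move=> L0 hL; apply: cvgV; first by rewrite gt_eqF// ltr_pwDl.
  by apply: cvgD => //; exact: cvg_cst.
have [r_gt0|r_lt0|r_eq0] := ltgtP 0 r.
- have hf : fp s @[s --> 0^'+] --> (0 : R).
    have h : C2 * s `^ r @[s --> 0^'+] --> (0 : R).
      have : C2 * s `^ r @[s --> 0^'+] --> (C2 * 0 : R).
        by apply: cvgM; [exact: cvg_cst|exact: powR_cvg0].
      by rewrite mulr0.
    apply: (squeeze_cvgr (f := fun _ => 0) _ (cvg_cst _) h); near=> s.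
    have s0' : 0 < s by near: s; exact: nbhs_right_gt.
    have /andP[_ ->] : C1 * s `^ r <= fp s <= C2 * s `^ r.
      by apply: hC' => //; near: s; exact: nbhs_right_lt.
    by rewrite (ltW (fp0 s0')).
  have h1 := idc 0 (lexx _) hf; exists (1 + 0)^-1 => //.
  by apply: sq0 => //; rewrite addr0 invr1 subrr mulr0.
- have h1 : dsum_id s @[s --> 0^'+] --> (0 : R).
    have h : C1^-1 * s `^ (- r) @[s --> 0^'+] --> (0 : R).
      have : C1^-1 * s `^ (- r) @[s --> 0^'+] --> (C1^-1 * 0 : R).
        by apply: cvgM; [exact: cvg_cst|apply: powR_cvg0; rewrite oppr_gt0].
      by rewrite mulr0.
    apply: (squeeze_cvgr (f := fun _ => 0) _ (cvg_cst _) h); near=> s.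
    have s0' : 0 < s by near: s; exact: nbhs_right_gt.
    have /andP[hr _] : C1 * s `^ r <= fp s <= C2 * s `^ r.
      by apply: hC' => //; near: s; exact: nbhs_right_lt.
    have /andP[-> _] := dsum_id_bound s0'.
    have f0 := addr_gt0 ltr01 (fp0 s0').
    have rC : 0 < C1 * s `^ r by rewrite mulr_gt0// powR_gt0.
    by rewrite powRN -invfM /dsum_id lef_pV2 ?posrE// ler_wpDl.
  by exists 0 => //; apply: sq0 => //; rewrite mul0r.
have [[l l0 hl] hd] := r0 (esym r_eq0).
have hf : fp s @[s --> 0^'+] --> l.
  have : phi s + s * derive1 phi s @[s --> 0^'+] --> l + 0 by exact: cvgD.
  by rewrite addr0.
have h1 := idc l (ltW l0) hf; exists (1 + l)^-1 => //; apply: sq.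
have hel : el s @[s --> 0^'+] --> (1 : R).
  rewrite -(@mulfV _ l) ?gt_eqF//; apply: cvgM => //.
  by apply: cvgV; rewrite ?gt_eqF.
have h2 : (1 + el s) ^+ 2 / (4 * el s) * (dsum_id s * (1 - dsum_id s)) @[s --> 0^'+] -->
    ((1 + 1) ^+ 2 / (4 * 1) * ((1 + l)^-1 * (1 - (1 + l)^-1)) : R).
  apply: cvgM.
    apply: cvgM.
      have h3 : 1 + el s @[s --> 0^'+] --> (1 + 1 : R) by apply: cvgD => //; exact: cvg_cst.
      exact: (cvgM h3 h3).
    apply: cvgV; first by rewrite mulr1.
    by apply: cvgM => //; exact: cvg_cst.
  by apply: cvgM => //; apply: cvgB => //; exact: cvg_cst.
have e1 : (1 + 1) ^+ 2 / (4 * 1) = 1 :> R by field.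
rewrite e1 mul1r in h2; apply: cvg_trans h2; apply: near_eq_cvg; near=> s.
by rewrite dsum_sqrt_sqr//; near: s; exact: nbhs_right_gt.
Unshelve. all: by end_near. Qed.

(** Near 0 by the limit found above, on a compact interval by continuity, near infinity by (v). *)
Lemma dsum_sqrt_bounded : exists B, forall s : R, 0 < s -> dsum_sqrt s <= B.
Proof.
have [k _ hk] := dsum_origin.
have [s0 [s00 hs0]] : exists s0, 0 < s0 /\
    forall s : R, 0 < s -> s < s0 -> dsum_sqrt s <= Num.sqrt (k * (1 - k)) + 1.
  have : \forall s \near 0^'+, dsum_sqrt s < Num.sqrt (k * (1 - k)) + 1.
    by apply: (cvgr_lt _ hk); rewrite ltrDl.
  rewrite near_withinE => -[/= eta eta0 he]; exists eta; split => // s s0 se.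
  by apply/ltW/he => //; rewrite /ball_/= sub0r normrN gtr0_norm.
have [_ _ _ _ [s0' [s00' _ [s1 s01 hs1]]]] := Hphi.
have s10 : 0 < s1 := lt_trans s00' s01.
pose a := s0 / 2; have a0 : 0 < a by rewrite divr_gt0.
pose b := Num.max a s1; have ab : a <= b by rewrite le_max lexx.
have [|c _ hc] := @EVT_max R dsum_sqrt a b ab.
  apply: continuous_in_subspaceT => s; rewrite inE/= in_itv/= => /andP[as' _].
  by apply: continuous_dsum_sqrt; exact: lt_le_trans as'.
(* If phi is nondecreasing then phi <= (s phi)' and the square is at most 1 / phi(s) <= 1 / phi(s1);
   if nonincreasing then (s phi)' <= phi and it is at most phi(s) <= phi(s1). The sum covers both
   cases. *)
have inf (s : R) : s1 <= s -> dsum_sqrt s ^+ 2 <= (phi s1)^-1 + phi s1.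
  move=> s1s; have sp : 0 < s := lt_le_trans s10 s1s.
  have := ph0 s10; have := ph0 sp; have := fp0 sp.
  have -> : dsum_sqrt s ^+ 2 = (phi s + fp s) ^+ 2 / phi s / (4 * (1 + fp s) ^+ 2).
    rewrite /dsum_sqrt (phi_sqrt Hphi sp).
    have q0 := sqrt_phi_gt0 Hphi sp; have := addr_gt0 ltr01 (fp0 sp).
    rewrite sqrtr_sqr (gtr0_norm q0).
    move: (Num.sqrt _) (fp s) q0 => q u q0 h.
    by field; rewrite !gt_eqF.
  move=> f0 p0 p1.
  have D0 : 0 < 4 * (1 + fp s) ^+ 2 by rewrite mulr_gt0// exprn_gt0// addr_gt0.
  case: hs1 => hs1.
    have h1 : phi s <= fp s by rewrite /dmass lerDl mulr_ge0// ?(ltW sp)// hs1.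
    have h2 : phi s1 <= phi s.
      have [|c' /andP[c1 c2] E] := @mean_value _ phi (derive1 phi) s1 s s1s.
        by move=> t /andP[t1 _]; apply: (is_derive_phi Hphi); exact: lt_le_trans t1.
      by rewrite -subr_ge0 E mulr_ge0 ?hs1 ?subr_ge0.
    apply: (@le_trans _ _ (phi s)^-1); last first.
      by rewrite ler_wpDr ?(ltW p1)// lef_pV2.
    rewrite ler_pdivrMr// [leRHS]mulrC; apply: ler_wpM2r; first by rewrite invr_ge0 ltW.
    by move: (phi s) (fp s) h1 f0 p0 => x y *; nra.
  have h1 : fp s <= phi s by rewrite /dmass gerDl pmulr_rle0// hs1.
  have h2 : phi s <= phi s1.
    have [|c' /andP[c1 c2] E] := @mean_value _ phi (derive1 phi) s1 s s1s.
      by move=> t /andP[t1 _]; apply: (is_derive_phi Hphi); exact: lt_le_trans t1.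
    by rewrite -subr_le0 E mulr_le0_ge0 ?hs1 ?subr_ge0.
  apply: (@le_trans _ _ (phi s)); last first.
    by rewrite ler_wpDl// invr_ge0 ltW.
  rewrite ler_pdivrMr// ler_pdivrMr//.
  by move: (phi s) (fp s) h1 f0 p0 => x y *; nra.
have i0 : 0 <= (phi s1)^-1 + phi s1 by rewrite addr_ge0 ?invr_ge0 ?ltW ?ph0.
have B0 := sqrtr_ge0 (k * (1 - k)); have n0 := normr_ge0 (dsum_sqrt c).
have nc := ler_norm (dsum_sqrt c).
set X := Num.sqrt _ in hs0 B0; set Y := (_^-1 + _) in inf i0.
move: X Y B0 i0 hs0 inf => X Y B0 i0 hs0 inf.
exists (X + 1 + `|dsum_sqrt c| + (1 + Y)) => s sp.
have [ss|ss] := ltP s s0; first by have := hs0 s sp ss; lra.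
have [sb|bs] := leP s b.
  have : dsum_sqrt s <= dsum_sqrt c.
    by apply: hc; rewrite in_itv/= sb (le_trans _ ss)// ler_pdivrMr// ler_pMr// ler1n.
  lra.
have sb : s1 <= b by rewrite le_max lexx orbT.
have := inf s (le_trans sb (ltW bs)); have := dsum_sqrt_ge0 sp; nra.
Qed.

End admissible_sum.

Section radial_sum.
Context {R : realType}.
Variable phi : R -> R.
Hypothesis Hphi : phi_admissible phi.

(** H recovers |u| from |p|. The three pairs express u, w and v as radial multiples of p; the values
    k and 1 - k at 0 add up to 1 as u + w = p demands. *)
Lemma radial_decomposition : exists (H : R -> R) (k : R),
  [/\ 0 <= k <= 1 /\
      (forall t : R, 0 < t -> 0 < H t) /\ (forall s : R, 0 < s -> H (s + s * phi s) = s),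
      radialC1 (fun t => if 0 < t then H t / t else k)
        (fun t => if 0 < t then dsum_id phi (H t) else k),
      radialC1 (fun t => if 0 < t then H t * phi (H t) / t else 1 - k)
        (fun t => if 0 < t then 1 - dsum_id phi (H t) else 1 - k) &
      radialC1 (fun t => if 0 < t then H t * Num.sqrt (phi (H t)) / t
                         else Num.sqrt (k * (1 - k)))
        (fun t => if 0 < t then dsum_sqrt phi (H t) else Num.sqrt (k * (1 - k)))].
Proof.
pose h (s : R) := s + s * phi s.
have hd (s : R) : 0 < s -> is_derive s 1 h (1 + dmass phi s).
  by move=> s0; exact: (is_derive_add (is_derive_id s 1) (is_derive_mass Hphi s0)).
have hd0 (s : R) : 0 < s -> 0 < 1 + dmass phi s.
  by move=> s0; rewrite addr_gt0// dmass_gt0.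
have onto (t : R) : 0 < t -> exists s1 s2 : R, [/\ 0 < s1, s1 <= s2, h s1 <= t & t <= h s2].
  move=> t0; have t2 : 0 < t / 2 by rewrite divr_gt0.
  have [s' s'0 fs'] := mass_onto Hphi t2.
  (* At the minimum each of the two terms of h is at most t / 2; at t the first term alone is
     already t. *)
  exists (Num.min s' (t / 2)), t.
  have s10 : 0 < Num.min s' (t / 2) by rewrite lt_min s'0.
  have h1 : Num.min s' (t / 2) <= t / 2 by rewrite ge_min lexx orbT.
  have h2 : Num.min s' (t / 2) * phi (Num.min s' (t / 2)) <= t / 2.
    by rewrite -[leRHS]fs'; apply: (mass_le Hphi) => //; rewrite ge_min lexx.
  move: (Num.min _ _) s10 h1 h2 => s1 s10 h1 h2.
  split => //; rewrite /h; [lra|lra|].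
  by rewrite lerDl mulr_ge0// ltW// phi_gt0.
have [H HP] := inverse_pos_ex hd onto.
have Hd := inverse_pos hd hd0 HP.
have [k hk hs] := dsum_origin Hphi.
have [B hB] := dsum_sqrt_bounded Hphi.
have Hle (t : R) : 0 < t -> H t <= t.
  move=> t0; have [H0 Ht] := HP t t0; rewrite -[leRHS]Ht /h lerDl mulr_ge0 ?ltW//.
  exact: phi_gt0.
have cH (t : R) : 0 < t -> {for t, continuous H}.
  by move=> t0; exact: is_derive_continuous (Hd t t0).
have compH (F : R -> R) (l : R) : F s @[s --> 0^'+] --> l -> F (H t) @[t --> 0^'+] --> l.
  move=> /cvgrPdist_lt hF; apply/cvgrPdist_lt => e e0.
  have := hF e e0; rewrite near_withinE => -[/= eta eta0 he].
  near=> t; have t0 : 0 < t by near: t; exact: nbhs_right_gt.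
  have [H0 _] := HP t t0; apply: he => //.
  rewrite /ball_/= sub0r normrN gtr0_norm//; apply: le_lt_trans (Hle t t0) _.
  by near: t; exact: nbhs_right_lt.
have k01 : 0 <= k <= 1.
  apply/andP; split.
    apply: (cvgr_to_ge hk).
    near=> s; have : 0 < s by near: s; exact: nbhs_right_gt.
    by move=> /(dsum_id_bound Hphi)/andP[].
  apply: (cvgr_to_le hk).
  near=> s; have : 0 < s by near: s; exact: nbhs_right_gt.
  by move=> /(dsum_id_bound Hphi)/andP[].
have id0 : t @[t --> 0^'+] --> (0 : R) by exact: cvg_at_right_filter.
have H0 : H t @[t --> 0^'+] --> (0 : R).
  apply: (squeeze_cvgr (f := fun _ => 0) _ (cvg_cst _) id0); near=> t.
  have t0 : 0 < t by near: t; exact: nbhs_right_gt.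
  by rewrite (ltW (HP t t0).1) Hle.
have wE (t : R) : 0 < t -> H t * phi (H t) = t - H t.
  by move=> /HP[_ Ht]; rewrite -[X in X - _]Ht /h addrC addKr.
exists H, k; split.
- split => //; split; first by move=> t /HP[].
  move=> s s0; have [|Hs0 Hs] := HP (h s); first by rewrite addr_gt0// mass_gt0.
  exact: (inj_pos hd hd0 Hs0 s0 Hs).
- apply: (@radial_of _ H (fun t => dsum_id phi (H t)) k 1) => // [t t0|t t0|].
  + exact: (continuous_comp (cH t t0) (continuous_dsum_id Hphi (HP t t0).1)).
  + by have /andP[h1 h2] := dsum_id_bound Hphi (HP t t0).1; rewrite ger0_norm.
  + exact: compH.
- have hw : radialC1 (fun t => if 0 < t then (t - H t) / t else 1 - k)
      (fun t => if 0 < t then 1 - dsum_id phi (H t) else 1 - k).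
    apply: (@radial_of _ (fun t => t - H t) (fun t => 1 - dsum_id phi (H t)) (1 - k) 1) => // [t t0|t t0|t t0||].
    + exact: (is_deriveB (is_derive_id t 1) (Hd t t0)).
    + apply: cvgB; first exact: cvg_cst.
      exact: (continuous_comp (cH t t0) (continuous_dsum_id Hphi (HP t t0).1)).
    + have /andP[h1 h2] := dsum_id_bound Hphi (HP t t0).1.
      by rewrite ger0_norm ?subr_ge0// gerBl.
    + by have := cvgB id0 H0; rewrite subr0; exact.
    + by apply: cvgB; [exact: cvg_cst|exact: compH].
  move: hw; congr radialC1; apply/funext => t; case: ifP => // t0.
  by rewrite wE.
apply: (@radial_of _ (fun t => H t * Num.sqrt (phi (H t))) (fun t => dsum_sqrt phi (H t))
  (Num.sqrt (k * (1 - k))) B) => // [t t0|t t0|t t0||].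
- have hh := is_derive_chain (is_derive_s_sqrt_phi Hphi (HP t t0).1) (Hd t t0).
  exact: hh.
- exact: (continuous_comp (cH t t0) (continuous_dsum_sqrt Hphi (HP t t0).1)).
- by rewrite ger0_norm ?hB ?(dsum_sqrt_ge0 Hphi) ?(HP t t0).1.
- have h1 : Num.sqrt (t * t) @[t --> 0^'+] --> (0 : R).
    have h2 : t * t @[t --> 0^'+] --> (0 * 0 : R) by exact: cvgM.
    by have := cvg_comp _ _ h2 (@sqrt_continuous R _); rewrite mulr0 sqrtr0; exact.
  apply: (squeeze_cvgr (f := fun _ => 0) _ (cvg_cst _) h1); near=> t.
  have t0 : 0 < t by near: t; exact: nbhs_right_gt.
  have [Ht0 Ht] := HP t t0; rewrite mulr_ge0 ?sqrtr_ge0 ?(ltW Ht0)//=.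
  (* |v|^2 = |u| |w|, and both factors are at most |p|. *)
  have -> : H t * Num.sqrt (phi (H t)) = Num.sqrt (H t * (H t * phi (H t))).
    by rewrite mulrA -expr2 sqrtrM ?sqr_ge0// sqrtr_sqr gtr0_norm.
  rewrite ler_sqrt ?mulr_ge0 ?(ltW t0)// wE//; have := Hle t t0; nra.
exact: compH.
Unshelve. all: by end_near. Qed.

End radial_sum.

(** * The quadratic forms *)

Section real_inner_product.
Local Open Scope sesquilinear_scope.
Context {R : realType} {m : nat}.
Implicit Types (u w : 'cV[R[i]]_m) (A : 'M[R[i]]_m).

(** The Euclidean inner product of C^m regarded as R^(2m). The radial terms involve only real parts,
    so real bilinearity is enough. *)
Definition rdot u w : R := complex.Re (hdot u w).

Lemma normc_ge0 (z : R[i]) : 0 <= Normc.normc z.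
Proof. by case: z => a b; exact: sqrtr_ge0. Qed.

Lemma normcD_le (z w : R[i]) : Normc.normc (z + w) <= Normc.normc z + Normc.normc w.
Proof. exact: (@le_normcD R z w). Qed.


Lemma rdotE u w : rdot u w = \sum_j vpart u j * vpart w j.
Proof. exact: Re_hdot. Qed.

Lemma rdot_hnorm u : rdot u u = hnorm u ^+ 2.
Proof. by rewrite hnorm_sqr. Qed.

Lemma rdotC u w : rdot u w = rdot w u.
Proof. by rewrite !rdotE; apply: eq_bigr => j _; exact: mulrC. Qed.

Lemma rdotDl u u' w : rdot (u + u') w = rdot u w + rdot u' w.
Proof.
rewrite !rdotE -big_split; apply: eq_bigr => j _.
by rewrite vpartD mulrDl.
Qed.

Lemma rdotZl (k : R) u w : rdot (k%:C *: u) w = k * rdot u w.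
Proof.
rewrite !rdotE mulr_sumr; apply: eq_bigr => j _.
by rewrite vpartZ mulrA.
Qed.

Lemma rdotDr u w w' : rdot u (w + w') = rdot u w + rdot u w'.
Proof. by rewrite rdotC rdotDl !(rdotC u). Qed.

Lemma rdotZr (k : R) u w : rdot u (k%:C *: w) = k * rdot u w.
Proof. by rewrite rdotC rdotZl rdotC. Qed.

Lemma rdot_comb (a b a' b' : R) u w u' w' :
  rdot (a%:C *: u + b%:C *: w) (a'%:C *: u' + b'%:C *: w') =
  a * a' * rdot u u' + a * b' * rdot u w' + b * a' * rdot w u' + b * b' * rdot w w'.
Proof.
rewrite rdotDl (rdotZl a) (rdotZl b) (rdotDr u) (rdotDr w).
rewrite (rdotZr a' u) (rdotZr b' u) (rdotZr a' w) (rdotZr b' w).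
by move: (rdot _ _) (rdot _ _) (rdot _ _) (rdot _ _) => x y z t; ring.
Qed.

Lemma rdot0l w : rdot 0 w = 0.
Proof. by have := rdotZl 0 w w; rewrite mul0r scale0r. Qed.

Lemma rdotBl u u' w : rdot (u - u') w = rdot u w - rdot u' w.
Proof.
by apply/eqP; rewrite eq_sym subr_eq -rdotDl subrK.
Qed.

Lemma hnorm0 : hnorm (0 : 'cV[R[i]]_m) = 0.
Proof. by have := rdot_hnorm (0 : 'cV[R[i]]_m); rewrite rdot0l => /esym/eqP; rewrite sqrf_eq0 => /eqP. Qed.

(** Here x, y, r are |u|^2, |w|^2 and <u, w>; the hypothesis is the squared norm of |w|^2 u - <u, w>
    w in the shape that [rdot_comb] produces. *)
Lemma discriminant (r x y : R) : 0 < y ->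
  0 <= y * y * x + y * - r * r + - r * y * r + - r * - r * y -> r ^+ 2 <= x * y.
Proof.
move=> y0 h; rewrite -subr_ge0 -(pmulr_rge0 _ y0).
by move: h; congr (0 <= _); ring.
Qed.

Lemma cauchy_schwarz u w : `|rdot u w| <= hnorm u * hnorm w.
Proof.
have [w0|wN0] := eqVneq (hnorm w) 0.
  by rewrite (hnorm0_eq0 w0) rdotC rdot0l normr0 mulr_ge0 ?hnorm_ge0.
have w0 : 0 < hnorm w by rewrite lt_neqAle eq_sym wN0 hnorm_ge0.
rewrite -(@ler_pXn2r _ 2)// ?nnegrE ?mulr_ge0 ?hnorm_ge0//.
rewrite real_normK ?num_real// exprMn.
have h0 (z : 'cV[R[i]]_m) : 0 <= rdot z z by rewrite rdot_hnorm; exact: sqr_ge0.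
have := h0 ((hnorm w ^+ 2)%:C *: u + (- rdot u w)%:C *: w).
rewrite rdot_comb (rdotC w u) (rdot_hnorm u) (rdot_hnorm w).
exact: discriminant (exprn_gt0 2 w0).
Qed.

Lemma square_sum_le (r x y : R) : r <= x * y ->
  x ^+ 2 + r + (r + y ^+ 2) <= (x + y) ^+ 2.
Proof. nra. Qed.

Lemma hnorm_triangle u w : hnorm (u + w) <= hnorm u + hnorm w.
Proof.
rewrite -(@ler_pXn2r _ 2)// ?nnegrE ?addr_ge0 ?hnorm_ge0//.
rewrite -(rdot_hnorm (u + w)) rdotDl (rdotDr u) (rdotDr w) (rdotC w u) (rdot_hnorm u) (rdot_hnorm w).
exact: square_sum_le (le_trans (ler_norm _) (cauchy_schwarz u w)).
Qed.

Lemma rdot_adjoint A u w : rdot (A^t* *m u) w = rdot u (A *m w).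
Proof.
rewrite /rdot !hdotE; congr complex.Re.
under eq_bigr => i _ do rewrite mxE mulr_suml.
rewrite exchange_big/=; apply: eq_bigr => j _.
rewrite mxE rmorph_sum mulr_sumr; apply: eq_bigr => i _.
by rewrite !mxE rmorphM mulrA [_ * u _ _]mulrC.
Qed.

Lemma normc_hnorm u i : Normc.normc (u i ord0) <= hnorm u.
Proof.
rewrite -(@ler_pXn2r _ 2)// ?nnegrE ?hnorm_ge0//; last exact: normc_ge0.
rewrite normc_sqr hnormE nrm_sqr /sqn.
rewrite -(pair_big xpredT xpredT (fun i b => vpart u (i, b) ^+ 2))/=.
rewrite [leRHS](bigD1 i)//= lerDl sumr_ge0// => j _.
by apply: sumr_ge0 => b _; exact: sqr_ge0.
Qed.

Lemma rdot_mulmx_le A (M : R) u w : (forall i j, Normc.normc (A i j) <= M) ->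
  `|rdot (A *m u) w| <= m%:R ^+ 2 * M * (hnorm u * hnorm w).
Proof.
move=> AM; rewrite /rdot hdotE.
have Re_le (z : R[i]) : `|complex.Re z| <= Normc.normc z.
  rewrite -(@ler_pXn2r _ 2)// ?nnegrE//; last exact: normc_ge0.
  by rewrite real_normK ?num_real// normc_sqr big_bool /= lerDr sqr_ge0.
have sum_le (I : finType) (F : I -> R[i]) : Normc.normc (\sum_i F i) <= \sum_i Normc.normc (F i).
  elim/big_ind2 : _ => // [|x y z t h1 h2].
    by rewrite Normc.normc0.
  by apply: (le_trans (normcD_le _ _)); exact: lerD.
apply: (le_trans (Re_le _)); apply: (le_trans (sum_le _ _)).
have bd i : Normc.normc ((A *m u) i ord0 * conjc (w i ord0)) <= m%:R * M * (hnorm u * hnorm w).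
  rewrite Normc.normcM.
  have -> : Normc.normc (conjc (w i ord0)) = Normc.normc (w i ord0).
    by case: (w i ord0) => a b; rewrite /= sqrrN.
  rewrite mulrA; apply: ler_pM; rewrite ?normc_ge0//; last exact: normc_hnorm.
  rewrite mxE; apply: (le_trans (sum_le _ _)).
  have -> : m%:R * M * hnorm u = \sum_(j < m) M * hnorm u.
    by rewrite sumr_const card_ord -[RHS]mulr_natl mulrA.
  apply: ler_sum => j _; rewrite Normc.normcM.
  by apply: ler_pM; rewrite ?normc_ge0//; exact: normc_hnorm.
have -> : m%:R ^+ 2 * M * (hnorm u * hnorm w) = \sum_(i < m) m%:R * M * (hnorm u * hnorm w).
  by rewrite sumr_const card_ord -[RHS]mulr_natl expr2 !mulrA.
by apply: ler_sum => i _.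
Qed.

End real_inner_product.

Section forms.
Local Open Scope sesquilinear_scope.
Context {R : realType} {N m : nat}.
Implicit Types (A : 'I_N -> 'I_N -> 'M[R[i]]_m) (X Y : 'I_N -> 'cV[R[i]]_m).

Definition reform A X Y : R := \sum_(h < N) \sum_(k < N) rdot (A h k *m X k) (Y h).

Lemma Re_sumc (I : finType) (F : I -> R[i]) :
  complex.Re (\sum_i F i) = \sum_i complex.Re (F i).
Proof. by elim/big_ind2 : _ => // z1 r1 z2 r2 <- <-; exact: Re_addc. Qed.

Lemma Re_comb (z1 z2 z3 : R[i]) (b c r t : R) :
  complex.Re (z1 + b%:C * z2 * r%:C - c%:C * z3 * r%:C * t%:C) =
  complex.Re z1 + b * complex.Re z2 * r - c * complex.Re z3 * r * t.
Proof. by case: z1 z2 z3 => [a1 b1] [a2 b2] [a3 b3] /=; ring. Qed.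

Lemma reformE A X Y :
  complex.Re (\sum_(h < N) \sum_(k < N) hdot (A h k *m X k) (Y h)) = reform A X Y.
Proof. by rewrite Re_sumc; apply: eq_bigr => h _; rewrite Re_sumc. Qed.

Lemma reform_comb A X (V : 'cV[R[i]]_m) (s : 'I_N -> R) (a b a' b' : R) :
  reform A (fun k => a%:C *: X k + (b * s k)%:C *: V)
           (fun h => a'%:C *: X h + (b' * s h)%:C *: V) =
  a * a' * reform A X X + a * b' * reform A X (fun h => (s h)%:C *: V) +
  b * a' * reform A (fun k => (s k)%:C *: V) X +
  b * b' * reform A (fun k => (s k)%:C *: V) (fun h => (s h)%:C *: V).
Proof.
rewrite /reform !mulr_sumr -!big_split; apply: eq_bigr => h _.
rewrite !mulr_sumr -!big_split; apply: eq_bigr => k _ /=.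
rewrite mulmxDr -(scalemxAr a%:C) -(scalemxAr (b * s k)%:C) -(scalemxAr (s k)%:C).
rewrite rdot_comb (rdotZr (s h)) (rdotZl (s k) _ (X h)) (rdotZl (s k)) (rdotZr (s h) _ V).
by move: (rdot _ _) (rdot _ _) (rdot _ _) (rdot _ _) => x y z t; ring.
Qed.

Lemma reform_scale A X Y (a b : R) : reform A (fun k => a%:C *: X k) (fun h => b%:C *: Y h) =
  a * b * reform A X Y.
Proof.
rewrite /reform mulr_sumr; apply: eq_bigr => h _.
rewrite mulr_sumr; apply: eq_bigr => k _ /=.
by rewrite -scalemxAr rdotZl rdotZr mulrA.
Qed.

Lemma reform_le A X Y (M : R) : (forall h k i j, Normc.normc (A h k i j) <= M) ->
  `|reform A X Y| <=
    m%:R ^+ 2 * M * ((\sum_k hnorm (X k)) * (\sum_h hnorm (Y h))).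
Proof.
move=> AM; apply: (le_trans (ler_norm_sum _ _ _)).
rewrite mulrA mulr_sumr; apply: ler_sum => h _; apply: (le_trans (ler_norm_sum _ _ _)).
rewrite mulrAC !mulr_sumr; apply: ler_sum => k _.
apply: (le_trans (rdot_mulmx_le _ _ (AM h k))).
by rewrite [hnorm (X k) * _]mulrC mulrA.
Qed.

(* Re <(A^{kh})^* v, d_h v> = Re <A^{kh} d_h v, v>, so that after exchanging h and k
   the first order terms of the two forms agree. *)
Lemma reform_transformed A X (V : 'cV[R[i]]_m) (b : R) (s := fun k => rdot V (X k)) :
  complex.Re (\sum_(h < N) \sum_(k < N)
    (hdot (A h k *m X k) (X h)
     + b%:C * hdot ((A h k - (A k h)^t*) *m V) (X h) * (s k)%:C
     - (b ^+ 2)%:C * hdot (A h k *m V) V * (s k)%:C * (s h)%:C)) =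
  reform A (fun k => X k + (b * s k)%:C *: V) (fun h => X h + (- b * s h)%:C *: V).
Proof.
have := reform_comb A X V s 1 b 1 (- b).
under [X in X = _ -> _]eq_bigr do under eq_bigr do rewrite !scale1r.
rewrite -/(reform _ _ _) => ->; rewrite !mul1r mulr1 mulrN -expr2 !mulNr.
have -> : reform A X (fun h => (s h)%:C *: V) =
    \sum_(h < N) \sum_(k < N) s k * rdot ((A k h)^t* *m V) (X h).
  rewrite /reform exchange_big; apply: eq_bigr => h _; apply: eq_bigr => k _.
  by rewrite rdotZr rdot_adjoint rdotC.
rewrite Re_sumc /reform !mulr_sumr -!sumrN -!big_split; apply: eq_bigr => h _.
rewrite Re_sumc !mulr_sumr -!sumrN -!big_split; apply: eq_bigr => k _ /=.
transitivity (rdot (A h k *m X k) (X h) +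
  b * rdot ((A h k - (A k h)^t*) *m V) (X h) * s k -
  b ^+ 2 * rdot (A h k *m V) V * s k * s h); first exact: Re_comb.
rewrite mulmxBl (rdotBl (A h k *m V)) -(scalemxAr (s k)%:C).
rewrite (rdotZl (s k)) (rdotZl (s k)) (rdotZr (s h)).
by move: (rdot _ _) (rdot _ _) (rdot _ _) (rdot _ _) => x y z t; ring.
Qed.

End forms.

Section measurable_forms.
Context {R : realType} {N m : nat}.
Variable Omega : set 'rV[R]_N.
Hypothesis oO : open Omega.
Notation mu := (lebesgueN N).
Let mO : measurable Omega := open_measurable_rV oO.
Implicit Types (X Y : 'rV[R]_N -> 'cV[R[i]]_m).

Definition vmeasurable X := forall j, measurable_fun Omega (fun x => vpart (X x) j).

Lemma Rintegral_ae_eq (f g : 'rV[R]_N -> R) :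
  measurable_fun Omega f -> measurable_fun Omega g ->
  {ae mu, forall x, Omega x -> f x = g x} ->
  \int[mu]_(x in Omega) f x = \int[mu]_(x in Omega) g x.
Proof.
move=> mf mg fg; rewrite /Rintegral; congr fine; apply: ae_eq_integral => //.
- exact/measurable_EFinP.
- exact/measurable_EFinP.
by apply: filterS fg => x h Ox /=; rewrite h.
Qed.

Lemma vmeasurableD X Y : vmeasurable X -> vmeasurable Y ->
  vmeasurable (fun x => X x + Y x).
Proof.
by move=> mX mY j; under eq_fun do rewrite vpartD; exact: measurable_funD.
Qed.

Lemma vmeasurableZ (r : 'rV[R]_N -> R) X : measurable_fun Omega r -> vmeasurable X ->
  vmeasurable (fun x => (r x)%:C *: X x).
Proof.
by move=> mr mX j; under eq_fun do rewrite vpartZ; exact: measurable_funM.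
Qed.

Lemma measurable_rdot X Y : vmeasurable X -> vmeasurable Y ->
  measurable_fun Omega (fun x => rdot (X x) (Y x)).
Proof.
move=> mX mY; under eq_fun do rewrite rdotE.
by apply: measurable_sum => j; exact: measurable_funM.
Qed.

Lemma vmeasurable_mulmx (A : 'rV[R]_N -> 'M[R[i]]_m) X :
  (forall i j, cmeasurable Omega (fun x => A x i j)) -> vmeasurable X ->
  vmeasurable (fun x => A x *m X x).
Proof.
move=> mA mX [i b].
have E x : vpart (A x *m X x) (i, b) = \sum_j cpart b (A x i j * X x j ord0).
  rewrite /vpart mxE; elim/big_ind2 : _ => //; first by case: b.
  by move=> z1 r1 z2 r2 <- <-; exact: cpartD.
under eq_fun do rewrite E; apply: measurable_sum => j.
have [mR mI] := mA i j; have mXR := mX (j, false); have mXI := mX (j, true).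
rewrite /cpart; case: b {E}.
  under eq_fun do rewrite Im_mulc.
  by apply: measurable_funD; exact: measurable_funM.
under eq_fun do rewrite Re_mulc.
by apply: measurable_funB; exact: measurable_funM.
Qed.

Lemma measurable_reform (A : 'I_N -> 'I_N -> 'rV[R]_N -> 'M[R[i]]_m)
    (X Y : 'I_N -> 'rV[R]_N -> 'cV[R[i]]_m) :
  (forall h k i j, cmeasurable Omega (fun x => A h k x i j)) ->
  (forall k, vmeasurable (X k)) -> (forall k, vmeasurable (Y k)) ->
  measurable_fun Omega (fun x => reform (fun h k => A h k x) (X^~ x) (Y^~ x)).
Proof.
move=> mA mX mY; apply: measurable_sum => h; apply: measurable_sum => k.
by apply: measurable_rdot => //; exact: vmeasurable_mulmx.
Qed.

Lemma measurable_if_pos (F : R -> R) (c : R) :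
  (forall t : R, 0 < t -> {for t, continuous F}) ->
  measurable_fun setT (fun t : R => if 0 < t then F t else c).
Proof.
move=> cF; pose P : set R := [set t | 0 < t].
have oP : open P by exact: open_gt.
have mP : measurable P by exact: open_measurable.
have -> : [set: R] = P `|` ~` P by rewrite setUv.
apply/measurable_funU => //; first exact: measurableC.
split.
  apply: (@eq_measurable_fun _ _ _ _ _ F).
    by move=> t /set_mem /= t0; rewrite t0.
  by apply: open_continuous_measurable_fun => // t /set_mem /=; exact: cF.
apply: (@eq_measurable_fun _ _ _ _ _ (cst c)); last exact: measurable_cst.
by move=> t /set_mem /= t0; rewrite ifF//; apply/negP.
Qed.

(** Meant for [Lambda], which is continuous on the open half-line only; at 0 it merely takes some
    value. *)
Lemma measurable_hnorm_comp (F : R -> R) X :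
  (forall t : R, 0 < t -> {for t, continuous F}) -> vmeasurable X ->
  measurable_fun Omega (fun x => F (hnorm (X x))).
Proof.
move=> cF mX; have E x : F (hnorm (X x)) = (fun t : R => if 0 < t then F t else F 0) (hnorm (X x)).
  by rewrite /=; case: ltP => // h; congr F; apply/le_anti; rewrite h hnorm_ge0.
under eq_fun do rewrite E.
by apply: measurableT_comp (measurable_if_pos _ cF) _; exact: measurable_hnorm.
Qed.

End measurable_forms.

(** * Gradients of radial multiples and the zero set *)

Section vector_gradients.
Context {R : realType} {N m : nat}.
Variable Omega : set 'rV[R]_N.
Hypothesis oO : open Omega.
Notation mu := (lebesgueN N).
Let mO : measurable Omega := open_measurable_rV oO.
Implicit Types (v : 'rV[R]_N -> 'cV[R[i]]_m).

Lemma H10v_vmeasurable v : H10v Omega v ->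
  vmeasurable Omega v /\ forall k, vmeasurable Omega (wpartialv Omega k v).
Proof.
move=> Hv; split=> [j|k j]; have [h1 h2] := H10v_sqint oO j Hv; first by have [] := h1.
by have [] := h2 k.
Qed.

Lemma H10v_gradient_integrable v : H10v Omega v ->
  mu.-integrable Omega (EFin \o (fun x => \sum_k hnorm (wpartialv Omega k v x) ^+ 2)).
Proof.
move=> Hv; rewrite (_ : _ \o _ = fun x =>
    (\sum_k (\sum_j ((vpart (wpartialv Omega k v x) j ^+ 2)%R)%:E))%E).
  apply: integrable_sum => // k _; apply: integrable_sum => // j _.
  by have [_ /(_ k)[]] := H10v_sqint oO j Hv.
apply/funext => x; rewrite /= -sumEFin; apply: eq_bigr => k _.
by rewrite sumEFin hnormE nrm_sqr.
Qed.

Lemma H10v_ibp v j k (psi : 'rV[R]_N -> R) : H10v Omega v -> test_fun Omega psi ->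
  \int[mu]_(x in Omega) (vpart (v x) j * 'D_('e_k) psi x) =
  - \int[mu]_(x in Omega) (vpart (wpartialv Omega k v x) j * psi x).
Proof.
move=> Hv tpsi; have [[LF wF] _] := Hv j.1.
have [_ h] := (is_wpartialP oO k _ LF).1 (wpartialP (wF k)).
rewrite (h j.2 psi tpsi) /wpartialv; congr (- _); apply: eq_Rintegral => x _.
by rewrite /vpart mxE.
Qed.

(** The derivative at V of y |-> a |y| y, applied to X: the component of X along V is multiplied by
    c, the orthogonal one by a. *)
Definition radial_partial (a c : R) (V X : 'cV[R[i]]_m) : 'cV[R[i]]_m :=
  a%:C *: X + ((c - a) / hnorm V ^+ 2 * rdot V X)%:C *: V.

Lemma radial_partial_le (a c : R) (V X : 'cV[R[i]]_m) :
  hnorm (radial_partial a c V X) <= (`|a| + `|c - a|) * hnorm X.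
Proof.
apply: (le_trans (hnorm_triangle _ _)); rewrite [leRHS]mulrDl !hnormZ lerD2l.
have [V0|VN0] := eqVneq (hnorm V) 0.
  by rewrite V0 mulr0 mulr_ge0 ?hnorm_ge0.
have V0 : 0 < hnorm V by rewrite lt_neqAle eq_sym VN0 hnorm_ge0.
rewrite !normrM normfV (ger0_norm (sqr_ge0 _)).
have := cauchy_schwarz V X; move: `|rdot V X| (hnorm X) (hnorm V) V0 VN0 => r x y y0 yN0 h.
have -> : `|c - a| / y ^+ 2 * r * y = `|c - a| / y * r by field.
by rewrite -mulrA ler_wpM2l// mulrC ler_pdivrMr// mulrC.
Qed.

Lemma sqr_vpart_le (u : 'cV[R[i]]_m) j : vpart u j ^+ 2 <= hnorm u ^+ 2.
Proof.
by rewrite hnormE nrm_sqr /sqn (bigD1 j)//= lerDl sumr_ge0// => i _; exact: sqr_ge0.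
Qed.

(* Stampacchia: the truncations [cutoff 1 d |v| v / |v|] tend to v, and their
   derivatives tend to those of v where v <> 0 and vanish where v = 0. *)
Lemma wpartialv_zero_set v : H10v Omega v ->
  {ae mu, forall x, Omega x -> v x = 0 -> forall k, wpartialv Omega k v x = 0}.
Proof.
move=> Hv; have [mv mdv] := H10v_vmeasurable Hv.
pose d n : R := n.+1%:R^-1; have d0 n : 0 < d n by rewrite invr_gt0.
(* These are the truncation multipliers of the identity for q = 0, written out so as to be
   convertible with [elastic_value] and [elastic_slope]. *)
pose a n (t : R) := if 0 < t then cutoff 1 (d n) t / t else 0.
pose c n (t : R) := if 0 < t then
  1 * (cutoff 1 (d n) t / cutoff 1 (d n) t) * dcutoff 1 (d n) t else 0.
have rad n : radialC1 (a n) (c n) by exact: (elastic_radial (id_elastic 0) (d0 n)).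
have Hn n := H10v_radial oO (rad n) Hv.
have cE n (t : R) : 0 < t -> c n t = dcutoff 1 (d n) t.
  by move=> t0; rewrite /c t0 mulfV ?mul1r// gt_eqF// cutoff_gt0.
have ale n (t : R) : 0 <= a n t <= 1.
  rewrite /a; case: ifP => t0; last by rewrite lexx ler01.
  by rewrite divr_ge0 ?(ltW t0) ?(ltW (cutoff_gt0 _ _ _))//= ler_pdivrMr// mul1r cutoff_le.
have cle n (t : R) : 0 <= c n t <= 2.
  have [t0|t0] := ltP 0 t; last by rewrite /c ltNge t0 lexx ler0n.
  rewrite cE// dcutoff_ge0//=; apply: (le_trans (dcutoff_le _ (d0 n) t0)).
  have := ale n t; rewrite /a t0 => /andP[_ h].
  by rewrite -[leRHS]mulr1; apply: ler_wpM2l.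
have acvg (t : R) : 0 < t -> a n t @[n --> \oo] --> (1 : R) /\ c n t @[n --> \oo] --> (1 : R).
  move=> t0; have [h1 h2] := cutoff_cvg 0 t0; split.
    under eq_fun do rewrite /a t0; rewrite -(@mulfV _ t) ?gt_eqF//.
    by apply: cvgM => //; exact: cvg_cst.
  under eq_fun do rewrite cE//.
  exact: h2.
(* The pointwise limit of the derivatives of the truncations: dv where v <> 0, and 0 elsewhere. It
   turns out to be a weak derivative of v, hence equal to dv a.e. *)
pose g k x : 'cV[R[i]]_m := if 0 < hnorm (v x) then wpartialv Omega k v x else 0.
have gE k j x : vpart (g k x) j =
    (fun t : R => if 0 < t then 1 else 0) (hnorm (v x)) * vpart (wpartialv Omega k v x) j.
  rewrite /g /=; case: ifP => _; first by rewrite mul1r.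
  by rewrite mul0r /vpart mxE; case: (j.2).
have mg k : vmeasurable Omega (g k).
  move=> j; under eq_fun do rewrite gE; apply: measurable_funM; last exact: mdv.
  apply: (measurableT_comp (measurable_if_pos 0 (F := cst 1) _)).
    by move=> t _; exact: cvg_cst.
  exact: measurable_hnorm mv.
have avp n x j : vpart (nscale (a n) v x) j = a n (hnorm (v x)) * vpart (v x) j.
  exact: vpartZ.
have ortho k j psi : test_fun Omega psi ->
    \int[mu]_(x in Omega) (vpart (v x) j * 'D_('e_k) psi x) =
    - \int[mu]_(x in Omega) (vpart (g k x) j * psi x).
  move=> tpsi; have [spsi sdpsi] := test_fun_sqint oO tpsi.
  have [sv sdv] := H10v_sqint oO j Hv.
  have cvg1 : \int[mu]_(x in Omega) (vpart (nscale (a n) v x) j * 'D_('e_k) psi x)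
      @[n --> \oo] --> \int[mu]_(x in Omega) (vpart (v x) j * 'D_('e_k) psi x).
    apply: (sqint_mul_cvg oO (D := fun x => vpart (v x) j ^+ 2)) => //.
    - by move=> n; have [h _] := H10v_vmeasurable (proj1 (Hn n)); exact: h.
    - by have [] := sv.
    - apply: aeW => x Ox; split=> [n|].
        rewrite avp exprMn ler_piMl ?sqr_ge0// exprn_ile1//;
          by have /andP[] := ale n (hnorm (v x)).
      under eq_fun do rewrite avp.
      have [V0|VN0] := eqVneq (hnorm (v x)) 0.
        have -> : vpart (v x) j = 0.
          by apply/eqP; rewrite -sqrf_eq0 -[_ == 0]andbT; have := sqr_vpart_le (v x) j;
             rewrite V0 expr0n /= => h; rewrite andbT eq_le h sqr_ge0.
        by under eq_fun do rewrite mulr0; exact: cvg_cst.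
      have V0 : 0 < hnorm (v x) by rewrite lt_neqAle eq_sym VN0 hnorm_ge0.
      have h1 : a n (hnorm (v x)) * vpart (v x) j @[n --> \oo] --> 1 * vpart (v x) j.
        by apply: cvgM; [exact: (acvg _ V0).1|exact: cvg_cst].
      by rewrite mul1r in h1; exact: h1.
  have cvg2 : \int[mu]_(x in Omega) (vpart (wpartialv Omega k (nscale (a n) v) x) j * psi x)
      @[n --> \oo] --> \int[mu]_(x in Omega) (vpart (g k x) j * psi x).
    (* 9 = 3^2 with |a| + |c - a| <= 1 + 2, from 0 <= a <= 1 and 0 <= c <= 2. *)
    apply: (sqint_mul_cvg oO (D := fun x => 9 * \sum_k hnorm (wpartialv Omega k v x) ^+ 2)) => //.
    - by move=> n; have [_ h] := H10v_vmeasurable (proj1 (Hn n)); exact: h.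
    - exact: mg.
    - by apply: integrableZ => //; exact: H10v_gradient_integrable.
    - have := ae_foralln (fun n => (Hn n).2); apply: filterS => x hx Ox.
      have E n : wpartialv Omega k (nscale (a n) v) x =
          radial_partial (a n (hnorm (v x))) (c n (hnorm (v x))) (v x) (wpartialv Omega k v x).
        exact: hx.
      split=> [n|].
        rewrite E; apply: (le_trans (sqr_vpart_le _ _)).
        apply: (@le_trans _ _ ((3 * hnorm (wpartialv Omega k v x)) ^+ 2)).
          rewrite ler_pXn2r ?nnegrE ?mulr_ge0 ?hnorm_ge0//.
          apply: (le_trans (radial_partial_le _ _ _ _)); apply: ler_wpM2r; first exact: hnorm_ge0.
          have /andP[a0 a1] := ale n (hnorm (v x)); have /andP[c0 c2] := cle n (hnorm (v x)).
          rewrite (ger0_norm a0); move: (a n _) (c n _) a0 a1 c0 c2 => y z *.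
          have : `|z - y| <= 2 by rewrite ler_norml; lra.
          lra.
        rewrite exprMn -natrX; apply: ler_wpM2l => //.
        by rewrite (bigD1 k)//= lerDl sumr_ge0// => l _; exact: sqr_ge0.
      under eq_fun do rewrite E /radial_partial vpartD !vpartZ.
      rewrite /g; case: ifPn => V0; last first.
        have {}V0 : hnorm (v x) = 0 by apply/le_anti; rewrite hnorm_ge0 leNgt V0.
        rewrite V0 (hnorm0_eq0 V0).
        have v0 : vpart (0 : 'cV[R[i]]_m) j = 0 by rewrite /vpart mxE; case: (j.2).
        rewrite v0 /a ltxx; under eq_fun do rewrite mul0r mulr0 addr0; exact: cvg_cst.
      have [ca cc] := acvg _ V0.
      have h1 : a n (hnorm (v x)) * vpart (wpartialv Omega k v x) j @[n --> \oo] -->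
          1 * vpart (wpartialv Omega k v x) j by apply: cvgM => //; exact: cvg_cst.
      have h2 : (c n (hnorm (v x)) - a n (hnorm (v x))) / hnorm (v x) ^+ 2 *
          rdot (v x) (wpartialv Omega k v x) * vpart (v x) j @[n --> \oo] -->
          (1 - 1) / hnorm (v x) ^+ 2 * rdot (v x) (wpartialv Omega k v x) * vpart (v x) j.
        apply: cvgM; last exact: cvg_cst.
        apply: cvgM; last exact: cvg_cst.
        by apply: cvgM; [exact: cvgB|exact: cvg_cst].
      have := cvgD h1 h2; rewrite subrr !mul0r addr0 mul1r; exact.
  have E : (fun n => \int[mu]_(x in Omega) (vpart (nscale (a n) v x) j * 'D_('e_k) psi x)) =
      (fun n => - (\int[mu]_(x in Omega) (vpart (wpartialv Omega k (nscale (a n) v) x) j * psi x))).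
    by apply/funext => n; rewrite (H10v_ibp j k (proj1 (Hn n)) tpsi).
  rewrite E in cvg1; exact: (cvg_unique (@Rhausdorff R) cvg1 (cvgN cvg2)).
have sg k j : sqint Omega (fun x => vpart (g k x) j).
  apply: (sqint_le oO (mg k j) (H10v_gradient_integrable Hv)); apply: aeW => x _.
  rewrite gE /= exprMn; apply: (@le_trans _ _ (vpart (wpartialv Omega k v x) j ^+ 2)).
    by rewrite ler_piMl ?sqr_ge0//; case: ifP => _; rewrite ?expr1n ?expr0n.
  apply: (le_trans (sqr_vpart_le _ _)).
  by rewrite (bigD1 k)//= lerDl sumr_ge0// => l _; exact: sqr_ge0.
have dg k j : {ae mu, forall x, Omega x -> vpart (wpartialv Omega k v x) j - vpart (g k x) j = 0}.
  have [sv /(_ k) sdv] := H10v_sqint oO j Hv.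
  apply: (sqint_orthogonal0 oO); first exact: sqintB.
  move=> psi tpsi; have [spsi _] := test_fun_sqint oO tpsi.
  under eq_Rintegral do rewrite mulrBl.
  rewrite RintegralB//; [|exact: sqintM|exact: sqintM].
  by have := ortho k j psi tpsi; rewrite (H10v_ibp j k Hv tpsi) => /oppr_inj ->; rewrite subrr.
suff : {ae mu, forall x, forall k, forall j, Omega x ->
    vpart (wpartialv Omega k v x) j - vpart (g k x) j = 0}.
  apply: filterS => x h Ox vx0 k; apply: vpart_inj => j.
  have := h k j Ox; rewrite gE vx0 hnorm0 /= ltxx mul0r subr0 => ->.
  by rewrite /vpart mxE; case: (j.2).
by apply: filter_forall => k; apply: filter_forall => j; exact: dg.
Qed.

End vector_gradients.

Section radial_algebra.
Context {R : realType} {N m : nat}.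
Implicit Types (P X : 'cV[R[i]]_m).

Lemma scalerC (k : R) (l : R) X : k%:C *: (l%:C *: X) = (k * l)%:C *: X.
Proof. by rewrite scalerA -rmorphM. Qed.

Lemma radial_partialZ (r a c : R) P X :
  radial_partial (r * a) (r * c) P X = r%:C *: radial_partial a c P X.
Proof.
rewrite /radial_partial scalerDr !scalerC; congr (_ + _ %:C *: _).
by rewrite -mulrBr !mulrA.
Qed.

Lemma radial_partial0 (a c : R) X : radial_partial a c 0 X = a%:C *: X.
Proof. by rewrite /radial_partial scaler0 addr0. Qed.

Lemma radial_partial1 (c : R) P X :
  radial_partial 1 (1 + c) P X = X + (c / hnorm P ^+ 2 * rdot P X)%:C *: P.
Proof. by rewrite /radial_partial scale1r addrAC subrr add0r. Qed.

(* The map v |-> dv + L <e, dv> e, e = v / |v|, multiplies the radial part of dv by 1 + L. *)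
Lemma radial_partial_twist (a c L : R) P X : a != 0 -> hnorm P != 0 ->
  radial_partial 1 (1 + L) (a%:C *: P) (radial_partial a c P X) =
  radial_partial a ((1 + L) * c) P X.
Proof.
move=> a0 P0; rewrite radial_partial1 scalerC /radial_partial -addrA -scalerDl -rmorphD.
congr (_ + _%:C *: _); rewrite hnormZ exprMn real_normK ?num_real//.
have -> : rdot (a%:C *: P) (a%:C *: X + ((c - a) / hnorm P ^+ 2 * rdot P X)%:C *: P) =
    a * c * rdot P X.
  rewrite rdotZl (rdotDr P) (rdotZr a) (rdotZr (_ * _)) rdot_hnorm.
  by move: (rdot P X) (hnorm P) P0 => r t t0; field.
by move: (rdot P X) (hnorm P) P0 => r t t0; field; rewrite a0 t0.
Qed.

End radial_algebra.

Section limits.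
Context {R : realType} {N m : nat}.
Implicit Types (A : 'I_N -> 'I_N -> 'M[R[i]]_m) (X : 'I_N -> 'cV[R[i]]_m) (V : 'cV[R[i]]_m).

Lemma radial_coef_cvg (a_ c_ : nat -> R) (a c h : R) :
  a_ @ \oo --> a -> c_ @ \oo --> c ->
  (fun n => (c_ n - a_ n) / h) @ \oo --> (c - a) / h.
Proof. by move=> ha hc; apply: cvgM; [exact: cvgB|exact: cvg_cst]. Qed.

Lemma reform_radial_cvg A X V (a_ c_ a'_ c'_ : nat -> R) (a c a' c' : R) :
  a_ @ \oo --> a -> c_ @ \oo --> c -> a'_ @ \oo --> a' -> c'_ @ \oo --> c' ->
  (fun n => reform A (fun k => radial_partial (a_ n) (c_ n) V (X k))
                     (fun h => radial_partial (a'_ n) (c'_ n) V (X h))) @ \oo -->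
  reform A (fun k => radial_partial a c V (X k)) (fun h => radial_partial a' c' V (X h)).
Proof.
move=> ha hc ha' hc'; have hb := radial_coef_cvg (h := hnorm V ^+ 2) ha hc.
have hb' := radial_coef_cvg (h := hnorm V ^+ 2) ha' hc'.
pose G (x y x' y' : R) : R := x * x' * reform A X X +
  x * y' * reform A X (fun h => (rdot V (X h))%:C *: V) +
  y * x' * reform A (fun k => (rdot V (X k))%:C *: V) X +
  y * y' * reform A (fun k => (rdot V (X k))%:C *: V) (fun h => (rdot V (X h))%:C *: V).
have E (x y x' y' : R) : reform A (fun k => radial_partial x y V (X k))
    (fun h => radial_partial x' y' V (X h)) =
    G x ((y - x) / hnorm V ^+ 2) x' ((y' - x') / hnorm V ^+ 2) by exact: reform_comb.
rewrite E (_ : (fun n => _) = fun n => G (a_ n) ((c_ n - a_ n) / hnorm V ^+ 2)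
  (a'_ n) ((c'_ n - a'_ n) / hnorm V ^+ 2)); last by apply/funext => n; exact: E.
rewrite /G.
have cM (x_ y_ : nat -> R) (x y z : R) : x_ @ \oo --> x -> y_ @ \oo --> y ->
    (fun n => x_ n * y_ n * z) @ \oo --> x * y * z.
  by move=> hx hy; apply: cvgM; [exact: cvgM|exact: cvg_cst].
apply: cvgD; last exact: cM.
apply: cvgD; last exact: cM.
by apply: cvgD; exact: cM.
Qed.

Lemma hnorm_radial_cvg (Y : 'cV[R[i]]_m) V (a_ c_ : nat -> R) (a c : R) :
  a_ @ \oo --> a -> c_ @ \oo --> c ->
  (fun n => hnorm (radial_partial (a_ n) (c_ n) V Y) ^+ 2) @ \oo -->
  hnorm (radial_partial a c V Y) ^+ 2.
Proof.
move=> ha hc; have hb := radial_coef_cvg (h := hnorm V ^+ 2) ha hc.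
pose G (x y : R) : R := x * x * rdot Y Y + x * y * rdot Y V + y * x * rdot V Y +
  y * y * rdot V V.
have E (x y : R) : hnorm (radial_partial x y V Y) ^+ 2 =
    G x ((y - x) / hnorm V ^+ 2 * rdot V Y) by apply: (etrans (esym (rdot_hnorm _))); exact: rdot_comb.
have {}hb : (fun n => (c_ n - a_ n) / hnorm V ^+ 2 * rdot V Y) @ \oo -->
    (c - a) / hnorm V ^+ 2 * rdot V Y by apply: cvgM => //; exact: cvg_cst.
refine (eq_ind_r (fun l : R => _ @ \oo --> l) _ (E a c)).
refine (eq_ind_r (fun f : nat -> R => f @ \oo --> _) _ (funext (fun n => E (a_ n) (c_ n)))).
rewrite /G.
have cM (x_ y_ : nat -> R) (x y z : R) : x_ @ \oo --> x -> y_ @ \oo --> y ->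
    (fun n => x_ n * y_ n * z) @ \oo --> x * y * z.
  by move=> hx hy; apply: cvgM; [exact: cvgM|exact: cvg_cst].
apply: cvgD; last exact: cM.
apply: cvgD; last exact: cM.
by apply: cvgD; exact: cM.
Qed.

End limits.

Section transformed.
Context {R : realType} {N m : nat}.
Variables (Omega : set 'rV[R]_N) (A : 'I_N -> 'I_N -> 'rV[R]_N -> 'M[R[i]]_m).
Variable phi : R -> R.
Hypothesis oO : open Omega.
Hypothesis AL : forall h k i j, Linfty Omega (fun x => A h k x i j).
Hypothesis Hphi : phi_admissible phi.
Notation mu := (lebesgueN N).
Let mO : measurable Omega := open_measurable_rV oO.
Implicit Types (u v w : 'rV[R]_N -> 'cV[R[i]]_m).

Let mA h k i j : cmeasurable Omega (fun x => A h k x i j).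
Proof. by have [] := AL h k i j. Qed.

Lemma transformed_reformE v x (L := Lambda phi (hnorm (v x))) :
  complex.Re (transformed_integrand Omega A phi v x) =
  reform (fun h k => A h k x)
    (fun k => radial_partial 1 (1 + L) (v x) (wpartialv Omega k v x))
    (fun h => radial_partial 1 (1 - L) (v x) (wpartialv Omega h v x)).
Proof.
have := reform_transformed (fun h k => A h k x) (fun k => wpartialv Omega k v x) (v x)
  (L / hnorm (v x) ^+ 2).
rewrite -mulNr => E.
have -> : (fun k => radial_partial 1 (1 + L) (v x) (wpartialv Omega k v x)) =
    (fun k => wpartialv Omega k v x +
      (L / hnorm (v x) ^+ 2 * rdot (v x) (wpartialv Omega k v x))%:C *: v x).
  by apply/funext => k; rewrite radial_partial1.
have -> : (fun k => radial_partial 1 (1 - L) (v x) (wpartialv Omega k v x)) =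
    (fun k => wpartialv Omega k v x +
      (- L / hnorm (v x) ^+ 2 * rdot (v x) (wpartialv Omega k v x))%:C *: v x).
  by apply/funext => k; rewrite radial_partial1.
rewrite -E /transformed_integrand; congr complex.Re.
have -> : Lambda phi (hnorm (v x)) ^+ 2 * hnorm (v x) ^- 4 = (L / hnorm (v x) ^+ 2) ^+ 2.
  have sqr_div (l h : R) : l ^+ 2 * h ^- 4 = (l / h ^+ 2) ^+ 2.
    by rewrite expr_div_n -exprM.
  exact: sqr_div.
by [].
Qed.

Lemma vmeasurable_radial_partial (a c : 'rV[R]_N -> R) v (X : 'rV[R]_N -> 'cV[R[i]]_m) :
  measurable_fun Omega a -> measurable_fun Omega c -> vmeasurable Omega v ->
  vmeasurable Omega X -> vmeasurable Omega (fun x => radial_partial (a x) (c x) (v x) (X x)).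
Proof.
move=> ma mc mv mX; apply: vmeasurableD; first exact: vmeasurableZ.
apply: vmeasurableZ => //; apply: measurable_funM; last exact: measurable_rdot.
apply: measurable_funM; first exact: measurable_funB.
apply: (measurableT_comp measurable_invR).
by under eq_fun do rewrite expr2; apply: measurable_funM; exact: measurable_hnorm.
Qed.

Lemma measurable_transformed v : H10v Omega v ->
  measurable_fun Omega (fun x => complex.Re (transformed_integrand Omega A phi v x)).
Proof.
move=> Hv; have [mv mdv] := H10v_vmeasurable oO Hv.
have mL : measurable_fun Omega (fun x => Lambda phi (hnorm (v x))).
  by apply: measurable_hnorm_comp => // t t0; exact: continuous_Lambda.
pose X k x := radial_partial 1 (1 + Lambda phi (hnorm (v x))) (v x) (wpartialv Omega k v x).
pose Y k x := radial_partial 1 (1 - Lambda phi (hnorm (v x))) (v x) (wpartialv Omega k v x).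
apply: (eq_measurable_fun (fun x => reform (fun h k => A h k x) (X^~ x) (Y^~ x))).
  by move=> x _; rewrite transformed_reformE.
apply: measurable_reform => // k.
- by apply: vmeasurable_radial_partial => //; exact: measurable_funD.
- by apply: vmeasurable_radial_partial => //; exact: measurable_funB.
Qed.

Lemma measurable_bilinear u w : H10v Omega u -> H10v Omega w ->
  measurable_fun Omega (fun x => complex.Re (\sum_(h < N) \sum_(k < N)
    hdot (A h k x *m wpartialv Omega k u x) (wpartialv Omega h w x))).
Proof.
move=> Hu Hw; have [_ mdu] := H10v_vmeasurable oO Hu.
have [_ mdw] := H10v_vmeasurable oO Hw.
apply: (eq_measurable_fun (fun x => reform (fun h k => A h k x)
  (fun k => wpartialv Omega k u x) (fun k => wpartialv Omega k w x))).
  by move=> x _; rewrite reformE.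
exact: (@measurable_reform _ _ _ _ A (fun k => wpartialv Omega k u)
  (fun k => wpartialv Omega k w)).
Qed.

(** Let q = sqrt (phi s). Scaling the radial part of dv by 1 + L gives q du, and by 1 - L gives dw /
    q. The two scalar factors cancel in the bilinear form. *)
Lemma decomposition_reform (B : 'I_N -> 'I_N -> 'M[R[i]]_m) (P : 'cV[R[i]]_m)
    (X : 'I_N -> 'cV[R[i]]_m) (s : R) (t := hnorm P)
    (a := s * Num.sqrt (phi s) / t) (L := Lambda phi (hnorm (a%:C *: P))) :
  0 < s -> 0 < t ->
  reform B (fun k => radial_partial 1 (1 + L) (a%:C *: P)
              (radial_partial a (dsum_sqrt phi s) P (X k)))
           (fun h => radial_partial 1 (1 - L) (a%:C *: P)
              (radial_partial a (dsum_sqrt phi s) P (X h))) =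
  reform B (fun k => radial_partial (s / t) (dsum_id phi s) P (X k))
           (fun h => radial_partial (s * phi s / t) (1 - dsum_id phi s) P (X h)).
Proof.
move=> s0 t0; have q0 := sqrt_phi_gt0 Hphi s0; have f0 := dmass_gt0 Hphi s0.
have a0 : 0 < a := divr_gt0 (mulr_gt0 s0 q0) t0.
have LE : L = 2 / (1 + elast phi s) - 1.
  rewrite /L hnormZ (gtr0_norm a0) divfK ?lt0r_neq0//.
  by rewrite (LambdaE Hphi (mulr_gt0 s0 q0)) (zetaK Hphi s0).
have tN : hnorm P != 0 := lt0r_neq0 t0.
have twist c : (fun k => radial_partial 1 (1 + c) (a%:C *: P)
      (radial_partial a (dsum_sqrt phi s) P (X k))) =
    (fun k => radial_partial a ((1 + c) * dsum_sqrt phi s) P (X k)).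
  by apply/funext => k; exact: radial_partial_twist (lt0r_neq0 a0) tN.
rewrite !twist LE /a {twist LE L a a0 tN}; move: t t0 => t t0.
(* [E1] and [E2] compare the radial coefficients of du and dw with those of dv, [E3] and [E4] the
   tangential ones. *)
have E1 : dsum_id phi s = (Num.sqrt (phi s))^-1 *
    ((1 + (2 / (1 + elast phi s) - 1)) * dsum_sqrt phi s).
  rewrite /dsum_id /dsum_sqrt /elast (phi_sqrt Hphi s0).
  rewrite sqrtr_sqr (gtr0_norm q0).
  have := addr_gt0 f0 (exprn_gt0 2 q0); have := addr_gt0 ltr01 f0.
  move: (Num.sqrt _) (dmass phi s) q0 f0 => q f q0 f0 h h'.
  by rewrite [1 + (_ - 1)]addrC subrK; field; rewrite !gt_eqF// addrC.
have E2 : 1 - dsum_id phi s = Num.sqrt (phi s) *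
    ((1 - (2 / (1 + elast phi s) - 1)) * dsum_sqrt phi s).
  rewrite /dsum_id /dsum_sqrt /elast (phi_sqrt Hphi s0).
  rewrite sqrtr_sqr (gtr0_norm q0).
  have := addr_gt0 f0 (exprn_gt0 2 q0); have := addr_gt0 ltr01 f0.
  move: (Num.sqrt _) (dmass phi s) q0 f0 => q f q0 f0 h h'.
  by field; rewrite !gt_eqF// addrC.
have E3 : s / t = (Num.sqrt (phi s))^-1 * (s * Num.sqrt (phi s) / t).
  by move: (Num.sqrt _) q0 => q q0; field; rewrite !gt_eqF.
have E4 : s * phi s / t = Num.sqrt (phi s) * (s * Num.sqrt (phi s) / t).
  by rewrite [in LHS](phi_sqrt Hphi s0); move: (Num.sqrt _) q0 => q q0; field; rewrite !gt_eqF.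
have scale1 : (fun k => radial_partial (s / t) (dsum_id phi s) P (X k)) =
    (fun k => ((Num.sqrt (phi s))^-1)%:C *: radial_partial (s * Num.sqrt (phi s) / t)
      ((1 + (2 / (1 + elast phi s) - 1)) * dsum_sqrt phi s) P (X k)).
  by apply/funext => k; rewrite -radial_partialZ -E1 -E3.
have scale2 : (fun k => radial_partial (s * phi s / t) (1 - dsum_id phi s) P (X k)) =
    (fun k => (Num.sqrt (phi s))%:C *: radial_partial (s * Num.sqrt (phi s) / t)
      ((1 - (2 / (1 + elast phi s) - 1)) * dsum_sqrt phi s) P (X k)).
  by apply/funext => k; rewrite -radial_partialZ -E2 -E4.
by rewrite scale1 scale2 reform_scale mulVf ?mul1r// lt0r_neq0.
Qed.

Lemma transformed_dissipative :
  (exists2 kappa : R, 0 < kappa & forall v, H10v Omega v ->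
    kappa * dirichlet Omega v <=
    complex.Re (cintegral Omega (transformed_integrand Omega A phi v))) ->
  strict_dissipative Omega A phi.
Proof.
move=> [kappa k0 hk]; exists kappa => // u Hu Hw.
have [H [k [[/andP[k0' k1] [H0 HK]] rU rW rV]]] := radial_decomposition Hphi.
set aU := (X in radialC1 X _) in rU; set cU := (X in radialC1 _ X) in rU.
set aW := (X in radialC1 X _) in rW; set cW := (X in radialC1 _ X) in rW.
set aV := (X in radialC1 X _) in rV; set cV := (X in radialC1 _ X) in rV.
set w := nscale phi u in Hw *; set v := nscale _ u.
pose p x := u x + w x.
have [Hp _] := H10vD oO Hu Hw; rewrite -/p in Hp.
have pE x : p x = (1 + phi (hnorm (u x)))%:C *: u x.
  by rewrite /p /w /nscale rmorphD scalerDl scale1r.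
have p0 x : hnorm (u x) = 0 -> p x = 0 /\ u x = 0.
  by move=> /hnorm0_eq0 u0; rewrite pE u0 scaler0.
have np x : 0 < hnorm (u x) ->
    hnorm (p x) = hnorm (u x) + hnorm (u x) * phi (hnorm (u x)).
  move=> u0; rewrite pE hnormZ gtr0_norm ?addr_gt0 ?(phi_gt0 Hphi)//.
  by rewrite mulrDl mul1r [phi _ * _]mulrC.
have np0 x : 0 < hnorm (u x) -> 0 < hnorm (p x).
  by move=> u0; rewrite np// addr_gt0// mulr_gt0// (phi_gt0 Hphi).
have u0P x : hnorm (u x) = 0 \/ 0 < hnorm (u x).
  have [->|uN0] := eqVneq (hnorm (u x)) 0; first by left.
  by right; rewrite lt_neqAle eq_sym uN0 hnorm_ge0.
have HE x : 0 < hnorm (u x) -> H (hnorm (p x)) = hnorm (u x).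
  by move=> u0; rewrite np// HK.
(* Taking F = 1, phi and sqrt phi recovers u, w and v as radial multiples of p. *)
have scaleE (F : R -> R) (l : R) : 
    nscale (fun t => if 0 < t then H t * F (H t) / t else l) p = nscale F u.
  apply/funext => x; rewrite /nscale; have [u0|u0] := u0P x.
    by have [-> ->] := p0 x u0; rewrite !scaler0.
  rewrite (np0 x u0) HE// np// pE scalerC; congr (_%:C *: _).
  have ph := phi_gt0 Hphi u0; have h := addr_gt0 ltr01 ph.
  by move: (hnorm (u x)) (F _) (phi _) u0 ph h => s f r s0 r0 h; field; rewrite !gt_eqF//= addr_gt0// mulr_gt0.
have uE : nscale aU p = u.
  transitivity (nscale (fun _ => 1) u); last first.
    by apply/funext => x; rewrite /nscale scale1r.
  rewrite -(scaleE (fun _ => 1) k); congr (nscale _ p); apply/funext => t.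
  by rewrite /aU mulr1.
have wE : nscale aW p = w by exact: scaleE.
have vE : nscale aV p = v by exact: (scaleE (fun s => Num.sqrt (phi s))).
have [_ dU] := H10v_radial oO rU Hp; have [_ dW] := H10v_radial oO rW Hp.
have [Hv dV] := H10v_radial oO rV Hp.
rewrite uE in dU; rewrite wE in dW; rewrite vE in Hv dV.
apply: le_trans (hk v Hv) _; rewrite le_eqVlt; apply/orP; left; apply/eqP.
rewrite /cintegral /=; apply: Rintegral_ae_eq => //.
- exact: measurable_transformed.
- exact: measurable_bilinear.
apply: filterS3 dU dW dV => x dU dW dV Ox.
rewrite transformed_reformE reformE.
have {}dU j : wpartialv Omega j u x =
    radial_partial (aU (hnorm (p x))) (cU (hnorm (p x))) (p x) (wpartialv Omega j p x).
  exact: dU.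
have {}dW j : wpartialv Omega j w x =
    radial_partial (aW (hnorm (p x))) (cW (hnorm (p x))) (p x) (wpartialv Omega j p x).
  exact: dW.
have {}dV j : wpartialv Omega j v x =
    radial_partial (aV (hnorm (p x))) (cV (hnorm (p x))) (p x) (wpartialv Omega j p x).
  exact: dV.
(* Where u = 0 the gradients of u, w and v are k dp, (1 - k) dp and sqrt (k (1 - k)) dp. The forms
   agree because k (1 - k) is the square of the last factor, whatever dp is there. *)
have [u0|u0] := u0P x.
  have [px ux] := p0 x u0.
  have vx : v x = 0 by rewrite /v /nscale ux scaler0.
  rewrite px hnorm0 in dU dW dV; rewrite vx.
  set X := fun j => wpartialv Omega j p x.
  have -> : (fun j => wpartialv Omega j u x) = (fun j => k%:C *: X j).
    by apply/funext => j; rewrite dU radial_partial0 /aU ltxx.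
  have -> : (fun j => wpartialv Omega j w x) = (fun j => (1 - k)%:C *: X j).
    by apply/funext => j; rewrite dW radial_partial0 /aW ltxx.
  have E c : (fun j => radial_partial 1 c 0 (wpartialv Omega j v x)) =
      (fun j => (Num.sqrt (k * (1 - k)))%:C *: X j).
    apply/funext => j; rewrite radial_partial0 scale1r dV radial_partial0.
    by rewrite /aV ltxx.
  by rewrite !E !reform_scale -expr2 sqr_sqrtr// mulr_ge0// subr_ge0.
have t0 := np0 x u0; have s0 := HE x u0.
have EU : (fun j => wpartialv Omega j u x) = (fun j => radial_partial
    (hnorm (u x) / hnorm (p x)) (dsum_id phi (hnorm (u x))) (p x) (wpartialv Omega j p x)).
  by apply/funext => j; rewrite dU /aU /cU t0 s0.
have EW : (fun j => wpartialv Omega j w x) = (fun j => radial_partial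
    (hnorm (u x) * phi (hnorm (u x)) / hnorm (p x)) (1 - dsum_id phi (hnorm (u x)))
    (p x) (wpartialv Omega j p x)).
  by apply/funext => j; rewrite dW /aW /cW t0 s0.
have vx : v x = (hnorm (u x) * Num.sqrt (phi (hnorm (u x))) / hnorm (p x))%:C *: p x.
  by rewrite -vE /nscale /aV t0 s0.
have EV c : (fun j => radial_partial 1 c (v x) (wpartialv Omega j v x)) =
    (fun j => radial_partial 1 c (v x) (radial_partial
      (hnorm (u x) * Num.sqrt (phi (hnorm (u x))) / hnorm (p x))
      (dsum_sqrt phi (hnorm (u x))) (p x) (wpartialv Omega j p x))).
  by apply/funext => j; rewrite dV /aV /cV t0 s0.
apply: (etrans (f_equal2 (reform (fun h k => A h k x)) (EV _) (EV _))); rewrite vx.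
apply: (etrans (decomposition_reform _ _ u0 t0)).
exact: (f_equal2 (reform (fun h k => A h k x)) (esym EU) (esym EW)).
Qed.

End transformed.

(** * Passage to the limit in the truncation *)

Section dissipative.
Context {R : realType} {N m : nat}.
Variables (Omega : set 'rV[R]_N) (A : 'I_N -> 'I_N -> 'rV[R]_N -> 'M[R[i]]_m).
Variable phi : R -> R.
Hypothesis oO : open Omega.
Hypothesis AL : forall h k i j, Linfty Omega (fun x => A h k x i j).
Hypothesis Hphi : phi_admissible phi.
Notation mu := (lebesgueN N).
Let mO : measurable Omega := open_measurable_rV oO.
Implicit Types (u v w : 'rV[R]_N -> 'cV[R[i]]_m).

Lemma Linfty_bound : exists2 M : R, 0 <= M &
  {ae mu, forall x, Omega x -> forall h k i j, Normc.normc (A h k x i j) <= M}.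
Proof.
pose I := ('I_N * 'I_N * ('I_m * 'I_m))%type.
have /choice[B hB] (p : I) : exists B : R, {ae mu, forall x, Omega x ->
    Normc.normc (A p.1.1 p.1.2 x p.2.1 p.2.2) <= B}.
  by have [_] := AL p.1.1 p.1.2 p.2.1 p.2.2.
exists (\sum_p `|B p|); first exact: sumr_ge0.
have : {ae mu, forall x, forall p : I, Omega x ->
    Normc.normc (A p.1.1 p.1.2 x p.2.1 p.2.2) <= B p}.
  by apply: filter_forall => p; exact: hB.
apply: filterS => x hx Ox h k i j; apply: (le_trans (hx ((h, k), (i, j)) Ox)).
rewrite (bigD1 ((h, k), (i, j)))//= (le_trans (ler_norm _))// lerDl.
exact: sumr_ge0.
Qed.

Section cutoff_scaling.
Variables (n : nat) (d : R).
Hypothesis d0 : 0 < d.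
Let aU := elastic_value (zeta phi) n d.
Let aW := elastic_value (fun t => t ^+ 2 / zeta phi t) n d.
Let aV := elastic_value (fun t => t) n d.

(** zeta cancels in the product, which is (T / t)^2 with T the cutoff. This bound is uniform in d,
    while the single factors may be unbounded as d -> 0. *)
Lemma elastic_value_mul t : 0 <= aU t * aW t <= 1.
Proof.
rewrite /aU /aW /elastic_value; case: ifP => t0; last by rewrite mulr0 lexx ler01.
have Tt := cutoff_gt0 n d0 t0; have Tle := cutoff_le n d0 t0.
have [z0 _] := zetaP Hphi Tt; move: (zeta phi _) z0 Tle Tt => z z0.
move: (cutoff n d t) => T Tle T0.
have -> : z / t * (T ^+ 2 / z / t) = (T / t) ^+ 2 by field; rewrite !gt_eqF.
rewrite sqr_ge0 /= exprn_ile1// ?divr_ge0 ?(ltW T0) ?(ltW t0)//.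
by rewrite ler_pdivrMr// mul1r.
Qed.

Lemma elastic_value_id_le1 t : 0 <= aV t <= 1.
Proof.
rewrite /aV /elastic_value; case: ifP => t0; last by rewrite lexx ler01.
have Tt := cutoff_gt0 n d0 t0; have Tle := cutoff_le n d0 t0.
by rewrite divr_ge0 ?(ltW Tt) ?(ltW t0)//= ler_pdivrMr// mul1r.
Qed.

(** If |v| is truncated to T and |u| = zeta T, then sqrt (phi |u|) |u| = T and phi |u| |u| = T^2 /
    zeta T, by the definition of zeta. *)
Lemma nscale_cutoff v : nscale phi (nscale aU v) = nscale aW v /\
  nscale (fun s => Num.sqrt (phi s)) (nscale aU v) = nscale aV v.
Proof.
suff E (F G : R -> R) : (forall t : R, 0 < t ->
    F (zeta phi (cutoff n d t)) * (zeta phi (cutoff n d t) / t) = G t) ->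
    nscale F (nscale aU v) = nscale G v.
  split; apply: E => t t0; have Tt := cutoff_gt0 n d0 t0; have [z0 gz] := zetaP Hphi Tt;
    rewrite /aW /aV /elastic_value t0; move: gz; move: (cutoff n d t) (zeta phi _) z0 => T z z0 <-.
    rewrite exprMn -(phi_sqrt Hphi z0); move: (phi z) => f.
    by field; rewrite !gt_eqF.
  by rewrite mulrA [_ * z]mulrC.
move=> FG; apply/funext => x; rewrite /nscale.
have [V0|VN0] := eqVneq (hnorm (v x)) 0; first by rewrite (hnorm0_eq0 V0) !scaler0.
have t0 : 0 < hnorm (v x) by rewrite lt_neqAle eq_sym VN0 hnorm_ge0.
have [z0 _] := zetaP Hphi (cutoff_gt0 n d0 t0).
have aE : aU (hnorm (v x)) = zeta phi (cutoff n d (hnorm (v x))) / hnorm (v x).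
  by rewrite /aU /elastic_value t0.
have a0 : 0 < aU (hnorm (v x)) by rewrite aE divr_gt0.
rewrite hnormZ (gtr0_norm a0) scalerC -(FG _ t0) aE divfK ?lt0r_neq0//.
Qed.

End cutoff_scaling.

Lemma radial_partial_null (a c : R) (V : 'cV[R[i]]_m) : radial_partial a c V 0 = 0.
Proof. by rewrite /radial_partial scaler0 add0r rdotC rdot0l mulr0 scale0r. Qed.

Lemma reform_null (B : 'I_N -> 'I_N -> 'M[R[i]]_m) (X Y : 'I_N -> 'cV[R[i]]_m) :
  (forall h, Y h = 0) -> reform B X Y = 0.
Proof.
move=> Y0; rewrite /reform big1// => h _; rewrite big1// => k _.
by rewrite Y0 rdotC rdot0l.
Qed.

Lemma radial_partial_bound (a c K : R) (V X : 'cV[R[i]]_m) : 0 <= a ->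
  0 <= c <= K * a -> hnorm (radial_partial a c V X) <= (K + 2) * a * hnorm X.
Proof.
move=> a0 /andP[c0 cK]; apply: (le_trans (radial_partial_le _ _ _ _)).
apply: ler_wpM2r; first exact: hnorm_ge0.
rewrite (ger0_norm a0); have := ler_normB c a; rewrite (ger0_norm c0) (ger0_norm a0).
by move: `|c - a| => r; lra.
Qed.

Lemma sum_mul_le (x : 'I_N -> R) :
  (\sum_k x k) * (\sum_h x h) <= 2 * N%:R * \sum_k x k ^+ 2.
Proof.
have -> : 2 * N%:R * \sum_k x k ^+ 2 = \sum_k \sum_h (x k ^+ 2 + x h ^+ 2).
  transitivity (\sum_(k < N) (x k ^+ 2 *+ N + \sum_h x h ^+ 2)).
    rewrite big_split /= sumr_const card_ord sumrMnl -mulr2n.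
    by rewrite -mulrA mulr_natl mulr_natl.
  by apply: eq_bigr => k _; rewrite big_split /= sumr_const card_ord.
rewrite mulr_suml; apply: ler_sum => k _; rewrite mulr_sumr; apply: ler_sum => h _.
by have := sqr_ge0 (x k - x h); nra.
Qed.

(** Since c and c' are bounded by K a and K a', the form is controlled by the product a a' alone;
    the resulting constant is therefore free of the truncation parameter. *)
Lemma reform_radial_le (B : 'I_N -> 'I_N -> 'M[R[i]]_m) (V : 'cV[R[i]]_m)
    (X : 'I_N -> 'cV[R[i]]_m) (M K a c a' c' : R) :
  (forall h k i j, Normc.normc (B h k i j) <= M) -> 0 <= M -> 0 <= K ->
  0 <= a -> 0 <= c <= K * a -> 0 <= a' -> 0 <= c' <= K * a' -> a * a' <= 1 ->
  `|reform B (fun k => radial_partial a c V (X k))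
             (fun h => radial_partial a' c' V (X h))| <=
  m%:R ^+ 2 * M * (K + 2) ^+ 2 * (2 * N%:R) * \sum_k hnorm (X k) ^+ 2.
Proof.
move=> BM M0 K0 a0 cK a'0 cK' aa; apply: (le_trans (reform_le _ _ BM)).
rewrite -(mulrA (m%:R ^+ 2 * M * (K + 2) ^+ 2)) -(mulrA (m%:R ^+ 2 * M)).
apply: ler_wpM2l; first by apply: mulr_ge0 => //; exact: exprn_ge0.
have le b g : 0 <= b -> 0 <= g <= K * b -> \sum_k hnorm (radial_partial b g V (X k)) <=
    (K + 2) * b * \sum_k hnorm (X k).
  move=> b0 gK; rewrite mulr_sumr; apply: ler_sum => k _; exact: radial_partial_bound.
have ge (Y : 'I_N -> 'cV[R[i]]_m) : 0 <= \sum_k hnorm (Y k).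
  by apply: sumr_ge0 => k _; exact: hnorm_ge0.
apply: (le_trans (ler_pM (ge _) (ge _) (le a c a0 cK) (le a' c' a'0 cK'))).
have h := sum_mul_le (fun k => hnorm (X k)).
have -> : (K + 2) * a * (\sum_k hnorm (X k)) * ((K + 2) * a' * \sum_k hnorm (X k)) =
  (K + 2) ^+ 2 * (a * a' * ((\sum_k hnorm (X k)) * \sum_k hnorm (X k))).
  by move: (\sum_k hnorm (X k)) => y; ring.
apply: ler_wpM2l; first exact: sqr_ge0.
apply: (le_trans _ h); apply: ler_piMl => //; exact: mulr_ge0.
Qed.

(** The limiting gradients carry the scalar factors E t / t and E' t / t, whose product is 1; they
    cancel in the form and leave only the radial factors e and e'. *)
Lemma elastic_form_cvg (E e E' e' : R -> R) q n (B : 'I_N -> 'I_N -> 'M[R[i]]_m)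
    (V : 'cV[R[i]]_m) (X : 'I_N -> 'cV[R[i]]_m) (t := hnorm V) :
  elastic E e q -> elastic E' e' q -> 0 < t -> E t / t * (E' t / t) = 1 ->
  (fun j : nat => reform B
    (fun k => radial_partial (elastic_value E n.+1 j.+1%:R^-1 t)
                (elastic_slope E e n.+1 j.+1%:R^-1 t) V (X k))
    (fun k => radial_partial (elastic_value E' n.+1 j.+1%:R^-1 t)
                (elastic_slope E' e' n.+1 j.+1%:R^-1 t) V (X k))) @ \oo -->
  reform B (fun k => radial_partial 1 (e t) V (X k))
           (fun k => radial_partial 1 (e' t) V (X k)).
Proof.
move=> Ee Ee' t0 EE; have [h1 h2] := elastic_cvg Ee n t0; have [h3 h4] := elastic_cvg Ee' n t0.
have lim := reform_radial_cvg (A := B) (X := X) (V := V) h1 h2 h3 h4.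
have scale F f : (fun k => radial_partial (F t / t) (f t * (F t / t)) V (X k)) =
    (fun k => (F t / t)%:C *: radial_partial 1 (f t) V (X k)).
  by apply/funext => k; rewrite [f t * _]mulrC -radial_partialZ mulr1.
refine (eq_ind _ (fun l : R => _ @ \oo --> l) lim _ _).
by apply: (etrans (f_equal2 (reform B) (scale E e) (scale E' e'))); rewrite reform_scale EE mul1r.
Qed.

Lemma cutoff_norm_cvg n (V Y : 'cV[R[i]]_m) (t : R) : 0 < t ->
  (fun j : nat => hnorm (radial_partial (elastic_value (fun t => t) n.+1 j.+1%:R^-1 t)
    (elastic_slope (fun t => t) (fun _ => 1) n.+1 j.+1%:R^-1 t) V Y) ^+ 2) @ \oo -->
  hnorm Y ^+ 2.
Proof.
move=> t0; have [h1 h2] := elastic_cvg (id_elastic 0) n t0.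
have tt : t / t = 1 by rewrite mulfV// gt_eqF.
rewrite tt in h1 h2; rewrite mulr1 in h2.
have := hnorm_radial_cvg (Y := Y) (V := V) h1 h2.
suff -> : radial_partial 1 1 V Y = Y by [].
by rewrite /radial_partial subrr mul0r mul0r scale0r addr0 scale1r.
Qed.

Lemma dissipative_transformed : strict_dissipative Omega A phi ->
  exists2 kappa : R, 0 < kappa & forall v, H10v Omega v ->
    kappa * dirichlet Omega v <=
    complex.Re (cintegral Omega (transformed_integrand Omega A phi v)).
Proof.
move=> [kappa k0 hk]; exists kappa => // v Hv.
(* One q serves zeta, its companion and the identity, so a single exponent n0 truncates u, w and v
   consistently. *)
have [q [EU EW]] := zeta_elastic Hphi; have EV := @id_elastic R q.
pose n0 := (q.*2).+1; pose d j : R := j.+1%:R^-1.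
have d0 j : 0 < d j by rewrite invr_gt0.
pose E2 (t : R) := t ^+ 2 / zeta phi t; pose L := Lambda phi.
pose aU j := elastic_value (zeta phi) n0 (d j).
pose cU j := elastic_slope (zeta phi) (fun t => 1 + L t) n0 (d j).
pose aW j := elastic_value E2 n0 (d j).
pose cW j := elastic_slope E2 (fun t => 1 - L t) n0 (d j).
pose aV j := elastic_value (fun t : R => t) n0 (d j).
pose cV j := elastic_slope (fun t : R => t) (fun _ => 1) n0 (d j).
have rU j : radialC1 (aU j) (cU j) by exact: elastic_radial EU _ (d0 j).
have rW j : radialC1 (aW j) (cW j) by exact: elastic_radial EW _ (d0 j).
have rV j : radialC1 (aV j) (cV j) by exact: elastic_radial EV _ (d0 j).
pose K : R := 2 * n0.+1%:R.
have K0 : 0 <= K by rewrite mulr_ge0.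
have bU j t : 0 <= aU j t /\ 0 <= cU j t <= K * aU j t.
  by split; [exact: (elastic_value_ge0 EU n0 t (d0 j))|exact: (elastic_slope_bound EU n0 t (d0 j))].
have bW j t : 0 <= aW j t /\ 0 <= cW j t <= K * aW j t.
  by split; [exact: (elastic_value_ge0 EW n0 t (d0 j))|exact: (elastic_slope_bound EW n0 t (d0 j))].
have bV j t : 0 <= aV j t /\ 0 <= cV j t <= K * aV j t.
  by split; [exact: (elastic_value_ge0 EV n0 t (d0 j))|exact: (elastic_slope_bound EV n0 t (d0 j))].
pose u j := nscale (aU j) v.
have uw j : nscale phi (u j) = nscale (aW j) v by exact: (nscale_cutoff n0 (d0 j) v).1.
have uv j : nscale (fun s => Num.sqrt (phi s)) (u j) = nscale (aV j) v.
  exact: (nscale_cutoff n0 (d0 j) v).2.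
have HU j := H10v_radial oO (rU j) Hv.
have HW j := H10v_radial oO (rW j) Hv.
have HV j := H10v_radial oO (rV j) Hv.
pose S x := \sum_k hnorm (wpartialv Omega k v x) ^+ 2.
have iS : mu.-integrable Omega (EFin \o S) by exact: H10v_gradient_integrable.
have aeU := ae_foralln (fun j => (HU j).2).
have aeW := ae_foralln (fun j => (HW j).2).
have aeV := ae_foralln (fun j => (HV j).2).
(* The truncation multipliers vanish at 0, so the truncated integrands are 0 where v = 0, whereas
   the limiting ones contain dv. Both limits below need dv = 0 a.e. on that set. *)
have zero := wpartialv_zero_set oO Hv.
have [M M0 aeM] := Linfty_bound.
have cvgR : complex.Re (cintegral Omega (fun x => \sum_(h < N) \sum_(k < N)
      hdot (A h k x *m wpartialv Omega k (u j) x)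
           (wpartialv Omega h (nscale (aW j) v) x))) @[j --> \oo] -->
    complex.Re (cintegral Omega (transformed_integrand Omega A phi v)).
  pose C := m%:R ^+ 2 * M * (K + 2) ^+ 2 * (2 * N%:R).
  have [||||_] := @Rdominated_cvg _ _ Omega oO
    (fun j x => complex.Re (\sum_(h < N) \sum_(k < N)
      hdot (A h k x *m wpartialv Omega k (u j) x)
           (wpartialv Omega h (nscale (aW j) v) x)))
    (fun x => complex.Re (transformed_integrand Omega A phi v x)) (fun x => C * S x).
  - move=> j; exact: (measurable_bilinear oO AL (proj1 (HU j)) (proj1 (HW j))).
  - exact: (measurable_transformed oO AL Hphi Hv).
  - exact: (integrableZ oO C iS).
  - apply: filterS2 (filterI aeU aeW) (filterI zero aeM) => x [hU hW] [h0 hM] Ox.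
    have FE j : complex.Re (\sum_(h < N) \sum_(k < N)
        hdot (A h k x *m wpartialv Omega k (u j) x)
           (wpartialv Omega h (nscale (aW j) v) x)) =
      reform (fun h k => A h k x)
        (fun k => radial_partial (aU j (hnorm (v x))) (cU j (hnorm (v x))) (v x)
                    (wpartialv Omega k v x))
        (fun k => radial_partial (aW j (hnorm (v x))) (cW j (hnorm (v x))) (v x)
                    (wpartialv Omega k v x)).
      apply: (etrans (reformE _ _ _)); apply: (f_equal2 (reform (fun h k => A h k x))).
        by apply/funext => k; exact: hU.
      by apply/funext => k; exact: hW.
    split=> [j|].
      rewrite FE; have [a0 c0] := bU j (hnorm (v x)); have [a1 c1] := bW j (hnorm (v x)).
      apply: reform_radial_le => //; first exact: hM.
      by have /andP[] := elastic_value_mul n0 (d0 j) (hnorm (v x)).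
    apply: cvg_trans; first by apply: near_eq_cvg; near=> j; exact/esym/FE.
    have [V0|VN0] := eqVneq (hnorm (v x)) 0.
      have X0 k : wpartialv Omega k v x = 0 by apply: h0 => //; exact: hnorm0_eq0.
      have Y0 a c h : radial_partial a c (v x) (wpartialv Omega h v x) = 0.
        by rewrite X0 radial_partial_null.
      rewrite (transformed_reformE Omega A phi) reform_null//.
      by apply: cvg_near_cst; near=> j; exact: reform_null.
    have V0 : 0 < hnorm (v x) by rewrite lt_neqAle eq_sym VN0 hnorm_ge0.
    rewrite (transformed_reformE Omega A phi).
    have [z0 _] := zetaP Hphi V0.
    apply: (elastic_form_cvg _ EU EW V0).
    by move: (zeta phi _) z0 => z z0; field; rewrite !gt_eqF.
  by [].
have cvgL : dirichlet Omega (nscale (aV j) v) @[j --> \oo] --> dirichlet Omega v.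
  have [||||_] := @Rdominated_cvg _ _ Omega oO
    (fun j x => \sum_(k < N) hnorm (wpartialv Omega k (nscale (aV j) v) x) ^+ 2)
    S (fun x => (K + 2) ^+ 2 * S x).
  - move=> j; have /integrableP[/measurable_EFinP] := H10v_gradient_integrable oO (HV j).1.
    by [].
  - by have /integrableP[/measurable_EFinP] := iS.
  - exact: integrableZ.
  - apply: filterS2 aeV zero => x hV h0 Ox.
    have E j k : wpartialv Omega k (nscale (aV j) v) x =
        radial_partial (aV j (hnorm (v x))) (cV j (hnorm (v x))) (v x) (wpartialv Omega k v x).
      exact: hV.
    split=> [j|].
      have ge0 (Y : 'I_N -> 'cV[R[i]]_m) : 0 <= \sum_k hnorm (Y k) ^+ 2.
        by apply: sumr_ge0 => k _; exact: sqr_ge0.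
      rewrite ger0_norm// /S mulr_sumr; apply: ler_sum => k _; rewrite E.
      have [a0 c0] := bV j (hnorm (v x)).
      have /andP[_ a1] := elastic_value_id_le1 n0 (d0 j) (hnorm (v x)).
      rewrite -exprMn ler_pXn2r ?nnegrE ?mulr_ge0 ?addr_ge0 ?hnorm_ge0//.
      apply: (le_trans (radial_partial_bound _ _ a0 c0)); apply: ler_wpM2r; first exact: hnorm_ge0.
      by rewrite ler_piMr// addr_ge0.
    rewrite /S; apply: cvg_big => [|k _]; first exact: add_continuous.
    refine (eq_ind_r (fun f : nat -> R => f @ \oo --> _) _
      (funext (fun j => congr1 (fun y => hnorm y ^+ 2) (E j k)))).
    have [V0|VN0] := eqVneq (hnorm (v x)) 0.
      have X0 : wpartialv Omega k v x = 0 by apply: h0 => //; exact: hnorm0_eq0.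
      by apply: cvg_near_cst; near=> j; rewrite X0 radial_partial_null.
    have V0 : 0 < hnorm (v x) by rewrite lt_neqAle eq_sym VN0 hnorm_ge0.
    exact: (@cutoff_norm_cvg (q.*2) (v x) (wpartialv Omega k v x) _ V0).
  by [].
apply: (ler_cvg_to (cvgM (cvg_cst kappa) cvgL) cvgR).
near=> j; have := hk (u j) (proj1 (HU j)).
by rewrite (uw j) (uv j); apply; exact: proj1 (HW j).
Unshelve. all: by end_near. Qed.

End dissipative.

Theorem lemma7 (R : realType) (N m : nat) (N_gt0 : (0 < N)%N) (m_gt0 : (0 < m)%N)
  (Omega : set 'rV[R]_N) (A : 'I_N -> 'I_N -> 'rV[R]_N -> 'M[R[i]]_m)
  (phi : R -> R) :
  domain Omega ->
  (forall h k i j, Linfty Omega (fun x => A h k x i j)) ->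
  phi_admissible phi ->
  strict_dissipative Omega A phi <->
  exists2 kappa : R, 0 < kappa &
    forall v : 'rV[R]_N -> 'cV[R[i]]_m, H10v Omega v ->
      kappa * dirichlet Omega v <=
      complex.Re (cintegral Omega (transformed_integrand Omega A phi v)).
Proof.
move=> [oO _ _] AL Hphi; split; first exact: dissipative_transformed.
exact: transformed_dissipative.
Qed.
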